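(* Let $K$ be a number field, $\mathfrak{n}$ a nonzero integral ideal of $\mathcal{O}_K$, and let $\mathbb{T}$ be the algebra of formal Hecke operators of level $\mathfrak{n}$ (acting on $\mathbb{Q}\mathcal{M}$, where $\mathcal{M}$ is either $\mathcal{M}_0(\mathfrak{n})$ or $\mathcal{M}_1(\mathfrak{n})$). Let $\lambda_1,\lambda_2:\mathbb{T}\to\mathbb{C}$ be two eigenvalue systems of level $\mathfrak{n}$. Then $\lambda_1$ and $\lambda_2$ have the same restriction to the subalgebra $\mathbb{T}_1$ of principal operators if and only if $\lambda_2=\lambda_1\otimes\psi$ for some unramified character $\psi$ (that is, a character $\psi:\mathrm{Cl}(K)\to\mathbb{C}^\times$). In this case, the characters $\chi_1,\chi_2$ of $\lambda_1,\lambda_2$ satisfy $\chi_2=\chi_1\psi^2$, and hence $\lambda_1$ and $\lambda_2$ have the same character if and only if $\psi$ is quadratic (meaning $\psi^2=1$, the trivial character being allowed).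
   Context: Lattices. $\widehat{K}=K\otimes_{\mathbb{Q}}\mathbb{R}$, with $K$ embedded diagonally. An $\mathcal{O}_K$-lattice is a finitely generated $\mathcal{O}_K$-submodule $L\subset\widehat{K}^2$ (row vectors) with $\dim_K(KL)=2$ and $\widehat{K}L=\widehat{K}^2$. Every lattice is isomorphic to $\mathcal{O}_K\oplus\mathfrak{a}$ for some ideal $\mathfrak{a}$; its class is $[L]=[\mathfrak{a}]\in\mathrm{Cl}(K)$. If $L\subseteq M$ are lattices with $M/L\cong\mathcal{O}_K/\mathfrak{a}_1\oplus\mathcal{O}_K/\mathfrak{a}_2$, the index ideal is $[M:L]=\mathfrak{a}_1\mathfrak{a}_2$. Ideals are nonzero. Modular points. $\mathcal{M}_0(\mathfrak{n})$ is the set of pairs $(L,L')$ of lattices with $L\subseteq L'$ and $L'/L\cong\mathcal{O}_K/\mathfrak{n}$. $\mathcal{M}_1(\mathfrak{n})$ is the set of triples $(L,L',\beta)$ with $(L,L')\in\mathcal{M}_0(\mathfrak{n})$ and $\beta\in L'$ such that $L'=L+\mathcal{O}_K\beta$, where $(L,L',\beta_1)$ and $(L,L',\beta_2)$ are identified when $\beta_1-\beta_2\in L$. The class of a modular point is $[L]$. For $\mathcal{M}=\mathcal{M}_0(\mathfrak{n})$ or $\mathcal{M}_1(\mathfrak{n})$, $\mathbb{Q}\mathcal{M}$ is the $\mathbb{Q}$-vector space with basis $\mathcal{M}$. Hecke operators (on $\mathbb{Q}\mathcal{M}_1(\mathfrak{n})$; on $\mathbb{Q}\mathcal{M}_0(\mathfrak{n})$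 ignore the third component). For each integral ideal $\mathfrak{a}$, $$T_{\mathfrak{a}}(L,L',\beta)=N(\mathfrak{a})^{-1}\sum (M,M+L',\beta),$$ the sum over all lattices $M\supseteq L$ with $[M:L]=\mathfrak{a}$ and $(M+L')/M\cong\mathcal{O}_K/\mathfrak{n}$. For each fractional ideal $\mathfrak{a}$ coprime to $\mathfrak{n}$, $$T_{\mathfrak{a},\mathfrak{a}}(L,L',\beta)=N(\mathfrak{a})^{-2}(\mathfrak{a}^{-1}L,\mathfrak{a}^{-1}L',\beta),$$ where $\beta$ is first chosen modulo $L$ so that $\beta\in L'\cap\mathfrak{a}^{-1}L'$ (always possible, and the result is well defined). $\mathbb{T}$ is the (commutative) $\mathbb{Q}$-algebra of operators on $\mathbb{Q}\mathcal{M}$ generated by all $T_{\mathfrak{a}}$ ($\mathfrak{a}$ integral) and all $T_{\mathfrak{a},\mathfrak{a}}$ ($\mathfrak{a}$ fractional, coprime to $\mathfrak{n}$). It is spanned by the operators $T_{\mathfrak{a},\mathfrak{a}}T_{\mathfrak{b}}$, whose class is $[\mathfrak{a}]^2[\mathfrak{b}]$, and is graded: $\mathbb{T}=\bigoplus_{c\in\mathrm{Cl}(K)}\mathbb{T}_c$ with $\mathbb{T}_c$ spanned by the $T_{\mathfrak{a},\mathfrak{a}}T_{\mathfrak{b}}$ of class $c$. $\mathbb{T}_1$ is the component of the trivial class, the subalgebra of principal operators. Eigenvalue systems. An eigenvalue system of level $\mathfrak{n}$ is a (unital) ring homomorphism $\lambda:\mathbb{T}\to\mathbb{C}$. It is determined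 by the functions $\alpha(\mathfrak{a})=\lambda(T_{\mathfrak{a}})$ ($\mathfrak{a}$ integral) and $\chi(\mathfrak{a})=\lambda(T_{\mathfrak{a},\mathfrak{a}})$ ($\mathfrak{a}$ in the group $\mathcal{J}_K^{\mathfrak{n}}$ of fractional ideals coprime to $\mathfrak{n}$); one writes $\lambda=(\alpha,\chi)$, and the homomorphism $\chi:\mathcal{J}_K^{\mathfrak{n}}\to\mathbb{C}^\times$ is called the character of $\lambda$. For an unramified character $\psi$, regarded as a function on ideals through their classes, the twist $\lambda\otimes\psi$ is the eigenvalue system $(\alpha\psi,\chi\psi^2)$, i.e. $(\lambda\otimes\psi)(T_{\mathfrak{a}})=\psi(\mathfrak{a})\lambda(T_{\mathfrak{a}})$ and $(\lambda\otimes\psi)(T_{\mathfrak{a},\mathfrak{a}})=\psi(\mathfrak{a})^2\lambda(T_{\mathfrak{a},\mathfrak{a}})$. *)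

(* Defs.v *)
From HB Require Import structures.
From mathcomp Require Import all_boot all_order all_algebra all_field.
From mathcomp Require Import generic_quotient.
From mathcomp Require Import finmap boolp classical_sets functions cardinality fsbigop reals.
From mathcomp Require Import complex.
From mathcomp Require Import monalg.

Set Implicit Arguments.
Unset Strict Implicit.
Unset Printing Implicit Defensive.

Import Order.TTheory GRing.Theory Num.Theory.
Local Open Scope classical_set_scope.
Local Open Scope ring_scope.
Local Open Scope quotient_scope.

(* A number field is a [K : fieldExtType rat]; submodules of K and of the
   space \hat K^2 are represented by classical sets. *)

Definition sumset (U : zmodType) (A B : set U) : set U :=
  [set z | exists x y, [/\ A x, B y & z = x + y]].

(* The finite sums of products [act x y] with x in A and y in B *)
Definition prodset (S U : zmodType) (act : S -> U -> U)
    (A : set S) (B : set U) : set U :=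
  [set z | exists (k : nat) (x : 'I_k -> S) (y : 'I_k -> U),
     [/\ forall i, A (x i), forall i, B (y i) & z = \sum_i act (x i) (y i)]].

Section Integers.
Variable K : fieldExtType rat.

Definition ringInt : set K := [set x | integralOver (intr : int -> K) x].

(* [quot_iso actU actV B A D C]: for O_K-modules A <= B (with scalar action
   [actU]) and C <= D (with scalar action [actV]), B/A and D/C are isomorphic
   O_K-modules.  The isomorphism is given by a choice [f] of representatives:
   modulo C it is additive, O_K-linear, with kernel A, and onto D/C. *)
Definition quot_iso (U V : zmodType) (actU : K -> U -> U) (actV : K -> V -> V)
    (B A : set U) (D C : set V) : Prop :=
  exists f : U -> V,
    [/\ forall x, B x -> D (f x),
        forall x y, B x -> B y -> C (f (x + y) - (f x + f y)),
        forall r x, ringInt r -> B x -> C (f (actU r x) - actV r (f x)),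
        forall x, B x -> (C (f x) <-> A x)
      & forall z, D z -> exists2 x, B x & C (z - f x)].

Definition is_submodK (I : set K) : Prop :=
  [/\ I 0, forall x y, I x -> I y -> I (x + y)
    & forall r x, ringInt r -> I x -> I (r * x)].

Definition is_fracideal (I : set K) : Prop :=
  [/\ is_submodK I, exists2 x, I x & x != 0
    & exists d, [/\ ringInt d, d != 0 & forall x, I x -> ringInt (d * x)]].

Definition is_intideal (I : set K) : Prop :=
  [/\ is_submodK I, exists2 x, I x & x != 0 & I `<=` ringInt].

Definition idmul (I J : set K) : set K := prodset *%R I J.

Definition idinv (I : set K) : set K :=
  [set x | forall y, I y -> ringInt (x * y)].

Definition idcoprime (I J : set K) : Prop := sumset I J = ringInt.

Definition is_fracideal_coprime (n I : set K) : Prop :=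
  is_fracideal I /\
  exists b c, [/\ is_intideal b, is_intideal c, idcoprime b n, idcoprime c n
    & idmul I c = b].

(* The norm #(O_K/I) of an integral ideal I *)
Definition intnorm (I : set K) : nat :=
  #|` fset_set [set sumset [set x] I | x in ringInt]|.

(* Its multiplicative extension N(b/c) = N(b)/N(c) to fractional ideals *)
Definition fracnorm (I : set K) : rat :=
  xget 0 [set q | exists b c, [/\ is_intideal b, is_intideal c, idmul I c = b
                               & q = (intnorm b)%:R / (intnorm c)%:R]].

End Integers.

Arguments ringInt {K}.

Section ClassGroup.
Variable K : fieldExtType rat.

Lemma ringInt0 : ringInt (0 : K).
Proof. exact: integral0. Qed.

Lemma ringInt1 : ringInt (1 : K).
Proof. exact: integral1. Qed.

Lemma ringIntM (x y : K) : ringInt x -> ringInt y -> ringInt (x * y).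
Proof. exact: integral_mul. Qed.

Lemma ringIntD (x y : K) : ringInt x -> ringInt y -> ringInt (x + y).
Proof. exact: integral_add. Qed.

Lemma prodsetD (S U : zmodType) (act : S -> U -> U) A B (u v : U) :
  prodset act A B u -> prodset act A B v -> prodset act A B (u + v).
Proof.
move=> [k [x [y [Ax By ->]]]] [k' [x' [y' [Ax' By' ->]]]].
exists (k + k')%N.
exists (fun i => match fintype.split i with inl a => x a | inr a => x' a end).
exists (fun i => match fintype.split i with inl a => y a | inr a => y' a end).
split=> [i|i|]; try by case: (fintype.split i).
by rewrite big_split_ord /=; congr (_ + _); apply: eq_bigr => i _;
  rewrite ?(unsplitK (inl i)) ?(unsplitK (inr i)).
Qed.

Lemma prodset1 (S U : zmodType) (act : S -> U -> U) (A : set S) (B : set U) x y :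
  A x -> B y -> prodset act A B (act x y).
Proof.
move=> Ax By; exists 1%N, (fun=> x), (fun=> y); split=> //.
by rewrite big_ord1.
Qed.

Lemma ringInt_sum k (F : 'I_k -> K) :
  (forall i, ringInt (F i)) -> ringInt (\sum_i F i).
Proof.
by move=> h; apply: (big_ind ringInt) => //; [exact: ringInt0|exact: ringIntD].
Qed.

Lemma fracideal_ringInt : is_fracideal (ringInt : set K).
Proof.
split; first by split; [exact: ringInt0|exact: ringIntD|exact: ringIntM].
- by exists 1; [exact: ringInt1|exact: oner_neq0].
- by exists 1; split; [exact: ringInt1|exact: oner_neq0|move=> x; rewrite mul1r].
Qed.

Lemma intideal_frac (I : set K) : is_intideal I -> is_fracideal I.
Proof.
case=> sI nI sub; split=> //.
by exists 1; split; [exact: ringInt1|exact: oner_neq0|move=> x /sub; rewrite mul1r].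
Qed.

Lemma fracidealM (I J : set K) :
  is_fracideal I -> is_fracideal J -> is_fracideal (idmul I J).
Proof.
move=> [[I0 ID IM] [x Ix x0] [d [Od d0 dI]]] [[J0 JD JM] [y Jy y0] [e [Oe e0 eJ]]].
split.
- split.
  + by exists 0%N, (fun=> 0), (fun=> 0); rewrite big_ord0; split => // -[].
  + by move=> u v; exact: prodsetD.
  + move=> r u Or [k [a [b [Ia Jb ->]]]].
    exists k, (fun i => r * a i), b; split=> // [i|]; first exact: IM.
    by rewrite mulr_sumr; apply: eq_bigr => i _; rewrite mulrA.
- by exists (x * y); [exact: prodset1|rewrite mulf_neq0].
- exists (d * e); split; [exact: ringIntM|by rewrite mulf_neq0|].
  move=> u [k [a [b [Ia Jb ->]]]]; rewrite mulr_sumr; apply: ringInt_sum => i.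
  by rewrite mulrACA; apply: ringIntM; [exact: dI|exact: eJ].
Qed.

Record fracideal := FracIdeal
  { fracideal_set :> set K; fracidealP : is_fracideal fracideal_set }.

Record intideal := IntIdeal
  { intideal_set :> set K; intidealP : is_intideal intideal_set }.

Record fracideal_coprime (n : set K) := FracIdealCoprime
  { fracideal_coprime_set :> set K;
    fracideal_coprimeP : is_fracideal_coprime n fracideal_coprime_set }.

HB.instance Definition _ := gen_eqMixin fracideal.
HB.instance Definition _ := gen_choiceMixin fracideal.

Definition frac_of_int (I : intideal) : fracideal :=
  FracIdeal (intideal_frac (intidealP I)).

Definition frac_of_coprime (n : set K) (I : fracideal_coprime n) : fracideal :=
  FracIdeal (proj1 (fracideal_coprimeP I)).

Definition frac1 : fracideal := FracIdeal fracideal_ringInt.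

Definition fracmul (I J : fracideal) : fracideal :=
  FracIdeal (fracidealM (fracidealP I) (fracidealP J)).

(* I ~ J iff J = x I for some x in K^* *)
Definition ideal_equiv (I J : fracideal) : bool :=
  `[< exists2 x : K, x != 0 & J = [set x * y | y in (I : set K)] :> set K >].

Lemma ideal_equiv_refl : reflexive ideal_equiv.
Proof.
move=> I; apply/asboolP; exists 1; first exact: oner_neq0.
by apply/seteqP; split=> [y Iy|y [z Iz <-]]; rewrite ?mul1r//; exists y; rewrite ?mul1r.
Qed.

Lemma ideal_equiv_sym : symmetric ideal_equiv.
Proof.
have h I J : ideal_equiv I J -> ideal_equiv J I.
  move=> /asboolP[x x0 EJ]; apply/asboolP; exists x^-1; first by rewrite invr_eq0.
  rewrite EJ.
  apply/seteqP; split=> [y Iy|_ [_ [z Iz <-] <-]]; last by rewrite mulKf.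
  by exists (x * y); [exists y|rewrite mulKf].
by move=> I J; apply/idP/idP; exact: h.
Qed.

Lemma ideal_equiv_trans : transitive ideal_equiv.
Proof.
move=> J I L /asboolP[x x0 EJ] /asboolP[y y0 EL]; apply/asboolP.
exists (y * x); first by rewrite mulf_neq0.
rewrite EL EJ; apply/seteqP; split=> [_ [_ [z Iz <-] <-]|_ [z Iz <-]].
  by exists z; rewrite // mulrA.
by exists (x * z); [exists z|rewrite mulrA].
Qed.

Canonical ideal_equivRel :=
  EquivRel ideal_equiv ideal_equiv_refl ideal_equiv_sym ideal_equiv_trans.

Definition classgroup := {eq_quot ideal_equiv}.

Definition idclass (I : fracideal) : classgroup := \pi I.

Definition class1 : classgroup := idclass frac1.

Definition classmul (c d : classgroup) : classgroup :=
  idclass (fracmul (repr c) (repr d)).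

Lemma idclassM I J : classmul (idclass I) (idclass J) = idclass (fracmul I J).
Proof.
have eqv (A : fracideal) :
    exists2 x : K, x != 0 & A = [set x * y | y in (repr (idclass A) : set K)] :> set K.
  by apply/asboolP; rewrite -[asbool _]/(ideal_equiv _ _); apply/eqmodP; rewrite reprK.
rewrite /classmul; move: (eqv I) (eqv J).
move: (repr (idclass I)) (repr (idclass J)) => I' J' [x x0 EI] [y y0 EJ].
apply/eqmodP; apply/asboolP; exists (x * y); first by rewrite mulf_neq0.
rewrite /= EI EJ; apply/seteqP; split=> [_ [k [a [b [Ia Jb ->]]]]|].
  exists (\sum_i (x^-1 * a i) * (y^-1 * b i)).
    exists k, (fun i => x^-1 * a i), (fun i => y^-1 * b i); split=> // i.
      by have [z Iz <-] := Ia i; rewrite mulKf.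
    by have [z Iz <-] := Jb i; rewrite mulKf.
  by rewrite mulr_sumr; apply: eq_bigr => i _; rewrite mulrACA !mulVKf.
move=> _ [_ [k [a [b [Ia Jb ->]]]] <-].
exists k, (fun i => x * a i), (fun i => y * b i); split=> [i|i|].
- by exists (a i).
- by exists (b i).
- by rewrite mulr_sumr; apply: eq_bigr => i _; rewrite mulrACA.
Qed.

End ClassGroup.

(* \hat K = K \otimes_Q R, in coordinates on the Q-basis e of K given by
   [vbasis {:K}]; the product is the R-bilinear extension of
   (e_i, e_j) |-> e_i * e_j and [iota x] is x \otimes 1. *)
Definition Khat (R : realType) (K : fieldExtType rat) : Type :=
  'rV[R]_(\dim {:K}).

HB.instance Definition _ (R : realType) (K : fieldExtType rat) :=
  GRing.Lmodule.copy (Khat R K) 'rV[R]_(\dim {:K}).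

Section Khat.
Variables (R : realType) (K : fieldExtType rat).
Local Notation e := (vbasis {:K}).
Local Notation Kh := (Khat R K).

Definition iota (x : K) : Kh := \row_i ratr (coord e i x).

Definition Khat_mul (v w : Kh) : Kh :=
  \sum_i \sum_j (v ord0 i * w ord0 j) *: iota (e`_i * e`_j).

Definition Khat_one : Kh := iota 1.

Lemma iotaD x y : iota (x + y) = iota x + iota y.
Proof. by apply/rowP=> i; rewrite !mxE linearD rmorphD. Qed.

Lemma iotaZ (q : rat) x : iota (q *: x) = ratr q *: iota x.
Proof. by apply/rowP=> i; rewrite !mxE linearZ rmorphM. Qed.

Lemma iota_sum I (r : seq I) (P : pred I) (F : I -> K) :
  iota (\sum_(i <- r | P i) F i) = \sum_(i <- r | P i) iota (F i).
Proof.
apply: (big_morph iota iotaD).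
by apply/rowP=> i; rewrite !mxE linear0 rmorph0.
Qed.

Lemma Khat_mulC : commutative Khat_mul.
Proof.
move=> v w; rewrite /Khat_mul exchange_big; apply: eq_bigr => i _.
by apply: eq_bigr => j _; rewrite [v _ _ * _]mulrC [e`_j * _]mulrC.
Qed.

Lemma Khat_mulDl : left_distributive Khat_mul +%R.
Proof.
move=> u v w; rewrite /Khat_mul -big_split; apply: eq_bigr => i _.
by rewrite -big_split; apply: eq_bigr => j _; rewrite mxE mulrDl scalerDl.
Qed.

Lemma Khat_mulZl (a : R) v w : Khat_mul (a *: v) w = a *: Khat_mul v w.
Proof.
rewrite /Khat_mul scaler_sumr; apply: eq_bigr => i _.
by rewrite scaler_sumr; apply: eq_bigr => j _; rewrite mxE -mulrA scalerA.
Qed.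

Lemma Khat_mul_suml I (r : seq I) (P : pred I) (F : I -> Kh) w :
  Khat_mul (\sum_(i <- r | P i) F i) w = \sum_(i <- r | P i) Khat_mul (F i) w.
Proof.
apply: (big_morph (Khat_mul^~ w)) => [u v|]; first exact: Khat_mulDl.
by have := Khat_mulZl 0 0 w; rewrite !scale0r.
Qed.

Lemma iotaM x y : Khat_mul (iota x) (iota y) = iota (x * y).
Proof.
have h z : z = \sum_i coord e i z *: e`_i :> K.
  by apply: coord_vbasis; rewrite memvf.
rewrite {2}(h x) mulr_suml iota_sum; apply: eq_bigr => i _.
rewrite {2}(h y) mulr_sumr iota_sum; apply: eq_bigr => j _.
by rewrite !mxE -scalerAl -scalerAr !iotaZ scalerA.
Qed.

Lemma Khat_expand (v : Kh) : v = \sum_i v ord0 i *: iota e`_i.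
Proof.
apply/rowP => j; rewrite summxE (bigD1 j) //= big1 ?addr0.
  by rewrite !mxE coord_free ?(basis_free (vbasisP _))// eqxx rmorph1 mulr1.
move=> i ij; rewrite !mxE coord_free ?(basis_free (vbasisP _))//.
by rewrite (negbTE ij) rmorph0 mulr0.
Qed.

Lemma Khat_mulA : associative Khat_mul.
Proof.
move: Khat_mul Khat_mulC Khat_mulZl Khat_mul_suml iotaM => op opC Zl Sl opM.
have Zr a v w : op v (a *: w) = a *: op v w by rewrite opC Zl opC.
have Sr I (r : seq I) (P : pred I) (F : I -> Kh) w :
    op w (\sum_(i <- r | P i) F i) = \sum_(i <- r | P i) op w (F i).
  by rewrite opC Sl; apply: eq_bigr => i _; rewrite opC.
move=> u v w; rewrite [u]Khat_expand !Sl; apply: eq_bigr => i _.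
rewrite !Zl; congr (_ *: _).
rewrite [v]Khat_expand !(Sr, Sl); apply: eq_bigr => j _.
rewrite !(Zr, Zl); congr (_ *: _).
rewrite [w]Khat_expand !Sr; apply: eq_bigr => k _.
by rewrite !Zr !opM mulrA.
Qed.

Lemma Khat_mul1 : left_id Khat_one Khat_mul.
Proof.
move: Khat_mul Khat_mulC Khat_mulZl Khat_mul_suml iotaM => op opC Zl Sl opM v.
rewrite opC (Khat_expand v) Sl.
by apply: eq_bigr => i _; rewrite Zl opM mulr1.
Qed.

Lemma Khat_one_neq0 : Khat_one != 0.
Proof.
apply/eqP => /rowP h; have /eqP := oner_neq0 K; apply.
rewrite (coord_vbasis (memvf (1 : K))) big1 // => i _.
by have := h i; rewrite !mxE => /eqP; rewrite fmorph_eq0 => /eqP ->; rewrite scale0r.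
Qed.

End Khat.

HB.instance Definition _ (R : realType) (K : fieldExtType rat) :=
  GRing.Zmodule_isComNzRing.Build (Khat R K) (@Khat_mulA R K) (@Khat_mulC R K)
    (@Khat_mul1 R K) (@Khat_mulDl R K) (@Khat_one_neq0 R K).

Section Lattices.
Variables (R : realType) (K : fieldExtType rat).

Definition Khat2 := 'rV[Khat R K]_2.

Definition scaleK (x : K) (v : Khat2) : Khat2 := iota R x *: v.

Definition fingenK (L : set Khat2) : Prop :=
  exists s : seq Khat2, L = prodset scaleK ringInt [set v | v \in s].

Definition span_K (L : set Khat2) : set Khat2 := prodset scaleK setT L.

Definition span_Khat (L : set Khat2) : set Khat2 :=
  prodset (fun (a : Khat R K) (v : Khat2) => a *: v) setT L.

(* dim_K W = 2: W has a K-basis (u, v) *)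
Definition dimK_eq2 (W : set Khat2) : Prop :=
  exists u v, [/\ forall x y, scaleK x u + scaleK y v = 0 -> x = 0 /\ y = 0
    & W = [set w | exists x y, w = scaleK x u + scaleK y v]].

Definition is_lattice (L : set Khat2) : Prop :=
  [/\ fingenK L, dimK_eq2 (span_K L) & span_Khat L = setT].

Definition idscale (I : set K) (L : set Khat2) : set Khat2 := prodset scaleK I L.

(* M/L is isomorphic to O_K/n *)
Definition cyclic_quot (n : set K) (M L : set Khat2) : Prop :=
  quot_iso scaleK *%R M L ringInt n.

(* M/L is isomorphic to O_K/a1 (+) O_K/a2 with a1 a2 = a, i.e. [M : L] = a *)
Definition index_ideal (M L : set Khat2) (a : set K) : Prop :=
  exists a1 a2 : intideal K,
    quot_iso scaleK (fun r z => (r * z.1, r * z.2) : K * K)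
      M L (ringInt `*` ringInt) (a1 `*` a2) /\ idmul a1 a2 = a.

(* The lattices over which T_a (L, L', beta) is summed *)
Definition hecke_lattices (n a : set K) (L L' : set Khat2) : set (set Khat2) :=
  [set M | [/\ is_lattice M, L `<=` M, index_ideal M L a
             & cyclic_quot n (sumset M L') M]].

End Lattices.

Section Operators.
Variable V : lmodType rat.

Definition linear_fun : {pred V -> V} := fun f => `[< linear f >].

(* End(V), whose product is composition *)
Record lend := LEnd { lend_fun :> V -> V; _ : linear_fun lend_fun }.

HB.instance Definition _ := [isSub for lend_fun].
HB.instance Definition _ := [Choice of lend by <:].

Lemma lendP (f : lend) : linear f.
Proof. by apply/asboolP; case: f. Qed.

Lemma linear_fun_closed : submod_closed linear_fun.
Proof.
split; first by apply/asboolP => a u v; rewrite /= scaler0 addr0.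
move=> a f g /asboolP lf /asboolP lg; apply/asboolP => b u v.
rewrite -![(a *: f + g) _]/(a *: f _ + g _) lf lg !scalerDr addrACA.
by rewrite !scalerA mulrC.
Qed.

HB.instance Definition _ :=
  GRing.isSubmodClosed.Build rat (V -> V) linear_fun linear_fun_closed.
HB.instance Definition _ := [SubChoice_isSubLmodule of lend by <:].

Lemma lend1_subproof : linear_fun (@id V).
Proof. exact/asboolP. Qed.

Definition lend1 : lend := LEnd lend1_subproof.

Lemma lend_comp_subproof (f g : lend) : linear_fun (f \o g).
Proof. by apply/asboolP => a u v /=; rewrite !lendP. Qed.

Definition lend_comp (f g : lend) : lend := LEnd (lend_comp_subproof f g).

Lemma lend_compA : associative lend_comp.
Proof. by move=> f g h; apply: val_inj. Qed.

Lemma lend_comp1l : left_id lend1 lend_comp.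
Proof. by move=> f; apply: val_inj. Qed.

Lemma lend_comp1r : right_id lend1 lend_comp.
Proof. by move=> f; apply: val_inj. Qed.

Lemma lend_compDl : left_distributive lend_comp +%R.
Proof. by move=> f g h; apply: val_inj. Qed.

Lemma lend_compDr : right_distributive lend_comp +%R.
Proof.
move=> f g h; apply: val_inj; apply/funext => v /=.
by have := lendP f 1 (g v) (h v); rewrite !scale1r.
Qed.

HB.instance Definition _ := GRing.Zmodule_isPzRing.Build lend
  lend_compA lend_comp1l lend_comp1r lend_compDl lend_compDr.

Definition is_subalg (A : set lend) : Prop :=
  [/\ A 1, forall q f g, A f -> A g -> A (q *: f + g)
    & forall f g, A f -> A g -> A (f * g)].

End Operators.

(* The linear extension of f : P -> V to the Q-vector space with basis P *)
Section LinearExtension.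
Variables (P : choiceType) (V : lmodType rat) (f : P -> V).

Definition linext (v : {malg rat[P]}) : V := \sum_(x <- msupp v) v@_x *: f x.

Lemma linextw (v : {malg rat[P]}) (d : {fset P}) : (msupp v `<=` d)%fset ->
  linext v = \sum_(x <- d) v@_x *: f x.
Proof.
move=> vd; apply: big_fset_incl => // x _ xv.
by rewrite mcoeff_outdom // scale0r.
Qed.

Lemma linext_linear : linear linext.
Proof.
move=> a u v; set d := (msupp u `|` msupp v)%fset.
have ud : (msupp u `<=` d)%fset by exact: fsubsetUl.
have vd : (msupp v `<=` d)%fset by exact: fsubsetUr.
have auvd : (msupp (a *: u + v) `<=` d)%fset.
  apply: fsubset_trans (msuppD_le _ _) _.
  by rewrite fsetSU // msuppZ_le.
rewrite (linextw ud) (linextw vd) (linextw auvd) scaler_sumr -big_split.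
by apply: eq_bigr => x _; rewrite mcoeffD mcoeffZ scalerDl scalerA.
Qed.

End LinearExtension.

Definition lextend (P : choiceType) (f : P -> {malg rat[P]}) :
  lend {malg rat[P]} := LEnd (asboolT (linext_linear f)).

(* The Q-subalgebra of End(V) generated by a set G of operators, as a ring *)
Section GeneratedAlgebra.
Variables (V : lmodType rat) (G : set (lend V)).

Definition generated : set (lend V) := smallest (@is_subalg V) G.

Lemma generated_subalg : is_subalg generated.
Proof.
split=> [A [[]]//|q f g Gf Gg A hA|f g Gf Gg A hA]; have [[_ Z M] _] := hA.
- by apply: Z; [exact: Gf|exact: Gg].
- by apply: M; [exact: Gf|exact: Gg].
Qed.

Definition generated_pred : {pred lend V} := fun f => f \in generated.

Lemma generated_predP f : reflect (generated f) (f \in generated_pred).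
Proof. by apply: (iffP idP) => [/(@set_mem _ _ _)|/(@mem_set _ _ _)]. Qed.

Lemma generated_submod : submod_closed generated_pred.
Proof.
have [h1 hZ _] := generated_subalg; split=> [|a f g].
  have := hZ (-1) 1 1 h1 h1.
  by rewrite scaleN1r addNr => h; apply/generated_predP.
by move=> /generated_predP Gf /generated_predP Gg; apply/generated_predP; exact: (hZ _ _ _ Gf Gg).
Qed.

Lemma generated_mul : mulr_closed generated_pred.
Proof.
have [h1 _ hM] := generated_subalg; split=> [|f g]; first exact/generated_predP.
by move=> /generated_predP Gf /generated_predP Gg; apply/generated_predP; exact: (hM _ _ Gf Gg).
Qed.

HB.instance Definition _ :=
  GRing.isSubmodClosed.Build rat (lend V) generated_pred generated_submod.
HB.instance Definition _ :=
  GRing.isMulClosed.Build (lend V) generated_pred generated_mul.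

Record genalg := GenAlg { genalg_op :> lend V; _ : generated_pred genalg_op }.

HB.instance Definition _ := [isSub for genalg_op].
HB.instance Definition _ := [Choice of genalg by <:].
HB.instance Definition _ := [SubChoice_isSubLmodule of genalg by <:].
HB.instance Definition _ := GRing.SubZmodule_isSubPzRing.Build (lend V) generated_pred genalg (GRing.subringClosedP _).

Lemma generated_gen (g : lend V) : G g -> generated_pred g.
Proof. by move=> Gg; apply/mem_set => A [_]; apply. Qed.

End GeneratedAlgebra.

Section ModularPoints.
Variables (R : realType) (K : fieldExtType rat) (n : set K).
Local Notation Kh2 := (Khat2 R K).

Definition is_point0 (L L' : set Kh2) : Prop :=
  [/\ is_lattice L, is_lattice L', L `<=` L' & cyclic_quot n L' L].

(* An element of L'/L is a coset B = beta + L. *)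
Definition is_point1 (L L' B : set Kh2) : Prop :=
  is_point0 L L' /\
  exists beta, [/\ L' beta, B = sumset [set beta] L
    & L' = sumset L [set v | exists2 r, ringInt r & v = scaleK r beta]].

Record point0 := Point0
  { pt0_L : set Kh2; pt0_L' : set Kh2; _ : is_point0 pt0_L pt0_L' }.

Record point1 := Point1
  { pt1_L : set Kh2; pt1_L' : set Kh2; pt1_beta : set Kh2;
    _ : is_point1 pt1_L pt1_L' pt1_beta }.

HB.instance Definition _ := gen_eqMixin point0.
HB.instance Definition _ := gen_choiceMixin point0.
HB.instance Definition _ := gen_eqMixin point1.
HB.instance Definition _ := gen_choiceMixin point1.

(* The basis vectors (L, L') and (L, L', B) of Q M_0(n) and Q M_1(n).  The
   value 0 on pairs and triples that are not modular points is a dummy: these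
   do not occur in the Hecke operators below. *)
Definition basis0 (L L' : set Kh2) : {malg rat[point0]} :=
  if pselect (is_point0 L L') is left h then << Point0 h >> else 0.

Definition basis1 (L L' B : set Kh2) : {malg rat[point1]} :=
  if pselect (is_point1 L L' B) is left h then << Point1 h >> else 0.

(* The sums are over finite sets of lattices. *)
Definition heckeT0 (a : intideal K) : lend {malg rat[point0]} :=
  lextend (fun P : point0 =>
    (intnorm a)%:R^-1 *:
      \sum_(M \in hecke_lattices n a (pt0_L P) (pt0_L' P))
        basis0 M (sumset M (pt0_L' P))).

Definition heckeT1 (a : intideal K) : lend {malg rat[point1]} :=
  lextend (fun P : point1 =>
    (intnorm a)%:R^-1 *:
      \sum_(M \in hecke_lattices n a (pt1_L P) (pt1_L' P))
        basis1 M (sumset M (pt1_L' P)) (sumset (pt1_beta P) M)).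

Definition heckeTT0 (a : fracideal_coprime n) : lend {malg rat[point0]} :=
  lextend (fun P : point0 =>
    fracnorm a ^- 2 *:
      basis0 (idscale (idinv a) (pt0_L P)) (idscale (idinv a) (pt0_L' P))).

(* The third component is the class modulo a^-1 L of the representatives
   beta of P lying in a^-1 L'. *)
Definition heckeTT1 (a : fracideal_coprime n) : lend {malg rat[point1]} :=
  lextend (fun P : point1 =>
    let aL := idscale (idinv a) (pt1_L P) in
    let aL' := idscale (idinv a) (pt1_L' P) in
    fracnorm a ^- 2 *: basis1 aL aL' (sumset (pt1_beta P `&` aL') aL)).

End ModularPoints.

Inductive modpoints := M0 | M1.

Definition point (m : modpoints) (R : realType) (K : fieldExtType rat)
    (n : set K) : choiceType :=
  match m with M0 => point0 R n | M1 => point1 R n end.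

Section HeckeAlgebra.
Variables (R : realType) (K : fieldExtType rat) (n : set K) (m : modpoints).

Definition heckeT (a : intideal K) : lend {malg rat[point m R n]} :=
  match m with M0 => heckeT0 R n a | M1 => heckeT1 R n a end.

Definition heckeTT (a : fracideal_coprime n) : lend {malg rat[point m R n]} :=
  match m with M0 => heckeTT0 R a | M1 => heckeTT1 R a end.

Definition hecke_generators : set (lend {malg rat[point m R n]}) :=
  range heckeT `|` range heckeTT.

Definition hecke : Type := genalg hecke_generators.

Definition hT (a : intideal K) : hecke :=
  GenAlg (generated_gen (or_introl (imageT heckeT a) : hecke_generators _)).

Definition hTT (a : fracideal_coprime n) : hecke :=
  GenAlg (generated_gen (or_intror (imageT heckeTT a) : hecke_generators _)).

Definition hclass (a : fracideal_coprime n) (b : intideal K) : classgroup K :=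
  classmul (classmul (idclass (frac_of_coprime a)) (idclass (frac_of_coprime a)))
    (idclass (frac_of_int b)).

(* T_c: the Q-span of the T_{a,a} T_b of class [a]^2 [b] = c *)
Definition hecke_class (c : classgroup K) : set hecke :=
  [set t | exists k (q : 'I_k -> rat) (a : 'I_k -> fracideal_coprime n)
      (b : 'I_k -> intideal K),
      (forall i, hclass (a i) (b i) = c) /\
      t = \sum_i q i *: (hTT (a i) * hT (b i))].

Definition hecke_principal : set hecke := hecke_class (class1 K).

Definition eigsystem : Type := {rmorphism hecke -> R[i]}.

Definition eigchar (l : eigsystem) (a : fracideal_coprime n) : R[i] := l (hTT a).

Record unramified_char := UnramifiedChar
  { uchar :> classgroup K -> R[i];
    _ : forall c d, uchar (classmul c d) = uchar c * uchar d;
    _ : forall c, uchar c != 0 }.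

(* l' = l \otimes psi: an eigenvalue system is determined by its values on the
   generators T_a and T_{a,a}. *)
Definition is_twist (l : eigsystem) (psi : unramified_char) (l' : eigsystem) : Prop :=
  (forall a : intideal K, l' (hT a) = psi (idclass (frac_of_int a)) * l (hT a)) /\
  (forall a : fracideal_coprime n,
     l' (hTT a) = psi (idclass (frac_of_coprime a)) ^+ 2 * l (hTT a)).

End HeckeAlgebra.

(* Main.v *)
(** The Hecke relations express T_a T_b as a combination of products
    T_d T_{c,c} with c^2 d = ab.  Hence a product of elements of T_c and T_d is,
    up to the order of its factors, an element of T_{cd}.  The classes c on
    which lambda_1 does not vanish form a subgroup H of Cl(K), containing all
    squares because T_{a,a} is invertible; since lambda_1 and lambda_2 agree on
    T_1, they vanish on the same T_c and lambda_2 / lambda_1 is a character of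
    H.  It extends to Cl(K), and the extension is psi.

    In T_a T_b the coefficient of a lattice M over L is the number of lattices
    between L and M with prescribed indices.  Since M meets L' in L, the
    quotient M / L is O/g + O/h with h in g, g prime to n and gh = ab, so the
    coefficient depends only on g.  As c^-1 L lies in M exactly when g lies in c,
    inverting the matrix (g in c) over the finitely many g gives the Hecke
    relation without computing these numbers.  The structure of M / L comes
    from bases adapted to L and M, and its uniqueness makes the index ideal
    multiplicative. *)
Require Import Defs.
From HB Require Import structures.
From mathcomp Require Import all_boot all_order all_algebra all_field.
From mathcomp Require Import generic_quotient.
From mathcomp Require Import finmap boolp classical_sets functions cardinality fsbigop reals.
From mathcomp Require Import complex.
From mathcomp Require Import monalg.
From mathcomp Require Import ring zify.
Import Order.TTheory GRing.Theory Num.Theory.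
Local Open Scope classical_set_scope.
Local Open Scope ring_scope.
Set Implicit Arguments.
Unset Strict Implicit.
Unset Printing Implicit Defensive.

(** * Ideals of the ring of integers *)

(** The arithmetic of O rests on one finiteness fact: O/I is finite for every nonzero ideal I. It
    shows that O is completely integrally closed and that fractional ideals are invertible and,
    through idempotent powers in O/m, it provides elements that generate an ideal modulo m and play
    the part of local generators. Every lattice occurring in a Hecke sum over L spans the same
    K-plane as L, so lattices are studied in abstract planes K u + K v, where the index ideal
    becomes a quotient of ideals of determinants. Norms are carried along as nonzero rational
    constants. The two eigenvalue systems are compared through one identity: for t in T_c and [a] =
    c^-1, the product T_{a,a} t^2 is principal up to the order of its factors, so lambda(T_{a,a})
    lambda(t)^2 has the same value for lambda_1 and lambda_2. As H contains all squares, extending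
    the quotient character by one more class costs only a square root. *)

Section IntegersArithmetic.
Variable K : fieldExtType rat.
Implicit Types (x y z r : K).
Local Notation O := (ringInt : set K).

Lemma ringIntN x : ringInt x -> ringInt (- x).
Proof. exact: integral_opp. Qed.

Lemma ringIntB x y : ringInt x -> ringInt y -> ringInt (x - y).
Proof. exact: integral_sub. Qed.

Lemma ringInt_int (c : int) : ringInt (c%:~R : K).
Proof. exact: integral_id. Qed.

Lemma ringIntX x k : ringInt x -> ringInt (x ^+ k).
Proof.
by move=> Ox; elim: k => [|k IH]; rewrite ?expr0 ?exprS;
  [exact: ringInt1|exact: ringIntM].
Qed.

(** Let p be the minimal polynomial of x, of degree [n.-1], and a an integer such that a p has
    integral coefficients. Then a x is a root of the monic polynomial with coefficients a^(n-1-i)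
    p_i, which are integral. *)
Lemma denom_exists x : exists2 d : int, d != 0 & ringInt (d%:~R * x).
Proof.
have /polyOver1P[p pE] := minPolyOver 1 x.
have mp : p \is monic.
  by rewrite -(map_monic (GRing.in_alg K)) -pE monic_minPoly.
have rp : root (map_poly (GRing.in_alg K) p) x by rewrite -pE root_minPoly.
have [q [a a0 qE]] := rat_poly_scale p.
exists a => //; set n := size p.
have n0 : (0 < n)%N by rewrite size_poly_gt0 monic_neq0.
pose aK : K := a%:~R.
have aK0 : aK != 0.
  by rewrite /aK -(rmorph_int (GRing.in_alg K)) fmorph_eq0 intr_eq0.
pose P : {poly K} := \poly_(i < n) (aK ^+ (n.-1 - i) * GRing.in_alg K p`_i).
have Pn : P`_n.-1 = 1.
  by rewrite coef_poly prednK // leqnn subnn mul1r; move/monicP: mp; rewrite /lead_coef => ->;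
    rewrite rmorph1.
have sP : size P = n.
  apply/eqP; rewrite eqn_leq size_poly /=.
  rewrite -(prednK n0) ltnNge; apply/negP => /leq_sizeP/(_ _ (leqnn _)).
  by rewrite Pn => /eqP; rewrite oner_eq0.
apply: (@integral_root_monic _ _ _ _ P).
- by apply/monicP; rewrite /lead_coef sP Pn.
- apply/rootP; rewrite horner_poly.
  have -> : \sum_(i < n) aK ^+ (n.-1 - i) * GRing.in_alg K p`_i * (a%:~R * x) ^+ i
          = aK ^+ n.-1 * \sum_(i < n) GRing.in_alg K p`_i * x ^+ i.
    rewrite mulr_sumr; apply: eq_bigr => i _.
    have -> : aK ^+ n.-1 = aK ^+ (n.-1 - i) * aK ^+ i.
      by rewrite -exprD subnK // -ltnS prednK.
    by rewrite exprMn -/aK; ring.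
  move/rootP: rp; rewrite horner_coef size_map_poly -/n => h.
  rewrite (eq_bigr (fun i : 'I_n => (map_poly (GRing.in_alg K) p)`_i * x ^+ i)) ?h ?mulr0 //.
  by move=> i _; rewrite coef_map.
- apply/integral_poly => i; rewrite coef_poly; case: ltnP => [lin|_]; last exact: integral0.
  have [-> | ni] := eqVneq i n.-1.
    by rewrite subnn mul1r; move/monicP: mp; rewrite /lead_coef => ->; rewrite rmorph1;
      exact: integral1.
  have -> : (n.-1 - i)%N = (n.-1 - i).-1.+1 by rewrite prednK // subn_gt0 ltn_neqAle ni -ltnS
    prednK.
  rewrite exprSr -mulrA; apply: ringIntM; first exact/ringIntX/ringInt_int.
  have -> : aK * GRing.in_alg K p`_i = (q`_i)%:~R.
    rewrite qE coefZ coef_map (rmorphM (GRing.in_alg K)) (fmorphV (GRing.in_alg K)).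
    rewrite !(rmorph_int (GRing.in_alg K)) -/aK.
    by rewrite mulrA divff ?mul1r.
  exact: ringInt_int.
Qed.

End IntegersArithmetic.

(** Finiteness of N/L as a list of representatives. They may lie outside N; [finquot_in] discards
    those that do. *)
Definition finquot (U : zmodType) (N L : set U) : Prop :=
  exists s : seq U, forall z, N z -> exists2 y, y \in s & L (z - y).

(** * Finiteness of O/pO for a prime p *)

Section FiniteQuotients.
Variable K : fieldExtType rat.
Implicit Types (x y z r : K).
Local Notation O := (ringInt : set K).

Lemma intr_eq0K (c : int) : ((c%:~R : K) == 0) = (c == 0).
Proof. by rewrite -(rmorph_int (GRing.in_alg K)) fmorph_eq0 intr_eq0. Qed.

Lemma rat_common_denom (I : finType) (q : I -> rat) :
  exists2 D : int, D != 0 & forall i, exists c : int, D%:~R * q i = c%:~R.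
Proof.
exists (\prod_i denq (q i)); first by apply/prodf_neq0 => i _; exact: denq_neq0.
move=> i; exists (numq (q i) * \prod_(j | j != i) denq (q j)).
by rewrite (bigD1 i) //= !intrM numqE; ring.
Qed.

Section ModPrime.
Variables (p : nat) (p_pr : prime p).
Local Notation pO := [set x : K | exists2 y, ringInt y & x = p%:R * y].

Definition indep_mod k (x : 'I_k -> K) :=
  forall c : 'I_k -> int, pO (\sum_i (c i)%:~R * x i) -> forall i, (p %| c i)%Z.

(** Infinite descent on the sum of the |c_i|: every c_i is divisible by p, and dividing the relation
    by p decreases the sum unless it is already 0. *)
Lemma indep_mod_rel k (x : 'I_k -> K) (c : 'I_k -> int) : indep_mod x ->
  \sum_i (c i)%:~R * x i = 0 -> forall i, c i = 0.
Proof.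
move=> ix; have [N] := ubnP (\sum_i `|c i|%N)%N.
elim: N c => // N IH c cN c0.
have dc : forall i, (p %| c i)%Z.
  by apply: ix; rewrite c0; exists 0; [exact: ringInt0|rewrite mulr0].
pose c' i := (c i %/ p)%Z.
have cE i : c i = c' i * p by rewrite divzK.
have c'0 : \sum_i (c' i)%:~R * x i = 0.
  apply: (@mulfI _ (p%:R : K)).
    by have := intr_eq0K p; rewrite -pmulrn => ->; rewrite -lt0n prime_gt0.
  rewrite /= mulr0 -[RHS]c0 mulr_sumr; apply: eq_bigr => i _.
  by rewrite cE intrM -pmulrn mulrA [p%:R * _]mulrC.
have [S0|S0] := posnP (\sum_i `|c i|%N)%N.
  move/eqP: S0; rewrite sum_nat_eq0 => /forallP S0 i.
  by have := S0 i; rewrite implyTb absz_eq0 => /eqP.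
have h : forall i, c' i = 0.
  apply: IH => //; rewrite ltnS in cN; apply: leq_trans cN.
  have -> : (\sum_i `|c i| = p * \sum_i `|c' i|)%N.
    by rewrite big_distrr /=; apply: eq_bigr => i _; rewrite cE abszM mulnC.
  have S0' : (0 < \sum_i `|c' i|)%N.
    move: S0; rewrite (eq_bigr (fun i => (p * `|c' i|)%N)) ?cE; last first.
      by move=> i _; rewrite cE abszM mulnC.
    by rewrite -big_distrr /= muln_gt0 => /andP[].
  by rewrite ltn_Pmull // prime_gt1.
by move=> i; rewrite cE h mul0r.
Qed.

Lemma indep_mod_dim k (x : 'I_k -> K) : indep_mod x -> (k <= \dim {:K})%N.
Proof.
move=> ix; pose X := [tuple x i | i < k].
have /eqP : free X.
  apply/freeP => q q0 i.
  have [D D0 /choice[c cE]] := rat_common_denom q.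
  have /(indep_mod_rel ix) c0 : \sum_i (c i)%:~R * x i = 0.
    rewrite (eq_bigr (fun j => (D%:~R : rat) *: (q j *: X`_j))); last first.
      move=> j _; rewrite scalerA cE scaler_int -[RHS]mulrzl; congr (_ * _).
      by rewrite (nth_map j) ?size_enum_ord // nth_ord_enum.
    by rewrite -scaler_sumr q0 scaler0.
  have := cE i; rewrite c0 => /eqP; rewrite mulf_eq0 intr_eq0 (negbTE D0) /=.
  by move/eqP.
by rewrite size_tuple => <-; apply: dimvS; exact: subvf.
Qed.

(* Dividing integral relations by p shows that a family independent modulo p is
   independent over Q, hence finite; a maximal one spans O modulo p. *)
Lemma finquot_prime : finquot O pO.
Proof.
pose P k := `[< exists2 x : 'I_k -> K, (forall i, ringInt (x i)) & indep_mod x >].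
have P0 : exists k, P k.
  exists 0%N; apply/asboolP; exists (fun=> 0); first by case.
  by move=> c _ [].
have Pb k : P k -> (k <= \dim {:K})%N by move=> /asboolP[x _ /indep_mod_dim].
case: (ex_maxnP P0 Pb) => k /asboolP[x Ox ix] kmax.
pose F (f : {ffun 'I_k -> 'I_p}) : K := \sum_i (f i : nat)%:R * x i.
exists [seq F f | f : {ffun 'I_k -> 'I_p}] => z Oz.
have [c cO] : exists c : 'I_k -> int, pO (z - \sum_i (c i)%:~R * x i).
  apply: contrapT => /forallNP nc.
  have : P k.+1; last by move/kmax; rewrite ltnn.
  apply/asboolP; exists (fun i => if unlift ord0 i is Some j then x j else z).
    by move=> i; case: unliftP.
  move=> c; rewrite big_ord_recl unlift_none => -[w Ow].
  rewrite (eq_bigr (fun i => (c (lift ord0 i))%:~R * x i)); last by move=> i _; rewrite liftK.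
  move=> wE.
  have pc0 : (p %| c ord0)%Z.
    (* Otherwise the coefficient of z is invertible modulo p, and z is a combination of the x_i
       modulo p, against [nc]. *)
    apply: contrapT => /negP npc.
    have cop : coprimez p (c ord0).
      by rewrite coprimezE /= prime_coprime.
    have [[u v] /= uv] := coprimezP _ _ cop.
    apply: (nc (fun i => - (v * c (lift ord0 i)))).
    exists (u%:~R * z + v%:~R * w).
      by apply: ringIntD; apply: ringIntM => //; exact: ringInt_int.
    rewrite mulrDr mulrCA [p%:R * (v%:~R * w)]mulrCA -wE mulrDr mulrCA.
    have uvK : u%:~R * (p%:R : K) + v%:~R * (c ord0)%:~R = 1.
      by rewrite pmulrn -!intrM -intrD uv.
    have -> : \sum_i (- (v * c (lift ord0 i)))%:~R * x i =
        - (v%:~R * \sum_i (c (lift ord0 i))%:~R * x i).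
      rewrite mulr_sumr -sumrN; apply: eq_bigr => i _.
      by rewrite mulrNz intrM mulNr mulrA.
    rewrite opprK addrA; congr (_ + _);
      transitivity ((u%:~R * p%:R + v%:~R * (c ord0)%:~R) * z); [by rewrite uvK mul1r|ring].
  have cl : forall i, (p %| c (lift ord0 i))%Z.
    apply: (ix (fun i => c (lift ord0 i))); move/dvdzP: pc0 => [q qE].
    exists (w - q%:~R * z).
      by apply: ringIntB => //; apply: ringIntM => //; exact: ringInt_int.
    by rewrite mulrBr -wE qE intrM -pmulrn; ring.
  by move=> i; case: (unliftP ord0 i) => [j ->|->].
pose f : {ffun 'I_k -> 'I_p} := [ffun i => Ordinal (ltn_pmod `|(c i %% p)%Z|%N (prime_gt0 p_pr))].
exists (F f); first by apply: map_f; rewrite mem_enum.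
have fE i : ((f i : nat) = (c i %% p)%Z :> int).
  rewrite ffunE /= modn_small.
    by rewrite gez0_abs // modz_ge0 // -lt0n prime_gt0.
  rewrite -ltz_nat gez0_abs ?modz_ge0 // -?lt0n ?prime_gt0 //.
  by rewrite ltz_pmod // ltz_nat prime_gt0.
case: cO => w Ow wE.
exists (w + \sum_i (c i %/ p)%Z%:~R * x i).
  apply: ringIntD => //; apply: ringInt_sum => i; apply: ringIntM => //; exact: ringInt_int.
have key : \sum_i (c i)%:~R * x i = F f + p%:R * \sum_i (c i %/ p)%Z%:~R * x i.
  rewrite mulr_sumr -big_split; apply: eq_bigr => i _ /=.
  by rewrite {1}(divz_eq (c i) p) intrD intrM -fE -!pmulrn; ring.
by rewrite mulrDr -wE key; ring.
Qed.

End ModPrime.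
End FiniteQuotients.

Section Submodules.
Variables (K : fieldExtType rat) (U : lmodType K).
Implicit Types (X L N : set U).

Definition submod X : Prop :=
  [/\ X 0, forall x y, X x -> X y -> X (x + y)
    & forall r x, ringInt r -> X x -> X (r *: x)].

Lemma submodN X x : submod X -> X x -> X (- x).
Proof. by case=> _ _ XZ Xx; rewrite -scaleN1r; apply: XZ => //; exact/ringIntN/ringInt1. Qed.

Lemma submodB X x y : submod X -> X x -> X y -> X (x - y).
Proof. by move=> sX Xx /(submodN sX); case: sX => _ XD _; exact: XD. Qed.

Lemma submod_sum X I (r : seq I) (P : pred I) (F : I -> U) : submod X ->
  (forall i, P i -> X (F i)) -> X (\sum_(i <- r | P i) F i).
Proof. by case=> X0 XD _ h; apply: big_ind. Qed.

Lemma finquot_sub N L L' : L `<=` L' -> finquot N L -> finquot N L'.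
Proof. by move=> LL' [s sP]; exists s => z /sP[y ys /LL']; exists y. Qed.

Lemma finquot_in N L : submod N -> L `<=` N -> finquot N L ->
  exists2 s : seq U, {in s, forall y, N y} & forall z, N z -> exists2 y, y \in s & L (z - y).
Proof.
move=> sN LN [s sP]; exists [seq y <- s | `[< N y >]].
  by move=> y; rewrite mem_filter => /andP[/asboolP].
move=> z Nz; have [y ys Lzy] := sP _ Nz; exists y => //.
rewrite mem_filter ys andbT; apply/asboolP.
by rewrite -(subKr z y); apply: submodB => //; exact: LN.
Qed.

Lemma finquot_pigeon N L (f : nat -> U) : submod L -> finquot N L ->
  (forall k, N (f k)) -> exists i j, (i < j)%N /\ L (f i - f j).
Proof.
move=> sL [s sP] Nf.
have /choice[g gP] k : exists i : 'I_(size s), L (f k - s`_i).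
  have [y ys Ly] := sP _ (Nf k).
  by exists (Ordinal (etrans (index_mem y s) ys)); rewrite /= nth_index.
have /injectivePn[i [j ij gij]] : ~~ injectiveb (fun k : 'I_(size s).+1 => g k).
  by apply/injectiveP => /leq_card; rewrite !card_ord ltnn.
have h i' j' : g i' = g j' -> L (f i' - f j').
  move=> gE; rewrite -[f i'](subrK s`_(g i')) {2}gE -addrA.
  case: sL (sL) => _ LD _ sL; apply: LD => //.
  by rewrite -[_ - _]opprB; apply: submodN.
have [lij|lji|/val_inj eij] := ltngtP i j.
- by exists i, j; split=> //; exact: h.
- by exists j, i; split=> //; exact: h.
- by rewrite eij eqxx in ij.
Qed.

End Submodules.

(** * Finiteness of O/I and complete integral closedness *)

Section IdealQuotients.
Variable K : fieldExtType rat.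
Implicit Types (x y z r : K) (I J : set K).
Local Notation O := (ringInt : set K).

Lemma submod_ringInt : @submod K K^o O.
Proof. by split; [exact: ringInt0|exact: ringIntD|exact: ringIntM]. Qed.

Lemma finquot_nat m : (0 < m)%N -> finquot O [set x : K | exists2 y, ringInt y & x = m%:R * y].
Proof.
have [N] := ubnP m; elim: N m => // N IH m mN m0.
have [m1|m1] := leqP m 1.
  have -> : m = 1%N by apply/eqP; rewrite eqn_leq m1.
  exists [:: 0] => z Oz; exists 0; first by rewrite inE.
  by exists z; rewrite // subr0 mul1r.
have pp := pdiv_prime m1; set p := pdiv m in pp.
have mE : (m = m %/ p * p)%N by rewrite divnK // pdiv_dvd.
have [s1 h1] := finquot_prime K pp.
have [||s2 h2] := IH (m %/ p)%N.
- by apply: leq_trans (mN : (m <= N)%N); rewrite ltn_Pdiv // prime_gt1.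
- by move: m0; rewrite {1}mE muln_gt0 => /andP[].
exists [seq a + p%:R * b | a <- s1, b <- s2] => z /h1[a as1 [w Ow zE]].
have [b bs2 [v Ov wE]] := h2 _ Ow.
exists (a + p%:R * b); first by apply/allpairsP; exists (a, b).
by exists v => //; rewrite mE natrM opprD addrA zE -mulrBr wE; ring.
Qed.

(** If d is an integer with d / x integral, then d = (d / x) x lies in I. *)
Lemma ideal_nat I x : is_submodK I -> I x -> x != 0 ->
  exists2 m : nat, (0 < m)%N & I m%:R.
Proof.
move=> sI Ix x0; have [d d0 Od] := denom_exists x^-1.
exists `|d|%N; first by rewrite absz_gt0.
have Id : I d%:~R by rewrite -(mulfVK x0 d%:~R); case: sI => _ _; apply.
case: d {d0 Od} Id => k //=; rewrite NegzE mulrNz => Id.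
by rewrite -[_%:R]opprK; apply: (@submodN _ K^o).
Qed.

Lemma finquot_ideal I x : is_submodK I -> I x -> x != 0 -> finquot O I.
Proof.
move=> sI Ix x0; have [m m0 Im] := ideal_nat sI Ix x0.
apply: (@finquot_sub _ K^o) (finquot_nat m0) => _ [y Oy ->].
by rewrite mulrC; case: sI => _ _; exact.
Qed.

Lemma quotient_submod a : is_submodK [set z : K | ringInt (z / a)].
Proof.
split=> [|u v|r u]; rewrite /= ?mul0r ?mulrDl -?mulrA.
- exact: ringInt0.
- exact: ringIntD.
- exact: ringIntM.
Qed.

(** As O/aO is finite, x^i a and x^j a agree modulo aO for some i < j. So x^i - x^j is integral, and
    x is a root of the monic polynomial X^j - X^i + (x^i - x^j). *)
Lemma ringInt_of_powers x a : a != 0 -> (forall k, ringInt (x ^+ k * a)) -> ringInt x.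
Proof.
move=> a0 h; have Oa : ringInt a by have := h 0%N; rewrite mul1r.
pose aO := [set z : K | ringInt (z / a)].
have saO : is_submodK aO by exact: quotient_submod.
have aOa : aO a by rewrite /aO /= divff //; exact: ringInt1.
have [i [j [ij]]] := finquot_pigeon (U := K^o) saO (finquot_ideal saO aOa a0) h.
rewrite /aO /= -mulrBl mulfK // => Oy.
pose p : {poly K} := 'X^j - 'X^i + (x ^+ i - x ^+ j)%:P.
have sp : (size ((x ^+ i - x ^+ j)%:P - 'X^i : {poly K})%R <= j)%N.
  apply: leq_trans (size_polyD _ _) _; rewrite size_polyN size_polyXn geq_max ij andbT.
  by apply: leq_trans (size_polyC_leq1 _) _; exact: leq_ltn_trans ij.
have pE : p = 'X^j + ((x ^+ i - x ^+ j)%:P - 'X^i) by rewrite /p; ring.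
apply: (@integral_root_monic _ _ _ _ p).
- by rewrite pE monicE lead_coefDl ?lead_coefXn // size_polyXn ltnS.
- by apply/rootP; rewrite /p !(hornerD, hornerN, hornerXn, hornerC); ring.
- apply/integral_poly => k; rewrite /p coefD coefB !coefXn coefC.
  apply: ringIntD; last by case: ifP => // _; exact: ringInt0.
  by apply: ringIntB; exact: integral_nat.
Qed.

End IdealQuotients.

(** * Invertibility of fractional ideals *)

Section Invertibility.
Variable K : fieldExtType rat.
Implicit Types (x y z r : K) (I J : set K).
Local Notation O := (ringInt : set K).

Section Annihilator.
Variables (J : set K) (a : K).
Hypotheses (sJ : is_submodK J) (JO : J `<=` O) (Ja : J a) (a0 : a != 0) (J1 : ~ J 1).

Let aO := [set z : K | ringInt (z / a)].

Let saO : is_submodK aO.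
Proof. exact: quotient_submod. Qed.

Let aOM r x : ringInt r -> aO x -> aO (r * x).
Proof. by case: saO => _ _; apply. Qed.

Let J_O x : J x -> ringInt (1 + x).
Proof. by move=> /JO; apply: ringIntD; exact: ringInt1. Qed.

(* Among the y whose annihilator modulo a avoids 1 + J, one with the largest
   annihilator is killed by J. *)
Lemma proper_ideal_annihilator : exists2 x, ~ ringInt x & forall j, J j -> ringInt (x * j).
Proof.
pose good y := ringInt y /\ forall j, J j -> ~ aO ((1 + j) * y).
have aOO : aO `<=` O.
  by move=> z; rewrite /aO /= => h; rewrite -(mulfVK a0 z); apply: ringIntM => //; exact: JO.
have aOa : aO a by rewrite /aO /= divff //; exact: ringInt1.
have [s sO sP] := finquot_in (U := K^o) (@submod_ringInt K) aOO (finquot_ideal saO aOa a0).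
(* The number of listed representatives of O/aO that do not kill y modulo a: a larger annihilator
   means a smaller [mu], so the maximal annihilator is found by minimising. *)
pose mu y := count (fun z => ~~ `[< aO (z * y) >]) s.
have mu_le y y' : (forall z, ringInt z -> aO (z * y) -> aO (z * y')) -> (mu y' <= mu y)%N.
  move=> h; rewrite /mu -!sum1_count big_mkcond [X in (_ <= X)%N]big_mkcond /= big_seq [X in (_
    <= X)%N]big_seq; apply: leq_sum => z /sO Oz.
  by case: asboolP => //= nz; case: asboolP => //= /(h _ Oz).
have mu_lt y y' j : ringInt y -> ringInt y' ->
    (forall z, ringInt z -> aO (z * y) -> aO (z * y')) ->
    ringInt j -> aO (j * y') -> ~ aO (j * y) -> (mu y' < mu y)%N.
  move=> Oy Oy' h Oj jy' jy; have [z zs zj] := sP _ Oj.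
  have tr w : ringInt w -> aO (j * w) <-> aO (z * w).
    move=> Ow; have d : aO ((j - z) * w) by rewrite mulrC; exact: aOM.
    split=> hh; last by rewrite -(subrK z j) mulrDl; case: saO => _ + _; apply.
    rewrite -[z](subKr j) mulrBl; exact: (@submodB _ K^o _ _ _ saO).
  rewrite /mu -!sum1_count big_mkcond [X in (_ < X)%N]big_mkcond /= (perm_big _ (perm_to_rem
    zs)) /=.
  rewrite [X in (_ < X)%N](perm_big _ (perm_to_rem zs)) /= !big_cons.
  rewrite (asboolT (proj1 (tr _ Oy') jy')) /= asboolF; last by move/(proj2 (tr _ Oy)).
  rewrite /= add0n add1n ltnS big_seq [X in (_ <= X)%N]big_seq; apply: leq_sum => w ws.
  case: asboolP => //= nw; case: asboolP => //= wy; case: nw.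
  by apply: h => //; exact: sO (mem_rem ws).
have good1 : good 1.
  split=> [|j Jj]; first exact: ringInt1.
  rewrite mulr1 /aO /= => h; apply: J1; rewrite -(addrK j 1).
  apply: (@submodB _ K^o) => //; rewrite -(mulfVK a0 (1 + j)).
  by case: sJ => _ _; apply.
have exm : exists k, `[< exists2 y, good y & mu y = k >].
  by exists (mu 1); apply/asboolP; exists 1.
case: (ex_minnP exm) => k /asboolP[y gy muy] kmin.
have mumin y' : good y' -> (k <= mu y')%N by move=> gy'; apply: kmin; apply/asboolP; exists y'.
have step y' j : J j -> good y' -> mu y' = k -> ~ aO (j * y') ->
    [/\ good (j * y'), mu (j * y') = k & ~ aO (j * (j * y'))].
  move=> Jj [Oy' gy'] muy' njy'.
  have Ojy' : ringInt (j * y') by apply: ringIntM => //; exact: JO.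
  have h z : ringInt z -> aO (z * y') -> aO (z * (j * y')).
    by move=> Oz zy'; rewrite mulrCA; apply: aOM => //; exact: JO.
  (* If 1 + j1 killed j y', then (1 + j1) y' would still be good, since 1 + J is closed under
     products, and its annihilator would be strictly larger than that of y', as it contains j. *)
  have gj : good (j * y').
    split=> // j1 Jj1 hj1.
    have : good ((1 + j1) * y').
      split; first by apply: ringIntM => //; exact: J_O.
      move=> j2 Jj2; rewrite mulrA.
      have -> : (1 + j2) * (1 + j1) = 1 + (j2 + (1 + j2) * j1) by ring.
      apply: gy'; case: sJ => _ JD JM; apply: JD => //; apply: JM => //; exact: J_O.
    move/mumin; rewrite -muy' leqNgt => /negP; apply; apply: (mu_lt _ _ j) => //.
    - by apply: ringIntM => //; exact: J_O.
    - by move=> z Oz zy'; rewrite mulrCA; apply: aOM => //; exact: J_O.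
    - exact: JO.
    - by rewrite mulrCA.
  have muj : mu (j * y') = k.
    by apply/eqP; rewrite eqn_leq mumin // -muy' mu_le.
  split=> // hj; have := mu_lt _ _ _ Oy' Ojy' h (JO Jj) hj njy'.
  by rewrite muj muy' ltnn.
have yJ j : J j -> aO (j * y).
  (* If j y is nonzero modulo a, then all j^i y stay good. Two powers of j agree modulo a, so some 1
     - j^k with k > 0, an element of 1 + J, kills a good element. *)
  move=> Jj; apply: contrapT => njy.
  have it i : [/\ good (j ^+ i * y), mu (j ^+ i * y) = k & ~ aO (j * (j ^+ i * y))].
    elim: i => [|i [g1 g2 g3]]; first by rewrite expr0 mul1r.
    by rewrite exprS -mulrA; exact: step.
  have [i1 [i2 [lt_i /= h]]] :=
    finquot_pigeon (U := K^o) (f := fun i => j ^+ i) saO (finquot_ideal saO aOa a0) (fun i =>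
      ringIntX i (JO Jj)).
  have [[_ g] _ _] := it i1.
  apply: (g (- j ^+ (i2 - i1))).
    apply: (@submodN _ K^o) => //.
    rewrite -[(i2 - i1)%N]prednK ?subn_gt0 // exprSr; case: sJ => _ _; apply => //.
    exact/ringIntX/JO.
  have -> : (1 - j ^+ (i2 - i1)) * (j ^+ i1 * y) = y * (j ^+ i1 - j ^+ i2).
    by rewrite -[in RHS](subnK (ltnW lt_i)) exprD; ring.
  by apply: aOM => //; case: gy.
exists (y / a) => [h|j /yJ]; last by rewrite mulrAC [y * j]mulrC.
by case: gy => _ /(_ 0); apply; [case: sJ|rewrite addr0 mul1r].
Qed.

End Annihilator.

Lemma fracideal_inv I : is_fracideal I -> is_fracideal (idinv I).
Proof.
move=> [[I0 ID IM] [x Ix x0] [d [Od d0 dI]]]; split; first split.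
- by move=> y _; rewrite mul0r; exact: ringInt0.
- by move=> u v hu hv y Iy; rewrite mulrDl; apply: ringIntD; [exact: hu|exact: hv].
- by move=> r u Or hu y Iy; rewrite -mulrA; apply: ringIntM => //; exact: hu.
- by exists d => // y Iy; exact: dI.
- have [e e0 Oe] := denom_exists x.
  have e0K : (e%:~R : K) != 0 by rewrite intr_eq0K.
  exists (e%:~R * x); split=> //; first by rewrite mulf_neq0.
  by move=> y hy; rewrite -mulrA; apply: ringIntM; [exact: ringInt_int|rewrite mulrC; exact: hy].
Qed.

(** If J = I I^-1 were proper, there would be a non-integral x with x J in O. Then x I^-1 lies in
    I^-1, so all x^k v i with v in I^-1 and i in I are integral, and [ringInt_of_powers] makes x
    integral. *)
Lemma idmul_idinv I : is_fracideal I -> idmul I (idinv I) = O.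
Proof.
move=> fI; have fV := fracideal_inv fI; have [sJ _ _] := fracidealM fI fV.
have JO : idmul I (idinv I) `<=` O.
  by move=> _ [k [a [b [Ia Vb ->]]]]; apply: ringInt_sum => i; rewrite mulrC; exact: Vb.
apply/seteqP; split=> //.
suff J1 : idmul I (idinv I) 1.
  by move=> x Ox; rewrite -(mulr1 x); case: sJ => _ _; apply.
have [[_ _ _] [i Ii i0] _] := fI; have [[_ _ VM] [v Vv v0] _] := fV.
apply: contrapT => nJ1.
have [x nOx xJ] := proper_ideal_annihilator sJ JO (prodset1 *%R Ii Vv) (mulf_neq0 i0 v0) nJ1.
apply: nOx; apply: (@ringInt_of_powers _ _ (v * i)); first by rewrite mulf_neq0.
have xV k : idinv I (x ^+ k * v).
  elim: k => [|k IH]; first by rewrite mul1r.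
  move=> y Iy; have -> : x ^+ k.+1 * v * y = x * (y * (x ^+ k * v)) by rewrite exprS; ring.
  exact/xJ/prodset1.
by move=> k; rewrite mulrA; exact: xV.
Qed.

End Invertibility.

(** * Approximation modulo an ideal *)

Section Approximation.
Variables (K : fieldExtType rat) (U : lmodType K) (X : set U) (n : nat) (phi : 'I_n -> U -> K).
Variable (m : set K) (m0 : K).
Hypotheses (sX : submod X) (sm : is_submodK m) (mm0 : m m0) (m00 : m0 != 0).
Hypothesis phiO : forall i x, X x -> ringInt (phi i x).
Hypothesis phiL : forall i r x y, ringInt r -> X x -> X y ->
  phi i (r *: x + y) = r * phi i x + phi i y.

Let Pid x : set K := [set t | exists (r : 'I_n -> K) (mu : K),
  [/\ forall i, ringInt (r i), m mu & t = \sum_i r i * phi i x + mu]].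

Let sP x : is_submodK (Pid x).
Proof.
have [h0 hD hM] := sm; split.
- exists (fun=> 0), 0; split=> // [_|]; first exact: ringInt0.
  by rewrite big1 ?addr0 // => i _; rewrite mul0r.
- move=> _ _ [r [mu [Or mmu ->]]] [r' [mu' [Or' mmu' ->]]].
  exists (fun i => r i + r' i), (mu + mu'); split=> [i||]; first exact: ringIntD.
    exact: hD.
  by rewrite addrACA -big_split; congr (_ + _); apply: eq_bigr => i _; rewrite mulrDl.
- move=> s _ Os [r [mu [Or mmu ->]]].
  exists (fun i => s * r i), (s * mu); split=> [i||]; first exact: ringIntM.
    exact: hM.
  by rewrite mulrDr mulr_sumr; congr (_ + _); apply: eq_bigr => i _; rewrite mulrA.
Qed.

Let Pm x mu : m mu -> Pid x mu.
Proof.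
move=> h; exists (fun=> 0), mu; split=> // [_|]; first exact: ringInt0.
by rewrite big1 ?add0r // => i _; rewrite mul0r.
Qed.

Let Pphi x i : Pid x (phi i x).
Proof.
exists (fun j => (j == i)%:R), 0; split=> [j||]; first exact: integral_nat.
  by case: sm.
rewrite addr0 (bigD1 i) //= eqxx mul1r big1 ?addr0 // => j /negbTE->.
by rewrite mul0r.
Qed.

Let Ppow x a b i j : ringInt a -> ringInt b -> Pid x (a ^+ i) -> Pid x (b ^+ j) ->
  Pid x ((a + b) ^+ (i + j)).
Proof.
move=> Oa Ob Pa Pb; have [_ _ PM] := sP x.
rewrite exprDn; apply: (@submod_sum _ K^o) => [|k _]; first exact: sP.
rewrite -mulr_natl; apply: (PM); first exact: integral_nat.
have [jk|kj] := leqP j k.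
  apply: (PM); first exact: ringIntX.
  by rewrite -(subnK jk) exprD; apply: (PM) => //; exact: ringIntX.
have ij : (i <= i + j - k)%N by rewrite -addnBA ?leq_addr // ltnW.
rewrite mulrC; apply: (PM); first exact: ringIntX.
by rewrite -(subnK ij) exprD; apply: (PM) => //; exact: ringIntX.
Qed.

(** In the finite ring O/m the powers of c are periodic from the exponent i + 1 on, with period d.
    The exponent M = (i + 1) d is in the periodic range and a multiple of d, so c^M and c^(2M)
    agree. *)
Let idem_power c : ringInt c -> exists2 M, (0 < M)%N & m (c ^+ M - c ^+ (M + M)).
Proof.
move=> Oc.
have [i [k [ik /= h]]] := finquot_pigeon (U := K^o) (f := fun i => c ^+ i.+1) sm
  (finquot_ideal sm mm0 m00) (fun i => ringIntX i.+1 Oc).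
pose d := (k - i)%N; have d0 : (0 < d)%N by rewrite subn_gt0.
have mM r x : ringInt r -> m x -> m (r * x) by case: sm => _ _; apply.
have stp t s : (i.+1 <= t)%N -> m (c ^+ t - c ^+ (t + s * d)).
  move=> it; elim: s => [|s IH]; first by rewrite mul0n addn0 subrr; case: sm.
  have -> : c ^+ t - c ^+ (t + s.+1 * d) =
      (c ^+ t - c ^+ (t + s * d)) + c ^+ (t + s * d - i.+1) * (c ^+ i.+1 - c ^+ k.+1).
    rewrite mulrBr -!exprD addrA; congr (_ - _).
      by rewrite subnK ?subrK // (leq_trans it) ?leq_addr.
    by congr (_ ^+ _); rewrite mulSn /d; lia.
  by case: (sm) => _ mD _; apply: mD => //; apply: mM => //; exact: ringIntX.
exists (i.+1 * d)%N; first by rewrite muln_gt0.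
by apply: stp; rewrite leq_pmulr.
Qed.

(* If c = phi_i(x_i) has idempotent power f modulo m, then f x_i + (1 - f) x'
   generates at least as much as x' and f. *)
Lemma approximation (x : 'I_n -> U) : (forall i, X (x i)) -> \sum_i phi i (x i) = 1 ->
  exists y, X y /\ exists (r : 'I_n -> K) (mu : K),
    [/\ forall i, ringInt (r i), m mu & 1 = \sum_i r i * phi i y + mu].
Proof.
move=> Xx S1.
(* Induction over the indices: only a power of the partial sum is shown to lie in the ideal of y,
   which is enough since the full sum is 1. *)
suff [y Xy [N]] : exists2 y, X y &
  exists N, Pid y ((\sum_(i <- index_enum 'I_n) phi i (x i)) ^+ N).
  by rewrite S1 expr1n => h; exists y.
elim: (index_enum 'I_n) => [|i s [x' Xx' [N IH]]].
  by exists 0; [case: sX|exists 1%N; rewrite big_nil expr1; case: (sP 0)].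
have Oc : ringInt (phi i (x i)) by exact: phiO.
have [M M0 mM] := idem_power Oc; set c := phi i (x i) in Oc mM *.
pose f := c ^+ M; have Of : ringInt f by exact: ringIntX.
have [_ XD XM] := sX.
pose y := f *: x i + (1 - f) *: x'.
have Of1 : ringInt (1 - f) by apply: ringIntB => //; exact: ringInt1.
have phiy l : phi l y = f * phi l (x i) + phi l x' - f * phi l x'.
  have X0 : X 0 by case: sX.
  have p0 : phi l 0 = 0.
    have := phiL l (ringInt1 K) X0 X0; rewrite scaler0 addr0 mul1r => /eqP.
    by rewrite -subr_eq0 opprD addNKr oppr_eq0 => /eqP.
  rewrite /y phiL //; last exact: XM.
  by rewrite -[(1 - f) *: x']addr0 phiL // p0; ring.
have Xy : X y by apply: XD; exact: XM.
have [_ PD PM] := sP y.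
have ff : Pid y (f - f * f) by apply: Pm; rewrite /f -exprD.
(* As f^2 = f modulo m, f phi_i(y) is f c modulo m. Since f c divides f^2, the ideal of y contains
   f, and then also the phi_l(x'), which differ from phi_l(y) by multiples of f. *)
have Pfc : Pid y (f * c).
  have -> : f * c = f * phi i y + (c - phi i x') * (f - f * f).
    by rewrite phiy -/c; ring.
  apply: (PD); apply: (PM) => //.
  by apply: ringIntB => //; exact: phiO.
have Pf : Pid y f.
  rewrite -(subrK (f * f) f); apply: (PD) => //.
  by rewrite {2}/f -(prednK M0) exprS mulrA mulrC; apply: (PM) => //; exact: ringIntX.
have sub : Pid x' `<=` Pid y.
  move=> _ [r [mu [Or mmu ->]]]; apply: (PD); last exact: Pm.
  apply: (@submod_sum _ K^o) => [|l _]; first exact: sP.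
  apply: (PM) => //.
  have -> : phi l x' = phi l y + (phi l x' - phi l (x i)) * f by rewrite phiy; ring.
  apply: (PD); first exact: Pphi.
  by apply: (PM) => //; apply: ringIntB; exact: phiO.
exists y => //; exists (M + N)%N; rewrite big_cons; apply: Ppow => //; last exact: sub.
by apply: (big_ind ringInt) => // [||j _]; [exact: ringInt0|exact: ringIntD|exact: phiO].
Qed.

End Approximation.

(** * Products of ideals and modules *)

Section Products.
Variables (K : fieldExtType rat) (U : lmodType K).
Implicit Types (I J : set K) (L M X : set U).
Local Notation O := (ringInt : set K).

Definition sprod I L : set U := prodset (fun (x : K) (v : U) => x *: v) I L.

Lemma mem_sprod I L x v : I x -> L v -> sprod I L (x *: v).
Proof. exact: prodset1. Qed.

Lemma sprod_sub I L X : submod X -> (forall x v, I x -> L v -> X (x *: v)) ->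
  sprod I L `<=` X.
Proof.
by move=> sX h _ [k [x [v [Ix Lv ->]]]]; apply: submod_sum => // i _; exact: h.
Qed.

Lemma sprod_submod I L : is_submodK I -> submod (sprod I L).
Proof.
move=> [I0 _ IM]; split.
- by exists 0%N, (fun=> 0), (fun=> 0); rewrite big_ord0; split => // -[].
- by move=> u v; exact: prodsetD.
- move=> r _ Or [k [x [v [Ix Lv ->]]]]; exists k, (fun i => r * x i), v.
  split=> // [i|]; first exact: IM.
  by rewrite scaler_sumr; apply: eq_bigr => i _; rewrite scalerA.
Qed.

Lemma sprodS I I' L L' : I `<=` I' -> L `<=` L' -> sprod I L `<=` sprod I' L'.
Proof.
move=> II LL _ [k [x [v [Ix Lv ->]]]]; exists k, x, v; split=> // i; [exact: II|exact: LL].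
Qed.

Lemma sprodO L : submod L -> sprod O L = L.
Proof.
move=> sL; apply/seteqP; split; first by apply: sprod_sub => //; case: sL.
by move=> v Lv; rewrite -[v]scale1r; apply: mem_sprod => //; exact: ringInt1.
Qed.

End Products.

Lemma sprodA (K : fieldExtType rat) (U : lmodType K) (I J : set K) (L : set U) : is_submodK I ->
  is_submodK J ->
  sprod (idmul I J) L = sprod I (sprod J L).
Proof.
move=> sI sJ; have sIJ : is_submodK (idmul I J) by exact: (@sprod_submod K K^o).
apply/seteqP; split; apply: sprod_sub; try exact: sprod_submod.
  move=> _ v [k [x [y [Ix Jy ->]]]] Lv; rewrite scaler_suml.
  apply: submod_sum => [|i _]; first exact: sprod_submod.
  by rewrite -scalerA; apply: mem_sprod => //; exact: mem_sprod.
move=> x _ Ix [k [y [v [Jy Lv ->]]]]; rewrite scaler_sumr.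
apply: submod_sum => [|i _]; first exact: sprod_submod.
by rewrite scalerA; apply: mem_sprod => //; exact: prodset1.
Qed.

Section IdealAlgebra.
Variable K : fieldExtType rat.
Implicit Types (I J g h L X : set K) (x y : K).
Local Notation O := (ringInt : set K).

Lemma idmulC I J : idmul I J = idmul J I.
Proof.
have h A B : idmul A B `<=` idmul B A.
  move=> _ [k [x [y [Ax By ->]]]]; exists k, y, x; split=> //.
  by apply: eq_bigr => i _; rewrite mulrC.
by apply/seteqP; split; exact: h.
Qed.

Lemma idmul_submod I J : is_submodK I -> is_submodK (idmul I J).
Proof. exact: (@sprod_submod K K^o). Qed.

Lemma idmulA I J L : is_submodK I -> is_submodK J -> idmul (idmul I J) L = idmul I (idmul J L).
Proof. exact: (@sprodA K K^o). Qed.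

Lemma idmulO I : is_submodK I -> idmul O I = I.
Proof. exact: (@sprodO K K^o). Qed.

Lemma idmulS I I' J J' : I `<=` I' -> J `<=` J' -> idmul I J `<=` idmul I' J'.
Proof. exact: (@sprodS K K^o). Qed.

Lemma mem_idmul I J x y : I x -> J y -> idmul I J (x * y).
Proof. exact: (@mem_sprod K K^o). Qed.

Lemma idmul_sub I J X : is_submodK X -> (forall x y, I x -> J y -> X (x * y)) ->
  idmul I J `<=` X.
Proof. exact: (@sprod_sub K K^o). Qed.

Lemma fracideal_submod I : is_fracideal I -> is_submodK I.
Proof. by case. Qed.

Lemma intideal_submod I : is_intideal I -> is_submodK I.
Proof. by case. Qed.

Lemma idmulK I J : is_fracideal I -> is_submodK J -> idmul (idinv I) (idmul I J) = J.
Proof.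
move=> fI sJ; have fV := fracideal_inv fI.
by rewrite -idmulA ?[idmul (idinv I) I]idmulC ?idmul_idinv ?idmulO //; exact: fracideal_submod.
Qed.

Lemma idmul_inj I J J' : is_fracideal I -> is_submodK J -> is_submodK J' ->
  idmul I J = idmul I J' -> J = J'.
Proof. by move=> fI sJ sJ' E; rewrite -(idmulK fI sJ) E idmulK. Qed.

Lemma idinv_uniq I J : is_fracideal I -> is_submodK J -> idmul I J = O -> J = idinv I.
Proof.
move=> fI sJ E; have fV := fracideal_inv fI.
by apply: (idmul_inj fI) => //; rewrite ?idmul_idinv //; exact: fracideal_submod.
Qed.

Lemma idinvK I : is_fracideal I -> idinv (idinv I) = I.
Proof.
move=> fI; have fV := fracideal_inv fI; apply/esym/idinv_uniq => //.
  exact: fracideal_submod.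
by rewrite idmulC idmul_idinv.
Qed.

Lemma idinvM I J : is_fracideal I -> is_fracideal J ->
  idinv (idmul I J) = idmul (idinv I) (idinv J).
Proof.
move=> fI fJ; have [fVI fVJ] := (fracideal_inv fI, fracideal_inv fJ).
have [sI sJ sVI sVJ] := And4 (fracideal_submod fI) (fracideal_submod fJ)
  (fracideal_submod fVI) (fracideal_submod fVJ).
apply/esym/idinv_uniq; [exact: fracidealM|exact: idmul_submod|].
rewrite [idmul (idinv I) _]idmulC idmulA // -[idmul J (idmul _ _)]idmulA //.
by rewrite idmul_idinv // idmulO // idmul_idinv.
Qed.

Lemma idinvO : idinv O = O.
Proof.
have fO := fracideal_ringInt K; apply/esym/idinv_uniq => //.
  exact: fracideal_submod.
by rewrite idmulO //; exact: fracideal_submod.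
Qed.

Lemma fracideal_bound I x c : is_submodK I -> I x -> x != 0 -> c != 0 ->
  (forall y, I y -> ringInt (c * y)) -> is_fracideal I.
Proof.
move=> sI Ix x0 c0 h; split=> //; first by exists x.
have [e e0 Oe] := denom_exists c.
exists (e%:~R * c); split=> //; first by rewrite mulf_neq0 ?intr_eq0K.
by move=> y /h Oy; rewrite -mulrA; apply: ringIntM => //; exact: ringInt_int.
Qed.

Lemma fracideal_sub I J x : is_submodK I -> I x -> x != 0 -> I `<=` J ->
  is_fracideal J -> is_fracideal I.
Proof.
move=> sI Ix x0 IJ [_ _ [d [Od d0 dJ]]].
by apply: (fracideal_bound sI Ix x0 d0) => y /IJ; exact: dJ.
Qed.

Lemma sumset_submod (U : lmodType K) (X Y : set U) : submod X -> submod Y -> submod (sumset X Y).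
Proof.
move=> [X0 XD XM] [Y0 YD YM]; split.
- by exists 0, 0; rewrite addr0.
- move=> _ _ [x [y [Xx Yy ->]]] [x' [y' [Xx' Yy' ->]]].
  by exists (x + x'), (y + y'); split; [exact: XD|exact: YD|rewrite addrACA].
- move=> r _ Or [x [y [Xx Yy ->]]].
  by exists (r *: x), (r *: y); split; [exact: XM|exact: YM|rewrite scalerDr].
Qed.

Lemma sumsetl (U : lmodType K) (X Y : set U) : submod Y -> X `<=` sumset X Y.
Proof. by move=> [Y0 _ _] x Xx; exists x, 0; rewrite addr0. Qed.

Lemma sumsetr (U : lmodType K) (X Y : set U) : submod X -> Y `<=` sumset X Y.
Proof. by move=> [X0 _ _] y Yy; exists 0, y; rewrite add0r. Qed.

Lemma sumset_sub (U : lmodType K) (X Y Z : set U) : submod Z -> X `<=` Z -> Y `<=` Z ->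
  sumset X Y `<=` Z.
Proof. by move=> [_ ZD _] XZ YZ _ [x [y [/XZ Zx /YZ Zy ->]]]; exact: ZD. Qed.

Lemma sumset_frac I J : is_fracideal I -> is_fracideal J -> is_fracideal (sumset I J).
Proof.
move=> [sI [x Ix x0] [d [Od d0 dI]]] [sJ _ [e [Oe e0 eJ]]].
apply: (@fracideal_bound _ x (d * e)) => //.
- exact: (@sumset_submod K^o).
- exact: (@sumsetl K^o).
- by rewrite mulf_neq0.
move=> _ [a [b [Ia Jb ->]]]; rewrite mulrDr; apply: ringIntD.
  by rewrite mulrAC mulrC; apply: ringIntM => //; exact: dI.
by rewrite -mulrA; apply: ringIntM => //; exact: eJ.
Qed.

Lemma intideal_of_frac I : is_fracideal I -> I `<=` O -> is_intideal I.
Proof. by case. Qed.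

Lemma intideal_ringInt : is_intideal O.
Proof. by apply: intideal_of_frac => //; exact: fracideal_ringInt. Qed.

Lemma intidealM I J : is_intideal I -> is_intideal J -> is_intideal (idmul I J).
Proof.
move=> iI iJ; apply: intideal_of_frac;
  first exact: fracidealM (intideal_frac iI) (intideal_frac iJ).
case: iI iJ => _ _ IO [_ _ JO].
by apply: idmul_sub => [|x y /IO Ox /JO]; [exact: submod_ringInt|exact: ringIntM].
Qed.

Lemma int_sub_inv g : is_intideal g -> O `<=` idinv g.
Proof. by case=> _ _ gO x Ox y /gO; exact: ringIntM. Qed.

Lemma sprod_idinv_sub (U : lmodType K) (c : set K) (L : set U) : is_intideal c -> submod L ->
  L `<=` sprod (idinv c) L.
Proof.
by move=> ic sL; rewrite -[X in X `<=` _](sprodO sL); apply: sprodS => //; exact: int_sub_inv.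
Qed.

Lemma idmul_int_sub g I : is_intideal g -> is_submodK I -> idmul g I `<=` I.
Proof. by case=> _ _ gO [I0 ID IM]; apply: idmul_sub => // x y /gO; exact: IM. Qed.

(** To contain is to divide. *)
Lemma idmul_idinv_sub I J : is_fracideal J -> is_submodK I ->
  (idmul (idinv J) I `<=` O) <-> (I `<=` J).
Proof.
move=> fJ sI; have fV := fracideal_inv fJ.
have [sJ sV] := (fracideal_submod fJ, fracideal_submod fV).
split=> h.
  rewrite -(idmulK fV sI) idinvK // -[X in _ `<=` X]idmulO // [idmul O J]idmulC.
  exact: idmulS.
by rewrite -(idmul_idinv fJ) idmulC; exact: idmulS.
Qed.

Lemma idmul_inv_intideal g h : is_intideal g -> is_intideal h -> h `<=` g ->
  is_intideal (idmul (idinv g) h).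
Proof.
move=> ig ih hg; have fg := intideal_frac ig; have fh := intideal_frac ih.
apply: intideal_of_frac; first exact: fracidealM (fracideal_inv fg) fh.
by apply/idmul_idinv_sub => //; exact: intideal_submod.
Qed.

Definition principal x : set K := [set x * y | y in O].

Lemma principal_frac x : x != 0 -> is_fracideal (principal x).
Proof.
move=> x0; apply: (@fracideal_bound _ x x^-1) => //.
- split.
  + by exists 0; [exact: ringInt0|rewrite mulr0].
  + move=> _ _ [a Oa <-] [b Ob <-]; exists (a + b); last by rewrite mulrDr.
    exact: ringIntD.
  + move=> r _ Or [a Oa <-]; exists (r * a); last by rewrite mulrCA.
    exact: ringIntM.
- by exists 1; [exact: ringInt1|rewrite mulr1].
- by rewrite invr_eq0.
- by move=> _ [a Oa <-]; rewrite mulKf.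
Qed.

Lemma idmul_principal x I : is_submodK I -> idmul (principal x) I = [set x * y | y in I].
Proof.
move=> sI; have [I0 ID IM] := sI; apply/seteqP; split.
  move=> _ [k [a [b [pa Ib ->]]]].
  have /choice[c cP] i : exists c, ringInt c /\ a i = x * c by have [c] := pa i; exists c.
  exists (\sum_i c i * b i).
    by apply: (@submod_sum _ K^o) => // i _; apply: (IM) => //; case: (cP i).
  rewrite mulr_sumr; apply: eq_bigr => i _; case: (cP i) => _ ->.
  by rewrite mulrA.
move=> _ [y Iy <-]; apply: mem_idmul => //; exists 1; first exact: ringInt1.
by rewrite mulr1.
Qed.

(* An element of I generating I locally at the primes dividing m. *)
Lemma fracideal_approx I m : is_fracideal I -> is_intideal m ->
  exists x, [/\ I x, x != 0 & exists y mu, [/\ idinv I y, m mu & x * y + mu = 1]].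
Proof.
move=> fI [sm [m0 mm0 m00] mO].
have sI := fracideal_submod fI; have [_ [x0 Ix0 x00] _] := fI.
(* If m is the unit ideal, any nonzero x works with y = 0. Otherwise 1 is not in m, which excludes x
   = 0 in the relation x y + mu = 1. *)
case: (pselect (m 1)) => [m1|nm1].
  exists x0; split=> //; exists 0, 1; rewrite mulr0 add0r; split=> //.
  by case: (fracideal_submod (fracideal_inv fI)).
have : idmul I (idinv I) 1 by rewrite idmul_idinv //; exact: ringInt1.
move=> [n [a [b [Ia Vb E]]]].
have [||||x [Ix [r [mu [Or mmu E1]]]]] := @approximation K K^o I n (fun i (x : K) => x * b i) m
  m0 sI sm mm0 m00 _ _ a.
- by move=> i x Ix; rewrite mulrC; exact: Vb.
- by move=> i r x y _ _ _; rewrite mulrDl mulrA.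
- exact: Ia.
- by rewrite E.
have E2 : x * (\sum_i r i * b i) + mu = 1.
  by rewrite E1 mulr_sumr; congr (_ + _); apply: eq_bigr => i _; rewrite mulrCA.
exists x; split=> //.
  by apply/eqP => x0E; move: E2 mmu; rewrite x0E mul0r add0r => -> /nm1.
exists (\sum_i r i * b i), mu; split=> //.
apply: (@submod_sum _ K^o) => [|i _]; first exact/fracideal_submod/fracideal_inv.
by case: (fracideal_inv fI) => -[_ _ VM] _ _; apply: VM.
Qed.

End IdealAlgebra.

(** * Lattices of rank two *)

Section PlaneLattices.
Variables (K : fieldExtType rat) (U : lmodType K).
Implicit Types (I J g h : set K) (L M X : set U) (u v l w : U).
Local Notation O := (ringInt : set K).

Definition indep u v := forall x y : K, x *: u + y *: v = 0 -> x = 0 /\ y = 0.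

Definition dsum J l I w : set U :=
  [set z | exists x y, [/\ J x, I y & z = x *: l + y *: w]].

(* M is commensurable with O u + O v. *)
Definition lat u v M : Prop :=
  [/\ submod M,
      exists2 d : K, d != 0 & forall z, M z ->
        exists x y, [/\ ringInt x, ringInt y & d *: z = x *: u + y *: v]
    & exists2 e : K, e != 0 & M (e *: u) /\ M (e *: v)].

Lemma indep_inj u v (x y x' y' : K) : indep u v ->
  x *: u + y *: v = x' *: u + y' *: v -> x = x' /\ y = y'.
Proof.
move=> uv E; have [|/subr0_eq -> /subr0_eq ->//] := uv (x - x') (y - y').
by rewrite !scalerBl addrACA E -opprD subrr.
Qed.

Lemma indep_sym u v : indep u v -> indep v u.
Proof. by move=> uv x y; rewrite addrC => /uv[]. Qed.

Lemma comb_comb u v (x y a b c d : K) :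
  x *: (a *: u + b *: v) + y *: (c *: u + d *: v) =
  (x * a + y * c) *: u + (x * b + y * d) *: v.
Proof. by rewrite !scalerDr !scalerA addrACA -!scalerDl. Qed.

Lemma indep_change u v (a b c d : K) : indep u v -> a * d - b * c != 0 ->
  indep (a *: u + b *: v) (c *: u + d *: v).
Proof.
move=> uv D x y; rewrite comb_comb => /uv[E1 E2].
have hx : x * (a * d - b * c) = 0.
  have -> : x * (a * d - b * c) = (x * a + y * c) * d - (x * b + y * d) * c by ring.
  by rewrite E1 E2 !mul0r subr0.
have hy : y * (a * d - b * c) = 0.
  have -> : y * (a * d - b * c) = (x * b + y * d) * a - (x * a + y * c) * b by ring.
  by rewrite E1 E2 !mul0r subr0.
by split; apply/eqP; [move/eqP: hx|move/eqP: hy]; rewrite mulf_eq0 (negbTE D) orbF.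
Qed.

Lemma dsum_fst_submod u v M : submod M -> is_submodK [set x | exists y, M (x *: u + y *: v)].
Proof.
move=> [M0 MD MZ]; split=> [|x x' [y h] [y' h']|r x Or [y h]].
- by exists 0; rewrite !scale0r addr0.
- by exists (y + y'); have := MD _ _ h h'; rewrite addrACA -!scalerDl.
- by exists (r * y); have := MZ _ _ Or h; rewrite scalerDr !scalerA.
Qed.

Lemma dsum_snd_submod u v M : submod M -> is_submodK [set y | exists x, M (x *: u + y *: v)].
Proof.
move=> /(dsum_fst_submod v u); congr is_submodK; apply/seteqP.
by split=> y [x h]; exists x; rewrite addrC.
Qed.

Lemma bounded_submod u v (d : K) :
  submod [set z | exists x y, [/\ ringInt x, ringInt y & d *: z = x *: u + y *: v]].
Proof.
split=> [|y z [p [q [Op Oq E]]] [p' [q' [Op' Oq' E']]]|r y Or [p [q [Op Oq E]]]].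
- by exists 0, 0; rewrite scaler0 !scale0r addr0; split=> //; exact: ringInt0.
- exists (p + p'), (q + q'); split; [exact: ringIntD|exact: ringIntD|].
  by rewrite scalerDr E E' addrACA -!scalerDl.
- exists (r * p), (r * q); split; [exact: ringIntM|exact: ringIntM|].
  by rewrite scalerA [_ * r]mulrC -[LHS]scalerA E scalerDr !scalerA.
Qed.

Lemma lat_submod u v M : lat u v M -> submod M.
Proof. by case. Qed.

Lemma lat_sym u v M : lat u v M -> lat v u M.
Proof.
move=> [sM [d d0 h] [e e0 [eu ev]]]; split=> //; last by exists e.
by exists d => // z /h[x [y [Ox Oy E]]]; exists y, x; rewrite addrC.
Qed.

Lemma lat_between u v L M X : lat u v L -> lat u v M -> submod X ->
  L `<=` X -> X `<=` M -> lat u v X.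
Proof.
move=> [_ _ [e e0 [eu ev]]] [_ [d d0 h] _] sX LX XM; split=> //.
  by exists d => // z /XM /h.
by exists e => //; split; exact: LX.
Qed.

Lemma lat_span u v M z : lat u v M -> M z -> exists x y, z = x *: u + y *: v.
Proof.
move=> [_ [d d0 h] _] /h[x [y [_ _ E]]]; exists (d^-1 * x), (d^-1 * y).
by rewrite -!scalerA -scalerDr -E scalerA mulVf // scale1r.
Qed.

Lemma dsum_submod J I l w : is_submodK J -> is_submodK I -> submod (dsum J l I w).
Proof.
move=> [J0 JD JM] [I0 ID IM]; split.
- by exists 0, 0; rewrite !scale0r addr0.
- move=> _ _ [x [y [Jx Iy ->]]] [x' [y' [Jx' Iy' ->]]].
  exists (x + x'), (y + y'); split; [exact: JD|exact: ID|].
  by rewrite !scalerDl addrACA.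
- move=> r _ Or [x [y [Jx Iy ->]]]; exists (r * x), (r * y).
  by split; [exact: JM|exact: IM|rewrite scalerDr !scalerA].
Qed.

Lemma dsum_subset J I J' I' l w : indep l w -> is_submodK J -> is_submodK I ->
  dsum J l I w `<=` dsum J' l I' w -> J `<=` J' /\ I `<=` I'.
Proof.
move=> lw [J0 _ _] [I0 _ _] h; split=> [x Jx|y Iy].
  have [|x' [y' [Jx' _]]] := h (x *: l + 0 *: w); first by exists x, 0.
  by move/(indep_inj lw) => [-> _].
have [|x' [y' [_ Iy']]] := h (0 *: l + y *: w); first by exists 0, y.
by move/(indep_inj lw) => [_ ->].
Qed.

Lemma dsumS J I J' I' l w : J `<=` J' -> I `<=` I' -> dsum J l I w `<=` dsum J' l I' w.
Proof. by move=> JJ II _ [x [y [/JJ Jx /II Iy ->]]]; exists x, y. Qed.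

Lemma sprod_dsum g J I l w : is_submodK g -> is_submodK J -> is_submodK I ->
  sprod g (dsum J l I w) = dsum (idmul g J) l (idmul g I) w.
Proof.
move=> sg sJ sI; have [J0 _ _] := sJ; have [I0 _ _] := sI.
apply/seteqP; split.
  apply: sprod_sub; first by apply: dsum_submod; exact: idmul_submod.
  move=> r _ gr [x [y [Jx Iy ->]]]; exists (r * x), (r * y).
  by split; [exact: mem_idmul|exact: mem_idmul|rewrite scalerDr !scalerA].
have [_ SD _] := sprod_submod (dsum J l I w) sg.
move=> _ [a [b [[k [x [y [gx Jy ->]]]] [k' [x' [y' [gx' Iy' ->]]]] ->]]].
rewrite !scaler_suml; apply: SD; apply: submod_sum => [|i _]; try exact: sprod_submod.
  rewrite -scalerA; apply: mem_sprod => //; exists (y i), 0.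
  by rewrite scale0r addr0.
rewrite -scalerA; apply: mem_sprod => //; exists 0, (y' i).
by rewrite scale0r add0r.
Qed.

Lemma frac_common I J : is_fracideal I -> is_fracideal J ->
  exists2 d : K, d != 0 & (forall x, I x -> ringInt (d * x)) /\ (forall x, J x ->
    ringInt (d * x)).
Proof.
move=> [_ _ [d [Od d0 dI]]] [_ _ [e [Oe e0 eJ]]]; exists (d * e); first by rewrite mulf_neq0.
split=> x hx; last by rewrite -mulrA; apply: ringIntM => //; exact: eJ.
by rewrite mulrAC mulrC; apply: ringIntM => //; exact: dI.
Qed.

Lemma lat_dsum u v J I : is_fracideal J -> is_fracideal I -> lat u v (dsum J u I v).
Proof.
move=> fJ fI; have [sJ [x Jx x0] _] := fJ; have [sI [y Iy y0] _] := fI.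
have sM := dsum_submod u v sJ sI; split=> //.
  have [d d0 [dJ dI]] := frac_common fJ fI.
  exists d => // _ [a [b [/dJ Oa /dI Ob ->]]]; exists (d * a), (d * b).
  by rewrite scalerDr !scalerA.
have [p p0 Jp] := ideal_nat sJ Jx x0; have [q q0 Iq] := ideal_nat sI Iy y0.
have [J0 _ JM] := sJ; have [I0 _ IM] := sI.
have pq0 : (p * q)%:R != 0 :> K.
  by rewrite pmulrn intr_eq0K eqz_nat -lt0n muln_gt0 p0.
exists (p * q)%:R => //; split.
  exists (p * q)%:R, 0; rewrite scale0r addr0; split=> //.
  by rewrite natrM mulrC; apply: JM => //; exact: integral_nat.
exists 0, (p * q)%:R; rewrite scale0r add0r; split=> //.
by rewrite natrM; apply: IM => //; exact: integral_nat.
Qed.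

(* The splitting of X -> I: lift the elements of a relation 1 = sum a_k b_k
   with a_k in I and b_k in I^-1. *)
Lemma dsum_split l v X : indep l v -> submod X ->
  (forall z, X z -> exists x y, z = x *: l + y *: v) ->
  is_fracideal [set y | exists x, X (x *: l + y *: v)] ->
  exists a, X = dsum [set x | X (x *: l)] l [set y | exists x, X (x *: l + y *: v)] (a *: l + v).
Proof.
move=> lv sX Xlv; set I := [set y | _] => fI; have [_ XD XM] := sX.
have : idmul I (idinv I) 1 by rewrite idmul_idinv //; exact: ringInt1.
move=> [n [a [b [Ia Vb E]]]]; have /choice[c cP] := Ia.
exists (\sum_i b i * c i).
have wI y : I y -> X (y *: ((\sum_i b i * c i) *: l + v)).
  move=> Iy; have -> : y *: ((\sum_i b i * c i) *: l + v) =
     \sum_i (y * b i) *: (c i *: l + a i *: v).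
    rewrite (eq_bigr (fun i => (y * (b i * c i)) *: l + (y * (a i * b i)) *: v)); last first.
      by move=> i _; rewrite scalerDr !scalerA -!mulrA [a i * b i]mulrC.
    by rewrite big_split -!scaler_suml /= -!mulr_sumr -E mulr1 scalerDr scalerA.
  by apply: submod_sum => // i _; apply: XM => //; rewrite mulrC; exact: Vb.
apply/seteqP; split=> [z Xz|z [x [y [Xx Iy ->]]]]; last by apply: XD => //; exact: wI.
have [x [y zE]] := Xlv _ Xz.
have Iy : I y by exists x; rewrite -zE.
exists (x - y * (\sum_i b i * c i)), y; split=> //; last first.
  by rewrite zE scalerDr scalerA addrA -scalerDl subrK.
have := submodB sX Xz (wI _ Iy); rewrite zE scalerDr scalerA opprD addrACA subrr addr0.
by rewrite -scalerBl.
Qed.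

Lemma lat_first_frac u v M a b : indep u v -> lat u v M -> (a != 0) || (b != 0) ->
  is_fracideal [set x | M (x *: (a *: u + b *: v))].
Proof.
move=> uv [sM [d d0 dM] [e e0 [eu ev]]] ab; have [M0 MD MM] := sM.
have [p p0 Op] := denom_exists (a / e); have [q q0 Oq] := denom_exists (b / e).
have {ab} [c c0 cE] : exists2 c, c != 0 & forall x, M (x *: (a *: u + b *: v)) -> ringInt (c * x).
  have h x : M (x *: (a *: u + b *: v)) -> ringInt (d * a * x) /\ ringInt (d * b * x).
    move=> /dM[y [z [Oy Oz E]]].
    have [|-> ->//] := @indep_inj u v (d * a * x) (d * b * x) y z uv.
    by rewrite -E !scalerDr !scalerA; congr (_ *: _ + _ *: _); ring.
  by case/orP: ab => n0; [exists (d * a)|exists (d * b)]; rewrite ?mulf_neq0 // => x /h[].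
apply: (@fracideal_bound _ _ (p%:~R * q%:~R) c) => //.
- split=> [|x y|r x Or]; rewrite /= ?scale0r // ?scalerDl -?[(r * x) *: _]scalerA;
  first exact: MD.
  exact: MM.
- rewrite /= scalerDr !scalerA; apply: MD.
    have -> : p%:~R * q%:~R * a = q%:~R * (p%:~R * (a / e)) * e by rewrite !mulrA mulfVK //; ring.
    by rewrite -scalerA; apply: (MM) => //; apply: ringIntM => //; exact: ringInt_int.
  have -> : p%:~R * q%:~R * b = p%:~R * (q%:~R * (b / e)) * e by rewrite !mulrA mulfVK //; ring.
  by rewrite -scalerA; apply: (MM) => //; apply: ringIntM => //; exact: ringInt_int.
- by rewrite mulf_neq0 ?intr_eq0K.
Qed.

Lemma lat_second_frac u v M a b : indep u v -> lat u v M -> a != 0 ->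
  is_fracideal [set y | exists x, M (x *: (a *: u + b *: v) + y *: v)].
Proof.
move=> uv [sM [d d0 dM] [e e0 [eu ev]]] a0; have [M0 MD MM] := sM.
have [p p0 Op] := denom_exists a; have [q q0 Oq] := denom_exists b.
have pK0 : (p%:~R : K) != 0 by rewrite intr_eq0K.
have qK0 : (q%:~R : K) != 0 by rewrite intr_eq0K.
apply: (@fracideal_bound _ _ e (p%:~R * q%:~R * d * a)) => //; last 1 first.
- move=> y [x /dM[s [t [Os Ot]]]]; rewrite scalerDr !scalerA.
  rewrite scalerDr !scalerA -addrA -scalerDl => /(indep_inj uv)[E1 E2].
  have -> : p%:~R * q%:~R * d * a * y = q%:~R * (p%:~R * a) * t - p%:~R * (q%:~R * b) * s.
    by rewrite -E1 -E2; ring.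
  by apply: ringIntB; apply: ringIntM => //; apply: ringIntM => //; exact: ringInt_int.
- exact: dsum_snd_submod.
- by exists 0; rewrite scale0r add0r.
- by rewrite !mulf_neq0.
Qed.

(** The Steinitz form with a prescribed first vector l: the projection of M along l is a fractional
    ideal, hence projective, so M splits over it. The freedom in l is what the elementary divisor
    theorem uses. *)
Lemma lat_steinitz u v M a b : indep u v -> lat u v M -> (a != 0) || (b != 0) ->
  let l := a *: u + b *: v in
  exists c d J I, [/\ a * d - b * c != 0, is_fracideal J, is_fracideal I,
    J = [set x | M (x *: l)] & M = dsum J l I (c *: u + d *: v)].
Proof.
move=> uv lM ab l; have fJ := lat_first_frac uv lM ab.
(* It suffices to treat a nonzero first coordinate of l; in the other case u and v exchange
   roles. *)
have main u' v' a' b' : indep u' v' -> lat u' v' M -> a' != 0 -> l = a' *: u' + b' *: v' ->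
    exists c, exists2 I, is_fracideal I & M = dsum [set x | M (x *: l)] l I (c *: l + v').
  move=> uv' lM' a0 lE.
  have lv : indep l v'.
    rewrite lE -[v' in indep _ v']scale1r -[1 *: v']add0r -(scale0r u').
    by apply: indep_change => //; rewrite mulr0 subr0 mulr1.
  have fI := lat_second_frac b' uv' lM' a0; rewrite -lE in fI.
  have Ml z : M z -> exists x y, z = x *: l + y *: v'.
    move=> /(lat_span lM')[x [y ->]]; exists (x / a'), (y - x / a' * b').
    by rewrite lE scalerDr !scalerA mulfVK // -addrA -scalerDl; congr (_ + _ *: _); ring.
  have [c cE] := dsum_split lv (lat_submod lM') Ml fI.
  by exists c; exists [set y | exists x, M (x *: l + y *: v')].
case/orP: (ab) => n0.
  have [c [I fI ME]] := main u v a b uv lM n0 erefl.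
  exists (c * a), (c * b + 1), [set x | M (x *: l)], I; split=> //.
    by have -> : a * (c * b + 1) - b * (c * a) = a by ring.
  by rewrite {1}ME /l scalerDr !scalerA -addrA scalerDl scale1r.
have [|c [I fI ME]] := main v u b a (indep_sym uv) (lat_sym lM) n0; first by rewrite addrC.
exists (c * a + 1), (c * b), [set x | M (x *: l)], I; split=> //.
  by rewrite (_ : _ - _ = - b) ?oppr_eq0 //; ring.
by rewrite {1}ME /l scalerDr !scalerA addrAC scalerDl scale1r.
Qed.

End PlaneLattices.

(** * Elementary divisors of a pair of lattices *)

Section Stacked.
Variables (K : fieldExtType rat) (U : lmodType K).
Implicit Types (I J g h A B : set K) (L M X : set U) (u v l w : U).
Local Notation O := (ringInt : set K).

Lemma dsum_det u v (x y a b c d : K) J I : indep u v ->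
  dsum J (a *: u + b *: v) I (c *: u + d *: v) (x *: u + y *: v) ->
  exists s t, [/\ J s, I t, x = s * a + t * c & y = s * b + t * d].
Proof.
by move=> uv [s [t [Js It]]]; rewrite comb_comb => /(indep_inj uv)[-> ->]; exists s, t.
Qed.

(** The exterior square of M inside the line K (u ∧ v), identified with K; the factor O turns the
    set of determinants into the O-module they generate. *)
Definition vol u v M : set K :=
  idmul O [set t | exists a b c d, [/\ M (a *: u + b *: v), M (c *: u + d *: v) &
    t = a * d - b * c]].

Lemma vol_dsum u v a b c d J I : indep u v -> is_submodK J -> is_submodK I ->
  vol u v (dsum J (a *: u + b *: v) I (c *: u + d *: v)) = idmul (principal (a * d - b * c))
    (idmul J I).
Proof.
move=> uv sJ sI; rewrite idmul_principal; last exact: idmul_submod.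
have sO := @submod_ringInt K; have sJI := idmul_submod I sJ.
have [JI0 JID JIM] := sJI; have [J0 JD JM] := sJ; have [I0 ID IM] := sI.
apply/seteqP; split.
  apply: idmul_sub.
    split; first by exists 0; rewrite ?mulr0.
      by move=> _ _ [s s1 <-] [t t1 <-]; exists (s + t); rewrite ?mulrDr //; exact: JID.
    by move=> r _ Or [s s1 <-]; exists (r * s); rewrite 1?mulrCA //; exact: JIM.
  move=> r ? Or [p [q [p' [q' []]]]].
  move=> /(dsum_det uv)[s [t [Js It -> ->]]] /(dsum_det uv)[s' [t' [Js' It' -> ->]]] ->.
  exists (r * (s * t' - s' * t)); last by ring.
  by apply: JIM => //; apply: (@submodB _ K^o) => //; exact: mem_idmul.
move=> _ [_ [k [x [y [Jx Iy ->]]]] <-]; rewrite mulr_sumr.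
apply: (@submod_sum _ K^o) => [|i _]; first exact: idmul_submod.
rewrite -[_ * _]mul1r; apply: mem_idmul; first exact: ringInt1.
exists (x i * a), (x i * b), (y i * c), (y i * d); rewrite -!scalerA -!scalerDr; split;
  last by ring.
  by exists (x i), 0; rewrite scale0r addr0.
by exists 0, (y i); rewrite scale0r add0r.
Qed.

Lemma lat_absorb u v L M : lat u v L -> lat u v M ->
  exists e, [/\ ringInt e, e != 0 & forall z, M z -> L (e *: z)].
Proof.
move=> [[L0 LD LM] _ [e e0 [eu ev]]] [_ [d d0 dM] _].
have [p p0 Op] := denom_exists (e * d).
exists (p%:~R * (e * d)); split=> //; first by rewrite !mulf_neq0 ?intr_eq0K.
move=> z /dM[x [y [Ox Oy E]]].
have -> : (p%:~R * (e * d)) *: z = (p%:~R * x) *: (e *: u) + (p%:~R * y) *: (e *: v).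
  by rewrite mulrA -scalerA E !scalerDr !scalerA; congr (_ *: _ + _ *: _); ring.
by apply: LD; apply: LM => //; apply: ringIntM => //; exact: ringInt_int.
Qed.

Lemma coords_exist u v : indep u v ->
  exists c1 c2 : U -> K, forall x y, c1 (x *: u + y *: v) = x /\ c2 (x *: u + y *: v) = y.
Proof.
move=> uv; have /choice[c cP] z : exists p : K * K, forall x y, z = x *: u + y *: v -> p = (x, y).
  case: (pselect (exists p : K * K, z = p.1 *: u + p.2 *: v)) => [[p pE]|np].
    exists p => x y; rewrite pE => /(indep_inj uv)[<- <-].
    by rewrite -surjective_pairing.
  by exists 0 => x y E; case: np; exists (x, y).
by exists (fun z => (c z).1), (fun z => (c z).2) => x y; rewrite (cP _ _ _ erefl).
Qed.

Lemma idmul_sumset g A B : is_submodK g ->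
  idmul g (sumset A B) `<=` sumset (idmul g A) (idmul g B).
Proof.
move=> sg; apply: idmul_sub; first by apply: (@sumset_submod _ K^o); exact: idmul_submod.
by move=> x _ gx [a [b [Aa Bb ->]]]; exists (x * a), (x * b); rewrite mulrDr; split=> //;
  exact: mem_idmul.
Qed.

(** Bases adapted to L in M, as in the elementary divisor theorem over a Dedekind domain, with ideal
    coefficients J and I for the summands that need not be free. *)
Definition stacked u v L M g h : Prop := exists a b c d J I,
  [/\ a * d - b * c != 0, is_fracideal J, is_fracideal I,
      M = dsum J (a *: u + b *: v) I (c *: u + d *: v)
    & L = dsum (idmul g J) (a *: u + b *: v) (idmul h I) (c *: u + d *: v)].

(* g is the content of L in M; by approximation some vector l of L has
   content g up to e, and then l splits off simultaneously in L and M. *)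
Lemma stacked_dsum u v L J0 I0 : indep u v -> is_fracideal J0 -> is_fracideal I0 ->
  let M := dsum J0 u I0 v in
  lat u v L -> L `<=` M ->
  exists g h, [/\ is_intideal g, is_intideal h, h `<=` g & stacked u v L M g h].
Proof.
move=> uv fJ fI M lL LM.
have lM : lat u v M by exact: lat_dsum.
have [e [Oe e0 eM]] := lat_absorb lL lM.
have [sL _ _] := lL; have [L0 LD LZ] := sL.
have [sJ sI] := (fracideal_submod fJ, fracideal_submod fI).
have [J00 _ _] := sJ; have [I00 _ _] := sI.
have [fVJ fVI] := (fracideal_inv fJ, fracideal_inv fI).
have [sVJ sVI] := (fracideal_submod fVJ, fracideal_submod fVI).
pose A : set K := [set x | exists y, L (x *: u + y *: v)].
pose B : set K := [set y | exists x, L (x *: u + y *: v)].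
have AJ : A `<=` J0.
  by move=> x [y /LM[x' [y' [Jx' _]]]] /(indep_inj uv)[->].
have BI : B `<=` I0.
  by move=> y [x /LM[x' [y' [_ Iy']]]] /(indep_inj uv)[_ ->].
have eA x : J0 x -> A (e * x).
  move=> Jx; exists 0; rewrite scale0r addr0 -scalerA; apply: eM.
  by exists x, 0; rewrite scale0r addr0.
have eB y : I0 y -> B (e * y).
  move=> Iy; exists 0; rewrite scale0r add0r -scalerA; apply: eM.
  by exists 0, y; rewrite scale0r add0r.
have fA : is_fracideal A.
  have [_ [x Jx x0] _] := fJ; apply: (@fracideal_sub _ A J0 (e * x)) => //; last 2 first.
  - exact: eA.
  - by rewrite mulf_neq0.
  exact: dsum_fst_submod.
have fB : is_fracideal B.
  have [_ [x Jx x0] _] := fI; apply: (@fracideal_sub _ B I0 (e * x)) => //; last 2 first.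
  - exact: eB.
  - by rewrite mulf_neq0.
  exact: dsum_snd_submod.
have [sA sB] := (fracideal_submod fA, fracideal_submod fB).
(* A and B are the coordinate projections of L, so g = A J0^-1 + B I0^-1 is the smallest ideal with
   L in gM. *)
pose X1 := idmul (idinv J0) A; pose X2 := idmul (idinv I0) B.
have [sX1 sX2] : is_submodK X1 /\ is_submodK X2 by split; exact: idmul_submod.
pose g := sumset X1 X2.
have fg : is_fracideal g by apply: sumset_frac; exact: fracidealM.
have sg := fracideal_submod fg; have fVg := fracideal_inv fg; have sVg := fracideal_submod fVg.
have X1g : X1 `<=` g by exact: (@sumsetl _ K^o).
have X2g : X2 `<=` g by exact: (@sumsetr _ K^o).
have gO : g `<=` O.
  apply: (@sumset_sub _ K^o); first exact: submod_ringInt.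
    by rewrite -(idmul_idinv fJ) idmulC; exact: idmulS.
  by rewrite -(idmul_idinv fI) idmulC; exact: idmulS.
have ig : is_intideal g by exact: intideal_of_frac.
have ge : g e.
  apply: X1g; have : idmul (idinv J0) J0 1 by rewrite idmulC idmul_idinv //; exact: ringInt1.
  move=> [k [x [y [Vx Jy E]]]]; rewrite -[e]mulr1 E mulr_sumr.
  apply: (@submod_sum _ K^o) => // i _; rewrite mulrCA; apply: mem_idmul => //; exact: eA.
have AgJ : A `<=` idmul g J0.
  by rewrite -(idmulK fVJ sA) idinvK // idmulC; exact: idmulS.
have BgI : B `<=` idmul g I0.
  by rewrite -(idmulK fVI sB) idinvK // idmulC; exact: idmulS.
(* The coordinates multiplied by elements of Y1 and Y2 are O-valued on gM, hence on L; by the choice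
   of g their values on L generate O, and [approximation] applies to them. *)
pose Y1 := idmul (idinv g) (idinv J0); pose Y2 := idmul (idinv g) (idinv I0).
have [sY1 sY2] : is_submodK Y1 /\ is_submodK Y2 by split; exact: idmul_submod.
have Y1A : idmul Y1 A `<=` O by rewrite idmulA // -(idmul_idinv fg) [idmul g _]idmulC;
  exact: idmulS.
have Y2B : idmul Y2 B `<=` O by rewrite idmulA // -(idmul_idinv fg) [idmul g _]idmulC;
  exact: idmulS.
have : idmul (idinv g) g 1 by rewrite idmulC idmul_idinv //; exact: ringInt1.
move=> /(idmul_sumset sVg)[s [t []]].
rewrite -!idmulA // => -[n1 [k1 [a1 [Yk1 Aa1 ->]]]] [n2 [k2 [b2 [Yk2 Bb2 ->]]]] E1.
have [c1 [c2 cE]] := coords_exist uv.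
have [/choice[y1 y1P] /choice[x2 x2P]] := (Aa1, Bb2).
have Lc z : L z -> A (c1 z) /\ B (c2 z).
  move=> Lz; have [x [y zE]] := lat_span lL Lz.
  by rewrite zE; have [-> ->] := cE x y; split; [exists y|exists x]; rewrite -zE.
pose phi (i : 'I_(n1 + n2)) z := match fintype.split i with inl i1 => k1 i1 * c1 z | inr i2 =>
  k2 i2 * c2 z end.
pose xs (i : 'I_(n1 + n2)) := match fintype.split i with
  inl i1 => a1 i1 *: u + y1 i1 *: v | inr i2 => x2 i2 *: u + b2 i2 *: v end.
have mE := idmul_principal e sVg.
(* For this modulus g m M = e M lies in L, which absorbs the error term of the approximation in
   [gJL]. *)
pose m := idmul (principal e) (idinv g).
have sm : is_submodK m by apply: idmul_submod; exact: fracideal_submod (principal_frac e0).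
have me : m e.
  rewrite /m mE; exists 1; last by rewrite mulr1.
  by apply: int_sub_inv => //; exact: ringInt1.
have phiO i z : L z -> ringInt (phi i z).
  move=> /Lc[Az Bz]; rewrite /phi; case: (fintype.split i) => j.
    exact: Y1A (mem_idmul (Yk1 j) Az).
  exact: Y2B (mem_idmul (Yk2 j) Bz).
have phiL i r x y : ringInt r -> L x -> L y -> phi i (r *: x + y) = r * phi i x + phi i y.
  move=> _ /(lat_span lL)[x1 [x1' ->]] /(lat_span lL)[z1 [z1' ->]].
  have -> : r *: (x1 *: u + x1' *: v) + (z1 *: u + z1' *: v) = (r * x1 + z1) *: u + (r * x1' +
    z1') *: v.
    by rewrite scalerDr !scalerA addrACA -!scalerDl.
  rewrite /phi; have := (cE (r * x1 + z1) (r * x1' + z1'), cE x1 x1', cE z1 z1').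
  by move=> [[[-> ->] [-> ->]] [-> ->]]; case: (fintype.split i) => j; ring.
have Lxs i : L (xs i) by rewrite /xs; case: (fintype.split i) => j.
have sum1 : \sum_i phi i (xs i) = 1.
  rewrite E1 big_split_ord /=; congr (_ + _); apply: eq_bigr => i _; rewrite /phi /xs.
    by rewrite (unsplitK (inl i)); have [-> _] := cE (a1 i) (y1 i).
  by rewrite (unsplitK (inr i)); have [_ ->] := cE (x2 i) (b2 i).
have [z [Lz [r [mu [Or mmu {}E1]]]]] := approximation sL sm me e0 phiO phiL Lxs sum1.
have [al [be zE]] := lat_span lL Lz.
have [ka [kb [Yka Ykb {}E1]]] : exists ka kb, [/\ Y1 ka, Y2 kb & 1 = ka * al + kb * be + mu].
  exists (\sum_(i < n1) r (lshift n2 i) * k1 i), (\sum_(i < n2) r (rshift n1 i) * k2 i); split.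
  - by apply: (@submod_sum _ K^o) => // i _; case: sY1 => _ _ hM; apply: hM;
    [exact: Or|exact: Yk1].
  - by apply: (@submod_sum _ K^o) => // i _; case: sY2 => _ _ hM; apply: hM;
    [exact: Or|exact: Yk2].
  rewrite E1 big_split_ord /=; congr (_ + _ + _); rewrite mulr_suml; apply: eq_bigr => i _;
    rewrite /phi.
    by rewrite (unsplitK (inl i)) zE; have [-> _] := cE al be; rewrite mulrA.
  by rewrite (unsplitK (inr i)) zE; have [_ ->] := cE al be; rewrite mulrA.
move: mmu; rewrite /m mE => -[nu Vnu muE].
(* If the vector z found is 0, then 1 lies in e g^-1. So g = eO, and L, lying between eM and gM, is
   gM. *)
case: (boolP ((al != 0) || (be != 0))) => ab; last first.
  move: ab; rewrite negb_or !negbK => /andP[/eqP al0 /eqP be0].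
  move: E1; rewrite al0 be0 !mulr0 !add0r -muE => E1.
  have gp : g `<=` principal e.
    by move=> x gx; exists (nu * x); [exact: Vnu|rewrite mulrA -E1 mul1r].
  have pg : principal e `<=` g by move=> _ [x Ox <-]; rewrite mulrC; case: sg => _ _; apply.
  have gE : g = principal e by apply/seteqP.
  exists g, g; split=> //; exists 1, 0, 0, 1, J0, I0.
  rewrite !scale1r !scale0r addr0 add0r mulr1 mulr0 subr0 oner_neq0; split=> //.
  apply/seteqP; split=> [z' Lz'|].
    have [x [y zE']] := lat_span lL Lz'; exists x, y; split=> //.
      by apply: AgJ; exists y; rewrite -zE'.
    by apply: BgI; exists x; rewrite -zE'.
  move=> _ [x [y [+ + ->]]]; rewrite gE !idmul_principal // => -[x' Jx' <-] [y' Iy' <-].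
  by rewrite -!scalerA -scalerDr; apply: eM; exists x', y'.
have [c [d [J [I [D fJ1 fI1 JE ME]]]]] := lat_steinitz uv lM ab.
set l := al *: u + be *: v in JE ME; set w := c *: u + d *: v in ME.
have [sJ1 sI1] := (fracideal_submod fJ1, fracideal_submod fI1).
have [fVI1 lw] := (fracideal_inv fI1, indep_change uv D).
(* Expand by 1 = ka al + kb be + mu: for y in g and x' in J, the first two terms of y x' l are
   integral multiples of l, which is in L, and the last is an integral multiple of an element of
   eM. *)
have gJL x : idmul g J x -> L (x *: l).
  apply: (@idmul_sub _ g J [set x | L (x *: l)]) => [|y x' gy Jx'].
    split=> [|p q Lp Lq|p q Op Lq] /=; first by rewrite scale0r.
      by rewrite scalerDl; exact: LD.
    by rewrite -scalerA; exact: LZ.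
  have [Jal Ibe] : J0 (x' * al) /\ I0 (x' * be).
    move: Jx'; rewrite JE /= /l scalerDr !scalerA => -[p [q [Jp Iq]]].
    by move/(indep_inj uv) => [-> ->].
  have yk : ringInt (y * x' * (ka * al)).
    have h1 : idinv J0 (y * ka) by rewrite -(idmulK fVg sVJ) idinvK //; exact: mem_idmul.
    by have := h1 _ Jal; congr ringInt; ring.
  have yk' : ringInt (y * x' * (kb * be)).
    have h1 : idinv I0 (y * kb) by rewrite -(idmulK fVg sVI) idinvK //; exact: mem_idmul.
    by have := h1 _ Ibe; congr ringInt; ring.
  have Ll : L l by rewrite /l -zE.
  have -> : y * x' = (y * x' * (ka * al) + y * x' * (kb * be)) + (nu * y) * e * x'.
    by rewrite -[LHS]mulr1 E1 -muE; ring.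
  rewrite /= scalerDl; apply: (LD); first by apply: (LZ) => //; exact: ringIntD.
  rewrite -[_ *: l]scalerA -[_ *: (x' *: l)]scalerA; apply: (LZ); first exact: Vnu.
  by apply: eM; move: Jx'; rewrite JE.
have LgM : L `<=` dsum (idmul g J) l (idmul g I) w.
  rewrite -sprod_dsum // -ME sprod_dsum // => z' Lz'.
  have [x [y zE']] := lat_span lL Lz'; exists x, y; split=> //.
    by apply: AgJ; exists y; rewrite -zE'.
  by apply: BgI; exists x; rewrite -zE'.
pose B' : set K := [set y | exists x, L (x *: l + y *: w)].
have B'gI : B' `<=` idmul g I.
  by move=> y [x /LgM[p [q [_ Iq]]]] /(indep_inj lw)[_ ->].
have fgI : is_fracideal (idmul g I) by exact: fracidealM.
have fB' : is_fracideal B'.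
  have [_ [x Jx x0] _] := fI1; apply: (@fracideal_sub _ B' (idmul g I) (e * x)) => //;
    last 2 first.
  - exists 0; rewrite scale0r add0r -scalerA; apply: eM; rewrite ME.
    by exists 0, x; rewrite scale0r add0r; split=> //; case: sJ1.
  - by rewrite mulf_neq0.
  exact: dsum_snd_submod.
have sB' := fracideal_submod fB'.
pose h := idmul (idinv I) B'.
have hI : idmul h I = B' by rewrite /h idmulC -[RHS](idmulK fVI1) // idinvK.
have hg : h `<=` g by rewrite -(idmulK fI1 sg) [idmul I g]idmulC; exact: idmulS.
exists g, h; split=> //.
  by apply: intideal_of_frac; [exact: fracidealM|exact: subset_trans hg gO].
exists al, be, c, d, J, I; split=> //; rewrite hI -/l -/w.
apply/seteqP; split=> [z' Lz'|].
  have [x [y [gx _ zE']]] := LgM _ Lz'; exists x, y; split=> //.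
  by exists x; rewrite -zE'.
move=> _ [x [y [gx [x' Lxy] ->]]].
have [p [q [gp _ /(indep_inj lw)[x'E _]]]] := LgM _ Lxy.
have -> : x *: l + y *: w = (x - x') *: l + (x' *: l + y *: w).
  by rewrite addrA -scalerDl subrK.
apply: LD => //; apply: gJL; rewrite x'E; apply: (@submodB _ K^o) => //; exact: idmul_submod.
Qed.

Lemma stacked_exists u v L M : indep u v -> lat u v L -> lat u v M -> L `<=` M ->
  exists g h, [/\ is_intideal g, is_intideal h, h `<=` g & stacked u v L M g h].
Proof.
move=> uv lL lM LM.
have [|c [d [J [I [D fJ fI _]]]]] := @lat_steinitz _ _ u v M 1 0 uv lM;
  first by rewrite oner_neq0.
set l := _ + _; set w := _ + _ => ME.
have lw : indep l w by exact: indep_change.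
have lLw : lat l w L.
  have l1 : lat l w (dsum J l I w) by exact: lat_dsum.
  have [e [Oe e0 eM]] := lat_absorb lL lM.
  rewrite -ME in l1; have [_ [d1 d10 h1] [e1 e10 [eu ev]]] := l1.
  split; first exact: lat_submod lL.
    by exists d1 => // z /LM /h1.
  by exists (e * e1); rewrite ?mulf_neq0 // -!scalerA; split; exact: eM.
have [|g [h [ig ih hg [a [b [c' [d' [J' [I' [D' fJ' fI' ME' LE]]]]]]]]]] :=
  @stacked_dsum l w L J I lw fJ fI lLw; first by rewrite -ME.
exists g, h; split=> //.
exists (a * 1 + b * c), (a * 0 + b * d), (c' * 1 + d' * c), (c' * 0 + d' * d), J', I'.
rewrite -!comb_comb -/l -/w; split=> //; last by rewrite ME.
have -> : (a * 1 + b * c) * (c' * 0 + d' * d) - (a * 0 + b * d) * (c' * 1 + d' * c) = (a * d' -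
  b * c') * (1 * d - 0 * c) by ring.
by rewrite mulf_neq0.
Qed.

End Stacked.

(** * Isomorphisms of quotient modules *)

Section QuotientMaps.
Variable K : fieldExtType rat.
Implicit Types (U V W : lmodType K).

Definition qiso U V (B A : set U) (D C : set V) : Prop :=
  quot_iso (fun (r : K) (x : U) => r *: x) (fun (r : K) (z : V) => r *: z) B A D C.

(** The same isomorphisms as in [quot_iso], with linearity in one clause and the kernel condition
    stated for differences; in this form they can be composed and inverted directly. *)
Definition qmap U V (f : U -> V) (B A : set U) (D C : set V) : Prop :=
  [/\ forall x, B x -> D (f x),
      forall r x y, ringInt r -> B x -> B y -> C (f (r *: x + y) - (r *: f x + f y)),
      forall x y, B x -> B y -> (C (f x - f y) <-> A (x - y))
    & forall z, D z -> exists2 x, B x & C (z - f x)].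

Lemma submod_tr U (C : set U) x y z : submod C -> C (x - y) -> C (y - z) -> C (x - z).
Proof. by move=> [_ CD _] h1 h2; rewrite -(subrKA y); exact: CD. Qed.

Lemma submod_sw U (C : set U) x y : submod C -> C (x - y) -> C (y - x).
Proof. by move=> sC h; rewrite -opprB; exact: submodN. Qed.

Lemma qisoP U V (B A : set U) (D C : set V) : submod B -> submod A -> submod C ->
  qiso B A D C <-> exists f, qmap f B A D C.
Proof.
move=> sB sA sC; have [B0 BD BM] := sB; have [A0 _ _] := sA; have [C0 CD CM] := sC.
split=> -[f [fD fL fK fS]]; exists f.
  have lin r x y : ringInt r -> B x -> B y -> C (f (r *: x + y) - (r *: f x + f y)).
    move=> Or Bx By; apply: (submod_tr sC (fL _ _ (BM _ _ Or Bx) By)).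
    by rewrite opprD addrACA subrr addr0; exact: fK.
  split=> // x y Bx By.
  have h : C (f (x - y) - (f x - f y)).
    have := lin (-1) y x (ringIntN (@ringInt1 K)) By Bx.
    by rewrite !scaleN1r ![- _ + _]addrC.
  rewrite -(fS (x - y) (submodB sB Bx By)); split=> hC.
    by rewrite -[f (x - y)](subrK (f x - f y)); exact: CD.
  by rewrite -[f x - f y](subrK (f (x - y))); apply: CD => //; exact: submod_sw.
have h0 : C (f 0).
  have := fL 1 0 0 (@ringInt1 K) B0 B0; rewrite !scale1r addr0 opprD addNKr.
  by move=> /(submodN sC); rewrite opprK.
split=> //.
- by move=> x y Bx By; have := fL 1 x y (@ringInt1 K) Bx By; rewrite !scale1r.
- move=> r x Or Bx; have := fL r x 0 Or Bx B0; rewrite addr0 opprD addrA => h.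
  by rewrite -(subrK (f 0) (_ - _)); exact: CD.
- move=> x Bx; rewrite -[x in A x]subr0 -(fK _ _ Bx B0); split=> h; first exact: submodB.
  by rewrite -(subrK (f 0) (f x)); exact: CD.
Qed.

Lemma qmap0 U V (f : U -> V) (B A : set U) (D C : set V) : submod B -> qmap f B A D C -> C (f 0).
Proof.
move=> [B0 _ _] [_ fL _ _]; have := fL (-1) 0 0 (ringIntN (@ringInt1 K)) B0 B0.
by rewrite scaler0 addr0 scaleN1r addNr subr0.
Qed.

Lemma qmapB U V (f : U -> V) (B A : set U) (D C : set V) x y : submod B -> qmap f B A D C ->
  B x -> B y -> C (f (x - y) - (f x - f y)).
Proof.
move=> sB [_ fL _ _] Bx By; have := fL (-1) y x (ringIntN (@ringInt1 K)) By Bx.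
by rewrite !scaleN1r ![- _ + _]addrC.
Qed.

Lemma qmap_sym U V f (B A : set U) (D C : set V) : submod B -> submod A -> submod C -> submod D ->
  qmap f B A D C -> exists g, qmap g D C B A.
Proof.
move=> sB sA sC sD [fD fL fK fS]; have [D0 DD DM] := sD; have [B0 BD BM] := sB;
  have [C0 CD CM] := sC.
have /choice[g gP] z : exists x, D z -> B x /\ C (z - f x).
  case: (pselect (D z)) => [/fS[x Bx Cx]|nD]; first by exists x.
  by exists 0.
have gB z : D z -> B (g z) by move=> /gP[].
have gC z : D z -> C (z - f (g z)) by move=> /gP[].
exists g; split=> // [r x y Or Dx Dy|x y Dx Dy|x Bx].
- have Dxy : D (r *: x + y) by apply: DD => //; exact: DM.
  have Bxy : B (r *: g x + g y) by apply: BD; [apply: BM => //|]; exact: gB.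
  apply/(fK _ _ (gB _ Dxy) Bxy).
  apply: (submod_tr sC (submod_sw sC (gC _ Dxy))).
  apply: submod_sw => //; apply: (submod_tr sC (fL _ _ _ Or (gB _ Dx) (gB _ Dy))).
  apply: submod_sw => //; rewrite opprD addrACA -scalerBr.
  by apply: CD; [apply: CM => //|]; exact: gC.
- rewrite -(fK _ _ (gB _ Dx) (gB _ Dy)); split=> h.
    apply: (submod_tr sC (gC _ Dx)); apply: (submod_tr sC h); apply: submod_sw => //; exact: gC.
  apply: (submod_tr sC (submod_sw sC (gC _ Dx))); apply: (submod_tr sC h); exact: gC.
- exists (f x); first exact: fD.
  by apply/(fK _ _ Bx (gB _ (fD _ Bx))); apply: gC; exact: fD.
Qed.

Lemma qmap_trans U V W f f' (B A : set U) (D C : set V) (F E : set W) :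
  submod B -> submod D -> submod E ->
  qmap f B A D C -> qmap f' D C F E -> qmap (f' \o f) B A F E.
Proof.
move=> [_ BD BM] sD sE [fD fL fK fS] [fD' fL' fK' fS']; have [_ DD DM] := sD.
split=> /= [x Bx|r x y Or Bx By|x y Bx By|z Fz].
- exact/fD'/fD.
- have Dfx := fD _ Bx; have Dfy := fD _ By.
  have Drf : D (r *: f x + f y) by apply: DD => //; exact: DM.
  apply: (submod_tr sE) (fL' _ _ _ Or Dfx Dfy); apply/fK' => //; last exact: fL.
  by apply: fD; apply: BD => //; exact: BM.
- by rewrite -(fK _ _ Bx By); apply: fK'; exact: fD.
- have [y Dy Ey] := fS' _ Fz; have [x Bx Cx] := fS _ Dy; exists x => //.
  apply: (submod_tr sE Ey); apply/fK' => //; exact: fD.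
Qed.

Lemma qiso_sym U V (B A : set U) (D C : set V) : submod B -> submod A -> submod C -> submod D ->
  qiso B A D C -> qiso D C B A.
Proof.
by move=> sB sA sC sD /qisoP[]// f /qmap_sym[]// g hg; apply/qisoP => //; exists g.
Qed.

Lemma qiso_trans U V W (B A : set U) (D C : set V) (F E : set W) :
  submod B -> submod A -> submod D -> submod C -> submod E ->
  qiso B A D C -> qiso D C F E -> qiso B A F E.
Proof.
move=> sB sA sD sC sE /qisoP[]// f hf /qisoP[]// f' hf'; apply/qisoP => //.
by exists (f' \o f); exact: qmap_trans hf hf'.
Qed.

Lemma qmap_linear U V (f : U -> V) (B A : set U) (D C : set V) :
  submod B -> C 0 -> (forall r x y, f (r *: x + y) = r *: f x + f y) ->
  (forall x, B x -> D (f x)) -> (forall x, B x -> C (f x) <-> A x) ->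
  (forall z, D z -> exists2 x, B x & C (z - f x)) -> qmap f B A D C.
Proof.
move=> sB C0 fL fD fK fS; split=> // [r x y _ _ _|x y Bx By]; first by rewrite fL subrr.
have -> : f x - f y = f (x - y) by rewrite addrC -scaleN1r -fL scaleN1r addrC.
by apply: fK; exact: submodB.
Qed.

Lemma qmap_finquot U V f (B A : set U) (D C : set V) : submod B -> submod C -> A `<=` B ->
  qmap f B A D C -> finquot B A -> finquot D C.
Proof.
move=> sB sC AB [fD fL fK fS] /(finquot_in sB AB)[s sB' sP].
exists [seq f x | x <- s] => z Dz; have [x Bx Cx] := fS _ Dz.
have [y ys Axy] := sP _ Bx; exists (f y); first exact: map_f.
by apply: (submod_tr sC Cx); apply/fK => //; exact: sB'.
Qed.

(** * The correspondence of intermediate submodules *)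

Section Intermediate.
Variables (U V : lmodType K) (f : U -> V) (M L : set U) (M' L' : set V).
Hypotheses (sM : submod M) (sL : submod L) (sM' : submod M') (sL' : submod L').
Hypotheses (LM : L `<=` M) (LM' : L' `<=` M') (fq : qmap f M L M' L').

Definition qpull (N : set V) : set U := [set x | M x /\ N (f x)].

Let near x y : M x -> M y -> L (x - y) -> L' (f x - f y).
Proof. by case: fq => _ _ fK _ Mx My; move/fK; apply. Qed.

Lemma qpull_submod N : submod N -> L' `<=` N -> submod (qpull N).
Proof.
move=> [N0 ND NM] LN; have [fD fL fK fS] := fq; have [M0 MD MM] := sM.
have lin r x y : ringInt r -> M x -> M y -> N (f x) -> N (f y) -> N (f (r *: x + y)).
  move=> Or Mx My Nx Ny; rewrite -[f _](subrK (r *: f x + f y)); apply: (ND).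
    exact/LN/fL.
  by apply: ND => //; exact: NM.
have Nf0 : N (f 0) by apply: LN; exact: qmap0 fq.
split=> [|x y [Mx Nx] [My Ny]|r x Or [Mx Nx]]; split=> //.
- exact: MD.
- by rewrite -[x]scale1r; apply: lin => //; exact: ringInt1.
- exact: MM.
- by rewrite -[_ *: x]addr0; exact: lin.
Qed.

Lemma qpull_sub N : L' `<=` N -> L `<=` qpull N.
Proof.
move=> LN x Lx; have Mx := LM Lx; split=> //; apply: LN.
have h0 : L' (f 0) by exact: qmap0 fq.
have [M0 _ _] := sM.
rewrite -(subrK (f 0) (f x)); case: (sL') => _ L'D _; apply: L'D => //.
by apply: near => //; rewrite subr0.
Qed.

Lemma qpull_le N : qpull N `<=` M.
Proof. by move=> x []. Qed.

Lemma qmap_pull_bottom N : submod N -> L' `<=` N -> N `<=` M' -> qmap f (qpull N) L N L'.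
Proof.
move=> [N0 ND NM] LN NM'; have [fD fL fK fS] := fq.
split=> [x []//|r x y Or [Mx _] [My _]|x y [Mx _] [My _]|z Nz].
- exact: fL.
- exact: fK.
- have [x Mx Lx] := fS _ (NM' _ Nz); exists x => //; split=> //.
  rewrite -[f x](subKr z); apply: (@submodB _ V) => //; exact: LN.
Qed.

Lemma qmap_pull_top N : submod N -> L' `<=` N -> N `<=` M' -> qmap f M (qpull N) M' N.
Proof.
move=> sN LN NM'; have [fD fL fK fS] := fq; have [_ MD MM] := sM.
have [_ ND NM] := sN.
split=> // [r x y Or Mx My|x y Mx My|z /fS[x Mx Lx]].
- exact/LN/fL.
- have h : L' (f (x - y) - (f x - f y)) by exact: qmapB fq _ _.
  split=> hN; last first.
    case: hN => _ hN; rewrite -[f x - f y](subrK (f (x - y))); apply: ND => //.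
    by apply: LN; exact: submod_sw.
  split; first exact: submodB.
  by rewrite -[f (x - y)](subrK (f x - f y)); apply: ND => //; exact: LN.
- by exists x => //; exact: LN.
Qed.

Lemma qpull_inj N1 N2 : submod N1 -> submod N2 -> L' `<=` N1 -> L' `<=` N2 ->
  N1 `<=` M' -> N2 `<=` M' -> qpull N1 = qpull N2 -> N1 = N2.
Proof.
have h P1 P2 : submod P1 -> submod P2 -> L' `<=` P1 -> L' `<=` P2 ->
    P1 `<=` M' -> qpull P1 = qpull P2 -> P1 `<=` P2.
  move=> sP1 [_ PD _] L1 L2 P1M E z P1z.
  have [fD fL fK fS] := fq; have [x Mx Lx] := fS _ (P1M _ P1z).
  have [_ P2x] : qpull P2 x.
    rewrite -E; split=> //; rewrite -[f x](subKr z); apply: (@submodB _ V) => //; exact: L1.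
  by rewrite -(subrK (f x) z); apply: PD => //; exact: L2.
by move=> s1 s2 L1 L2 M1 M2 E; apply/seteqP; split; apply: h.
Qed.

Lemma qpull_surj X : submod X -> L `<=` X -> X `<=` M ->
  exists N, [/\ submod N, L' `<=` N, N `<=` M' & qpull N = X].
Proof.
move=> sX LX XM; have [X0 XD XZ] := sX; have [fD fL fK fS] := fq; have [_ MD MM] := sM.
have [L0 LD LZ] := sL'.
exists [set z | exists2 x, X x & L' (z - f x)]; split.
- have lin r z z' : ringInt r -> (exists2 x, X x & L' (z - f x)) ->
  (exists2 x, X x & L' (z' - f x)) ->
      exists2 x, X x & L' (r *: z + z' - f x).
    move=> Or [x Xx Lx] [y Xy Ly]; exists (r *: x + y).
      by apply: XD => //; exact: XZ.
    apply: (submod_tr sL' _ (submod_sw sL' (fL _ _ _ Or (XM _ Xx) (XM _ Xy)))).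
    by rewrite opprD addrACA -scalerBr; apply: LD => //; exact: LZ.
  have z0 : exists2 x, X x & L' (0 - f x).
    by exists 0 => //; rewrite sub0r; apply: submodN => //; exact: qmap0 fq.
  split=> // [z z' hz hz'|r z Or hz].
    by have := lin 1 _ _ (@ringInt1 K) hz hz'; rewrite scale1r.
  by have := lin r _ _ Or hz z0; rewrite addr0.
- by move=> z L'z; exists 0 => //; apply: submodB => //; exact: qmap0 fq.
- move=> z [x /XM /fD M'x /LM' h]; rewrite -(subrK (f x) z).
  by case: sM' => _ M'D _; exact: M'D.
- apply/seteqP; split=> [x [Mx [y Xy]]|x Xx].
    move/(fK _ _ Mx (XM _ Xy)) => /LX Xxy; rewrite -(subrK y x); exact: XD.
  by split; [exact: XM|exists x; rewrite ?subrr].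
Qed.

End Intermediate.

(** An intermediate module is a union of cosets of L, hence determined by the representatives it
    contains. *)
Lemma finquot_intermediate U (M L : set U) : finquot M L -> submod L ->
  finite_set [set X | [/\ submod X, L `<=` X & X `<=` M]].
Proof.
move=> [s sP] sL.
pose F (t : {ffun 'I_(size s) -> bool}) : set U :=
  [set z | M z /\ exists2 i, t i & L (z - s`_i)].
apply: (@sub_finite_set _ _ (F @` setT)); last exact/finite_image/finite_finset.
move=> X [sX LX XM]; exists (finfun (fun i : 'I_(size s) => `[< X s`_i >])) => //.
have [_ XD _] := sX.
apply/seteqP; split=> [z [Mz [i + h]]|z Xz].
  rewrite ffunE => /asboolP Xi; rewrite -(subrK s`_i z); apply: XD => //; exact: LX.
split; first exact: XM.
have [y ys Ly] := sP _ (XM _ Xz).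
exists (Ordinal (etrans (index_mem y s) ys)); rewrite /= ?nth_index //.
rewrite ffunE; apply/asboolP; rewrite /= nth_index // -(subKr z y).
by apply: submodB => //; exact: LX.
Qed.

End QuotientMaps.

(** * Uniqueness of the elementary divisors *)

Section CyclicTypes.
Variable K : fieldExtType rat.
Implicit Types (I J g h a : set K).
Local Notation O := (ringInt : set K).
Local Notation K2 := (K^o * K^o)%type.
Local Notation OO := ((O : set K^o) `*` (O : set K^o) : set K2).
Local Notation "a `x` b" := ((a : set K^o) `*` (b : set K^o) : set K2) (at level 40).

Lemma pair_comb (r x y x' y' : K) : r *: ((x, y) : K2) + (x', y') = (r * x + x', r * y + y').
Proof. by []. Qed.

Lemma setX_submod I J : is_submodK I -> is_submodK J -> @submod K K2 (I `x` J).
Proof.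
move=> [I0 ID IM] [J0 JD JM]; split=> // [[x y] [x' y'] [/= Ix Jy] [/= Ix' Jy']|r [x y] Or [/=
  Ix Jy]].
  by split; [exact: ID|exact: JD].
by split; [exact: IM|exact: JM].
Qed.

Let sO := @submod_ringInt K.

(** Let F be the matrix of f on the unit vectors and G that of preimages of the unit vectors, so FG
    = 1 with the first row read modulo g and the second modulo h. As h lies in g, F is invertible
    modulo g, and an r in a1 kills its first column; so r is in g. An r in a2 also lies in a1 and
    kills the second row of F modulo h, and the lower right entry of FG = 1 puts r in h. *)
Lemma qmap_types_sub f a1 a2 g h : is_intideal a1 -> is_intideal a2 -> is_intideal g ->
  is_intideal h -> h `<=` g -> a2 `<=` a1 ->
  @qmap K K2 K2 f OO (a1 `x` a2) OO (g `x` h) -> a1 `<=` g /\ a2 `<=` h.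
Proof.
move=> i1 i2 ig ih hg a21 hf; have [fD fL fK fS] := hf.
have sOO : @submod K K2 OO by exact: setX_submod.
have [s1 s2] := (intideal_submod i1, intideal_submod i2).
have [sg sh] := (intideal_submod ig, intideal_submod ih).
have [g0 gD gM] := sg; have [h0 hD hM] := sh.
have [O0 O1] := (@ringInt0 K, @ringInt1 K).
have OO10 : OO (1, 0) by split.
have OO01 : OO (0, 1) by split.
have f0 : (g `x` h) (f (0, 0)) by exact: qmap0 sOO hf.
have lin (x y : K) : ringInt x -> ringInt y ->
    g ((f (x, y)).1 - (x * (f (1, 0)).1 + y * (f (0, 1)).1)) /\
    h ((f (x, y)).2 - (x * (f (1, 0)).2 + y * (f (0, 1)).2)).
  move=> Ox Oy.
  have OOy : OO (0, y) by split.
  have := fL x (1, 0) (0, y) Ox OO10 OOy; have := fL y (0, 1) (0, 0) Oy OO01 (conj O0 O0).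
  have -> : y *: ((0, 1) : K2) + (0, 0) = (0, y) by rewrite pair_comb; congr (_, _); ring.
  have -> : x *: ((1, 0) : K2) + (0, y) = (x, y) by rewrite pair_comb; congr (_, _); ring.
  move: f0; case: (f (0, 0)) => z1 z2; case: (f (0, y)) => u1 u2; case: (f (x, y)) => v1 v2.
  case: (f (1, 0)) => w1 w2; case: (f (0, 1)) => t1 t2 [/= gz hz] [/= gu hu] [/= gv hv].
  split.
    have -> : v1 - (x * w1 + y * t1) = (v1 - (x * w1 + u1)) + (u1 - (y * t1 + z1)) + z1 by ring.
    by apply: (gD) => //; apply: (gD).
  have -> : v2 - (x * w2 + y * t2) = (v2 - (x * w2 + u2)) + (u2 - (y * t2 + z2)) + z2 by ring.
  by apply: (hD) => //; apply: (hD).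
have fO z : OO z -> ringInt (f z).1 /\ ringInt (f z).2 by move=> /fD.
have [O11 O21] := fO _ OO10; have [O12 O22] := fO _ OO01.
have [[g11 g21] [/= Og11 Og21] [/= e1 e2]] := fS _ OO10.
have [[g12 g22] [/= Og12 Og22] [/= e3 e4]] := fS _ OO01.
have [l1 l2] := lin _ _ Og11 Og21; have [l3 l4] := lin _ _ Og12 Og22.
have ker (x y : K) : a1 x -> a2 y -> g (f (x, y)).1 /\ h (f (x, y)).2.
  move=> ax ay; have [_ _ a1O] := i1; have [_ _ a2O] := i2.
  have := proj2 (fK (x, y) (0, 0) (conj (a1O _ ax) (a2O _ ay)) (conj O0 O0)).
  rewrite -[(0, 0) in X in X -> _]/(0 : K2) subr0 => /(_ (conj ax ay)).
  move: f0; case: (f (0, 0)) => z1 z2; case: (f (x, y)) => v1 v2 [/= gz hz] [/= gv hv].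
  by rewrite -(subrK z1 v1) -(subrK z2 v2); split; [exact: gD|exact: hD].
move: lin ker l1 l2 l3 l4 e1 e2 e3 e4 O11 O21 O12 O22.
case: (f (1, 0)) => f11 f21; case: (f (0, 1)) => f12 f22.
case: (f (g11, g21)) => p1 p2; case: (f (g12, g22)) => q1 q2 /=.
move=> lin ker l1 l2 l3 l4 e1 e2 e3 e4 O11 O21 O12 O22.
have tr (C : set K) x y z : is_submodK C -> C (x - y) -> C (y - z) -> C (x - z).
  exact: (@submod_tr _ K^o).
have E11 : g (1 - (g11 * f11 + g21 * f12)) := tr _ _ _ _ sg e1 l1.
have E21 : h (0 - (g11 * f21 + g21 * f22)) := tr _ _ _ _ sh e2 l2.
have E12 : g (0 - (g12 * f11 + g22 * f12)) := tr _ _ _ _ sg e3 l3.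
have E22 : h (1 - (g12 * f21 + g22 * f22)) := tr _ _ _ _ sh e4 l4.
have [_ _ a1O] := i1; have [_ _ a2O] := i2.
have imgs (x y : K) : a1 x -> a2 y -> g (x * f11 + y * f12) /\ h (x * f21 + y * f22).
  move=> ax ay; have [gx hx] := ker _ _ ax ay; have [lx hy] := lin _ _ (a1O _ ax) (a2O _ ay).
  split; [rewrite -[_ + _](subKr (f (x, y)).1)|rewrite -[_ + _](subKr (f (x, y)).2)].
    by apply: (@submodB _ K^o _ _ _ sg gx lx).
  by apply: (@submodB _ K^o _ _ _ sh hx hy).
have a10 : a1 0 by case: s1.
have a20 : a2 0 by case: s2.
have sB (C : set K) x y : is_submodK C -> C x -> C y -> C (x - y) by exact: (@submodB _ K^o).
split=> r ar.
  have [gp1] := imgs _ _ ar a20; rewrite !mul0r !addr0 in gp1 *.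
  move=> /hg gp2.
  have Or := a1O _ ar.
  have -> : r = g11 * (r * f11) + r * (1 - (g11 * f11 + g21 * f12))
     + g21 * g12 * f12 * (r * f21) + r * f12 * g21 * (1 - (g12 * f21 + g22 * f22))
     - r * f12 * g22 * (0 - (g11 * f21 + g21 * f22)) - f12 * g22 * g11 * (r * f21) by ring.
  have [Om1 Om2 Om3 Om4] := And4 (ringIntM (ringIntM Og21 Og12) O12) (ringIntM (ringIntM Or O12)
    Og21)
    (ringIntM (ringIntM Or O12) Og22) (ringIntM (ringIntM O12 Og22) Og11).
  apply: (sB) => //; last by apply: gM.
  apply: (sB) => //; last by apply: gM => //; exact: hg.
  apply: (gD); last by apply: gM => //; exact: hg.
  by apply: (gD); [apply: (gD)|]; apply: gM.
have [_ hr1] := imgs _ _ a10 ar; rewrite mul0r add0r in hr1.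
have [_ hr2] := imgs _ _ (a21 _ ar) a20; rewrite mul0r addr0 in hr2.
have Or := a2O _ ar.
have -> : r = r * (1 - (g12 * f21 + g22 * f22)) + g12 * (r * f21) + g22 * (r * f22) by ring.
by do ?apply: (hD); apply: (hM).
Qed.

Lemma types_uniq a1 a2 g h : is_intideal a1 -> is_intideal a2 -> is_intideal g ->
  is_intideal h -> h `<=` g -> a2 `<=` a1 ->
  @qiso K K2 K2 OO (a1 `x` a2) OO (g `x` h) -> a1 = g /\ a2 = h.
Proof.
move=> i1 i2 ig ih hg a21.
have sOO : @submod K K2 OO by exact: setX_submod.
have [s1 s2] := (intideal_submod i1, intideal_submod i2).
have [sg sh] := (intideal_submod ig, intideal_submod ih).
have [sA sC] := (setX_submod s1 s2, setX_submod sg sh).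
move=> /qisoP[]// f hf; have [f' hf'] := qmap_sym sOO sA sC sOO hf.
have [h1 h2] := qmap_types_sub i1 i2 ig ih hg a21 hf.
have [h3 h4] := qmap_types_sub ig ih i1 i2 a21 hg hf'.
by split; apply/seteqP.
Qed.

(* The change of basis (x, y) |-> (x + y, u2 y - u1 x) with u1 + u2 = 1,
   u1 in b2, u2 in b1 carries a1 x a2 = g b1 x g b2 onto g x g b1 b2. *)
Lemma types_normal a1 a2 : is_intideal a1 -> is_intideal a2 ->
  exists g h, [/\ is_intideal g, is_intideal h, h `<=` g, idmul g h = idmul a1 a2
    & @qiso K K2 K2 OO (a1 `x` a2) OO (g `x` h)].
Proof.
move=> i1 i2; have [[s1 _ a1O] [s2 _ a2O]] := (i1, i2).
have [f1 f2] := (intideal_frac i1, intideal_frac i2).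
pose g := sumset a1 a2.
have fg : is_fracideal g by exact: sumset_frac.
have gO : g `<=` O by exact: (@sumset_sub _ K^o).
have ig := intideal_of_frac fg gO.
have [a1g a2g] : a1 `<=` g /\ a2 `<=` g by split;
  [exact: (@sumsetl _ K^o)|exact: (@sumsetr _ K^o)].
pose b1 := idmul (idinv g) a1; pose b2 := idmul (idinv g) a2.
have [ib1 ib2] : is_intideal b1 /\ is_intideal b2 by split; exact: idmul_inv_intideal.
have [sb1 sb2] := (intideal_submod ib1, intideal_submod ib2).
have [sg sVg] := (fracideal_submod fg, fracideal_submod (fracideal_inv fg)).
have fVg := fracideal_inv fg.
have gb1 : idmul g b1 = a1 by rewrite -(idmulK fVg s1) idinvK.
have gb2 : idmul g b2 = a2 by rewrite -(idmulK fVg s2) idinvK.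
pose h := idmul g (idmul b1 b2).
have ibb := intidealM ib1 ib2.
have ih : is_intideal h by exact: intidealM.
have hg : h `<=` g by rewrite /h idmulC; apply: idmul_int_sub.
have : sumset b1 b2 1.
  by apply: idmul_sumset => //; rewrite idmulC idmul_idinv //; exact: ringInt1.
move=> [u2 [u1 [bu2 bu1 E]]].
have [Ou1 Ou2] : ringInt u1 /\ ringInt u2 by case: ib1 ib2 => _ _ b1O [_ _ b2O]; split;
  [exact: b2O|exact: b1O].
exists g, h; split=> //.
  transitivity (idmul (idmul g b1) (idmul g b2)); last by rewrite gb1 gb2.
  by rewrite /h [RHS]idmulA // -[idmul b1 (idmul g b2)]idmulA // [idmul b1 g]idmulC idmulA.
have sh := intideal_submod ih.
have [sOO sA sC] := And3 (setX_submod sO sO) (setX_submod s1 s2) (setX_submod sg sh).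
apply/qisoP => //.
exists (fun z : K2 => (z.1 + z.2, u2 * z.2 - u1 * z.1) : K2).
have [g0 gD gM] := sg; have [h0 hD hM] := sh; have [a10 a1D a1M] := s1; have [a20 a2D a2M] := s2.
have ha1 : h `<=` a1 by rewrite /h -gb1; apply: idmulS => //; rewrite idmulC;
  exact: idmul_int_sub.
have ha2 : h `<=` a2 by rewrite /h -gb2; apply: idmulS => //; exact: idmul_int_sub.
have gu1 x : g x -> a2 (u1 * x) by move=> gx; rewrite -gb2 mulrC; exact: mem_idmul.
have gu2 x : g x -> a1 (u2 * x) by move=> gx; rewrite -gb1 mulrC; exact: mem_idmul.
have h1 x : a1 x -> h (u1 * x).
  by move=> ax; rewrite /h -idmulA // gb1 mulrC; exact: mem_idmul.
have h2 x : a2 x -> h (u2 * x).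
  by move=> ax; rewrite /h [idmul b1 _]idmulC -idmulA // gb2 mulrC; exact: mem_idmul.
have [C00 _ _] := sC.
apply: qmap_linear => //.
- by move=> r [x y] [x' y']; congr (_, _) => /=; rewrite /GRing.scale /=; ring.
- move=> [x y] [/= Ox Oy]; split => /=; first exact: ringIntD.
  by apply: ringIntB; exact: ringIntM.
- move=> [x y] [/= Ox Oy]; split=> [[/= gxy hxy]|[/= ax ay]]; split=> /=.
  + have -> : x = u2 * (x + y) - (u2 * y - u1 * x) by rewrite -[LHS]mul1r E; ring.
    by apply: (@submodB _ K^o) => //; [exact: gu2|exact: ha1].
  + have -> : y = u1 * (x + y) + (u2 * y - u1 * x) by rewrite -[LHS]mul1r E; ring.
    by apply: (a2D); [exact: gu1|exact: ha2].
  + by apply: gD; [exact: a1g|exact: a2g].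
  + by apply: (@submodB _ K^o) => //; [exact: h2|exact: h1].
- move=> [s t] [/= Os Ot]; exists (u2 * s - t, u1 * s + t).
    by split=> /=; [apply: ringIntB => //|apply: ringIntD => //]; exact: ringIntM.
  have -> : s - (u2 * s - t + (u1 * s + t)) = 0 by rewrite -[s in s - _]mul1r E; ring.
  have -> : t - (u2 * (u1 * s + t) - u1 * (u2 * s - t)) = 0 by rewrite -[t in t - _]mul1r E; ring.
  by split.
Qed.

End CyclicTypes.

(** * Index ideals *)

Section Index.
Variables (K : fieldExtType rat) (U : lmodType K).
Implicit Types (I J g h a c : set K) (L M X : set U) (u v l w : U).
Local Notation O := (ringInt : set K).
Local Notation K2 := (K^o * K^o)%type.
Local Notation "a `x` b" := ((a : set K^o) `*` (b : set K^o) : set K2) (at level 40).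
Local Notation OO := (O `x` O).

Let sO := @submod_ringInt K.

Definition index_in M L a : Prop := exists a1 a2 : intideal K,
  @qiso K U K2 M L OO (a1 `x` a2) /\ idmul a1 a2 = a.

(** The relation j y + m = 1 says that j generates J modulo gJ; the lemma is the injectivity of
    multiplication by j from O/g to J/gJ. *)
Lemma mulr_in_idmul g J j y m x : is_intideal g -> is_fracideal J -> idinv J y -> g m ->
  j * y + m = 1 -> idmul g J (x * j) -> ringInt x -> g x.
Proof.
move=> ig fJ Vy gm E gx Ox; have [[g0 gD gM] _ _] := ig.
have sJ := fracideal_submod fJ; have sg := intideal_submod ig.
have -> : x = (x * j) * y + x * m by rewrite -mulrA -mulrDr E mulr1.
apply: gD; last exact: gM.
have -> : g = idmul (idmul g J) (idinv J) by rewrite idmulA // idmul_idinv // idmulC idmulO.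
exact: mem_idmul.
Qed.

(** J and I may be non-principal, but elements j and i from [fracideal_approx] generate them modulo
    gJ and hI, so (s, t) maps to s j l + t i w. *)
Lemma stacked_qmap u v L M g h : indep u v -> is_intideal g -> is_intideal h ->
  stacked u v L M g h -> exists f, @qmap K K2 U f OO (g `x` h) M L.
Proof.
move=> uv ig ih [a [b [c [d [J [I [D fJ fI ME LE]]]]]]].
have lw := indep_change uv D; set l := _ + _ in ME LE lw; set w := _ + _ in ME LE lw.
have [j [Jj _ [y [m [Vy gm E]]]]] := fracideal_approx fJ ig.
have [i [Ii _ [y' [m' [Vy' hm' E']]]]] := fracideal_approx fI ih.
have [sJ sI] := (fracideal_submod fJ, fracideal_submod fI).
have [sg sh] := (intideal_submod ig, intideal_submod ih).
have [[J0 JD JM] [I0 ID IM]] := (sJ, sI).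
have [_ _ gO] := ig; have [_ _ hO] := ih.
exists (fun z : K2 => (z.1 * j) *: l + (z.2 * i) *: w).
have appr (g' J' : set K) (j' t t' x : K) : is_intideal g' -> is_fracideal J' -> idinv J' t ->
  g' t' ->
    j' * t + t' = 1 -> J' j' -> J' x -> exists2 r, ringInt r & idmul g' J' (x - r * j').
  move=> ig' fJ' Vt gt' E1 Jj' Jx; exists (x * t); first by rewrite mulrC; exact: Vt.
  have -> : x - x * t * j' = t' * x by rewrite -{1}[x]mulr1 -E1; ring.
  exact: mem_idmul.
apply: qmap_linear.
- exact: setX_submod.
- by have [] := dsum_submod l w (idmul_submod J sg) (idmul_submod I sh); rewrite -LE.
- move=> r [x1 x2] [y1 y2];
  rewrite pair_comb /= [in RHS]scalerDr !scalerA [RHS]addrACA -!scalerDl.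
  by congr (_ *: _ + _ *: _); ring.
- move=> [x1 x2] [/= Ox1 Ox2]; rewrite ME; exists (x1 * j), (x2 * i).
  by split=> //; [exact: JM|exact: IM].
- move=> [x1 x2] [/= Ox1 Ox2]; rewrite LE; split.
    move=> [p [q [gp hq /(indep_inj lw)[E1 E2]]]]; split=> /=.
      by apply: (mulr_in_idmul ig fJ Vy gm E) => //; rewrite E1.
    by apply: (mulr_in_idmul ih fI Vy' hm' E') => //; rewrite E2.
  by move=> [/= gx1 hx2]; exists (x1 * j), (x2 * i); split=> //; exact: mem_idmul.
- move=> z; rewrite ME => -[p [q [Jp Iq ->]]].
  have [r Or gr] := appr _ _ _ _ _ _ ig fJ Vy gm E Jj Jp.
  have [s Os hs] := appr _ _ _ _ _ _ ih fI Vy' hm' E' Ii Iq.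
  exists (r, s) => //; rewrite LE; exists (p - r * j), (q - s * i); split=> //=.
  by rewrite !scalerBl opprD addrACA.
Qed.

Lemma stacked_submod u v L M g h : is_intideal g -> is_intideal h ->
  stacked u v L M g h -> submod L /\ submod M.
Proof.
move=> ig ih [a [b [c [d [J [I [D fJ fI -> ->]]]]]]].
have [sJ sI] := (fracideal_submod fJ, fracideal_submod fI).
by split; apply: dsum_submod => //; apply: idmul_submod; exact: intideal_submod.
Qed.

Lemma stacked_qiso u v L M g h : indep u v -> is_intideal g -> is_intideal h ->
  stacked u v L M g h -> @qiso K U K2 M L OO (g `x` h).
Proof.
move=> uv ig ih st; have [sL sM] := stacked_submod ig ih st.
have [f hf] := stacked_qmap uv ig ih st.
have sgh := setX_submod (intideal_submod ig) (intideal_submod ih).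
have sOO := setX_submod sO sO.
by have [f' hf'] := qmap_sym sOO sgh sL sM hf; apply/qisoP => //; exists f'.
Qed.

(** The pair a1, a2 in the definition of the index is arbitrary. Bringing it to the form where one
    ideal contains the other and comparing elementary divisors shows that the product depends on M/L
    only. *)
Lemma index_stacked u v L M g h a : indep u v -> is_intideal g -> is_intideal h -> h `<=` g ->
  stacked u v L M g h -> index_in M L a <-> a = idmul g h.
Proof.
move=> uv ig ih hg st; have [sL sM] := stacked_submod ig ih st.
have q := stacked_qiso uv ig ih st.
have sgh := setX_submod (intideal_submod ig) (intideal_submod ih).
have sOO := setX_submod sO sO.
split=> [[[a1 i1] [[a2 i2] /= [qa <-]]]|->]; last by exists (IntIdeal ig), (IntIdeal ih).
have [g' [h' [ig' ih' hg' <- qn]]] := types_normal i1 i2.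
have sa := setX_submod (intideal_submod i1) (intideal_submod i2).
have sgh' := setX_submod (intideal_submod ig') (intideal_submod ih').
have q1 := qiso_trans sM sL sOO sa sgh' qa qn.
have q2 := qiso_trans sOO sgh' sM sL sgh (qiso_sym sM sL sgh' sOO q1) q.
by have [-> ->] := types_uniq ig' ih' ig ih hg hg' q2.
Qed.

Lemma stacked_vol u v L M g h : indep u v -> is_intideal g -> is_intideal h ->
  stacked u v L M g h -> vol u v L = idmul (idmul g h) (vol u v M) /\ is_fracideal (vol u v M).
Proof.
move=> uv ig ih [a [b [c [d [J [I [D fJ fI -> ->]]]]]]].
have [sJ sI] := (fracideal_submod fJ, fracideal_submod fI).
have [sg sh] := (intideal_submod ig, intideal_submod ih).
have [sgJ shI] := (idmul_submod J sg, idmul_submod I sh).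
have fD := principal_frac D; have sD := fracideal_submod fD.
rewrite !vol_dsum //; split; last by apply: fracidealM => //; exact: fracidealM.
set P := principal _; set gh := idmul g h.
have sgh : is_submodK gh by exact: idmul_submod.
have -> : idmul (idmul g J) (idmul h I) = idmul gh (idmul J I).
  by rewrite /gh !idmulA // -[idmul J (idmul h I)]idmulA // [idmul J h]idmulC idmulA.
by rewrite -idmulA // [idmul P gh]idmulC idmulA.
Qed.

Lemma vol_frac u v M : indep u v -> lat u v M -> is_fracideal (vol u v M).
Proof.
move=> uv lM; have [g [h [ig ih hg st]]] := stacked_exists uv lM lM (@subset_refl _ M).
by have [] := stacked_vol uv ig ih st.
Qed.

(** Turns the index into an equation between ideals of determinants, where its multiplicativity in
    chains is visible. *)
Lemma index_vol u v L M a : indep u v -> lat u v L -> lat u v M -> L `<=` M -> is_intideal a ->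
  index_in M L a <-> vol u v L = idmul a (vol u v M).
Proof.
move=> uv lL lM LM ia; have [g [h [ig ih hg st]]] := stacked_exists uv lL lM LM.
have [volE fv] := stacked_vol uv ig ih st.
rewrite (index_stacked _ uv ig ih hg st) volE; split=> [->//|E].
apply: (idmul_inj fv); [exact: intideal_submod|by apply: idmul_submod; exact: intideal_submod|].
by rewrite idmulC -E idmulC.
Qed.

(** On the two summands the inclusion reads g in c and h in c, and the second follows from h in
    g. *)
Lemma stacked_scale_sub u v L M g h c : indep u v -> is_intideal g -> is_intideal h ->
  h `<=` g -> is_intideal c -> stacked u v L M g h -> sprod (idinv c) L `<=` M <-> g `<=` c.
Proof.
move=> uv ig ih hg ic [a [b [p [d [J [I [D fJ fI -> ->]]]]]]].
have lw := indep_change uv D.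
have [sJ sI] := (fracideal_submod fJ, fracideal_submod fI).
have [sg sh] := (intideal_submod ig, intideal_submod ih).
have fc := intideal_frac ic; have fVc := fracideal_inv fc; have sVc := fracideal_submod fVc.
have [fVJ fVI] := (fracideal_inv fJ, fracideal_inv fI).
have sVJ := fracideal_submod fVJ.
have [sgJ shI] := (idmul_submod J sg, idmul_submod I sh).
rewrite sprod_dsum //; split=> [|gc].
  move/(dsum_subset lw (idmul_submod _ sVc) (idmul_submod _ sVc)) => [h1 _].
  apply/idmul_idinv_sub => //.
  have -> : idmul (idinv c) g = idmul (idmul (idinv c) (idmul g J)) (idinv J).
    by rewrite !idmulA // idmul_idinv // [idmul g O]idmulC idmulO.
  by rewrite -(idmul_idinv fJ); exact: idmulS.
have key g' J' : is_submodK g' -> is_submodK J' -> g' `<=` c ->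
  idmul (idinv c) (idmul g' J') `<=` J'.
  move=> sg' sJ' gc'; rewrite -[X in _ `<=` X](idmulK fc sJ').
  by apply: idmulS => //; exact: idmulS.
by apply: dsumS; apply: key => //; exact: subset_trans hg gc.
Qed.

Lemma stacked_scale u v L M g h a : is_intideal g -> is_intideal h -> is_fracideal a ->
  stacked u v L M g h -> stacked u v (sprod a L) (sprod a M) g h.
Proof.
move=> ig ih fa [p [q [c [d [J [I [D fJ fI -> ->]]]]]]].
have [sJ sI] := (fracideal_submod fJ, fracideal_submod fI).
have [sg sh] := (intideal_submod ig, intideal_submod ih).
have sa := fracideal_submod fa.
exists p, q, c, d, (idmul a J), (idmul a I); split=> //; try exact: fracidealM.
  by rewrite sprod_dsum.
rewrite sprod_dsum //; try exact: idmul_submod.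
by rewrite -!idmulA // [idmul a g]idmulC [idmul a h]idmulC.
Qed.

(** M/L and aM/aL have the same elementary divisors. *)
Lemma qiso_scale u v L M a : indep u v -> lat u v L -> lat u v M -> L `<=` M ->
  is_fracideal a -> qiso M L (sprod a M) (sprod a L).
Proof.
move=> uv lL lM LM fa; have [g [h [ig ih hg st]]] := stacked_exists uv lL lM LM.
have sta := stacked_scale ig ih fa st.
have [sL sM] := stacked_submod ig ih st; have [saL saM] := stacked_submod ig ih sta.
have sgh := setX_submod (intideal_submod ig) (intideal_submod ih).
have sOO := setX_submod sO sO.
have q1 := stacked_qiso uv ig ih st; have q2 := stacked_qiso uv ig ih sta.
exact: qiso_trans sM sL sOO sgh saL q1 (qiso_sym saM saL sgh sOO q2).
Qed.

Lemma stacked_iso u v u' v' L M L' M' g h : indep u v -> indep u' v' ->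
  is_intideal g -> is_intideal h -> stacked u v L M g h -> stacked u' v' L' M' g h ->
  exists f, qmap f M L M' L'.
Proof.
move=> uv uv' ig ih st st'.
have [sL sM] := stacked_submod ig ih st; have [saL saM] := stacked_submod ig ih st'.
have sgh := setX_submod (intideal_submod ig) (intideal_submod ih).
have sOO := setX_submod sO sO.
have q1 := stacked_qiso uv ig ih st; have q2 := stacked_qiso uv' ig ih st'.
by apply/qisoP => //; exact: qiso_trans sM sL sOO sgh saL q1 (qiso_sym saM saL sgh sOO q2).
Qed.

Lemma lat_finquot u v L M : indep u v -> lat u v L -> lat u v M -> L `<=` M -> finquot M L.
Proof.
move=> uv lL lM LM; have [g [h [ig ih hg st]]] := stacked_exists uv lL lM LM.
have [f hf] := stacked_qmap uv ig ih st.
have [sg [x gx x0] gO] := ig; have [sh [y hy y0] hO] := ih.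
apply: (qmap_finquot _ _ _ hf); [exact: setX_submod|by case: lL| |].
  by move=> [s t] [/= /gO ? /hO ?].
have [s sP] := finquot_ideal sg gx x0; have [t tP] := finquot_ideal sh hy y0.
exists [seq (p, q) | p <- s, q <- t] => -[p q] [/= /sP[p' sp' gp'] /tP[q' tq' hq']].
by exists (p', q'); [apply/allpairsP; exists (p', q')|split].
Qed.

Lemma lat_scale u v M a : indep u v -> lat u v M -> is_fracideal a -> lat u v (sprod a M).
Proof.
move=> uv lM fa; have [[sM [d d0 dM] [e e0 [eu ev]]] [sa [x ax x0] [f [Of f0 fP]]]] := (lM, fa).
split; first exact: sprod_submod.
  exists (f * d); first by rewrite mulf_neq0.
  apply: sprod_sub; first exact: bounded_submod.
  move=> y z /fP ay /dM[p [q [Op Oq E]]]; exists (f * y * p), (f * y * q).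
  split; [exact: ringIntM|exact: ringIntM|].
  by rewrite -!scalerA -!scalerDr -E !scalerA; congr (_ *: _); ring.
exists (x * e); first by rewrite mulf_neq0.
by rewrite -!scalerA; split; exact: mem_sprod.
Qed.

Lemma lat_sumset u v L M : lat u v L -> lat u v M -> lat u v (sumset L M).
Proof.
move=> [sL [d d0 dL] [e e0 [eu ev]]] [sM [d' d'0 dM] _]; split; first exact: sumset_submod.
  have [p p0 Op] := denom_exists d; have [q q0 Oq] := denom_exists d'.
  exists (p%:~R * q%:~R * (d * d')); first by rewrite !mulf_neq0 ?intr_eq0K.
  move=> _ [y [z [/dL[s [t [Os Ot E]]] /dM[s' [t' [Os' Ot' E']]] ->]]].
  exists ((p%:~R * (q%:~R * d')) * s + (q%:~R * (p%:~R * d)) * s'),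
    ((p%:~R * (q%:~R * d')) * t + (q%:~R * (p%:~R * d)) * t').
  have [Op1 Oq1] : ringInt (p%:~R * (q%:~R * d')) /\ ringInt (q%:~R * (p%:~R * d)).
    by split; apply: ringIntM => //; exact: ringInt_int.
  split; try by apply: ringIntD; exact: ringIntM.
  rewrite scalerDr.
  have -> : (p%:~R * q%:~R * (d * d')) *: y = (p%:~R * (q%:~R * d')) *: (s *: u + t *: v).
    by rewrite -E scalerA; congr (_ *: _); ring.
  have -> : (p%:~R * q%:~R * (d * d')) *: z = (q%:~R * (p%:~R * d)) *: (s' *: u + t' *: v).
    by rewrite -E' scalerA; congr (_ *: _); ring.
  by rewrite !scalerDr !scalerA addrACA -!scalerDl.
by exists e => //; split; apply: sumsetl.
Qed.

Lemma vol_scale u v M a : indep u v -> lat u v M -> is_fracideal a ->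
  vol u v (sprod a M) = idmul (idmul a a) (vol u v M).
Proof.
move=> uv lM fa; have [g [h [ig ih hg [p [q [c [d [J [I [D fJ fI ME _]]]]]]]]]] :=
  stacked_exists uv lM lM (@subset_refl _ M).
have [sJ sI sa] := And3 (fracideal_submod fJ) (fracideal_submod fI) (fracideal_submod fa).
have [saJ saI] := (idmul_submod J sa, idmul_submod I sa).
have sD := fracideal_submod (principal_frac D).
rewrite ME sprod_dsum // !vol_dsum //; set P := principal _; set aa := idmul a a.
have saa : is_submodK aa by exact: idmul_submod.
have -> : idmul (idmul a J) (idmul a I) = idmul aa (idmul J I).
  by rewrite /aa !idmulA // -[idmul J (idmul a I)]idmulA // [idmul J a]idmulC idmulA.
by rewrite -idmulA // [idmul P aa]idmulC idmulA.
Qed.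

Lemma index_trivial u v L M : indep u v -> lat u v L -> lat u v M -> L `<=` M ->
  index_in M L O -> L = M.
Proof.
move=> uv lL lM LM; have [g [h [ig ih hg st]]] := stacked_exists uv lL lM LM.
move/(index_stacked _ uv ig ih hg st) => E.
have [sg sh] := (intideal_submod ig, intideal_submod ih).
have [_ _ gO] := ig; have [_ _ hO] := ih.
have gE : g = O.
  by apply/seteqP; split=> //; rewrite [X in X `<=` _]E idmulC; exact: idmul_int_sub.
have hE : h = O.
  by apply/seteqP; split=> //; rewrite [X in X `<=` _]E; exact: idmul_int_sub.
have [a [b [c [d [J [I [D fJ fI -> ->]]]]]]] := st.
by rewrite gE hE !idmulO //; exact: fracideal_submod.
Qed.

End Index.

(** * Level structures *)

Section Level.
Variables (K : fieldExtType rat) (U : lmodType K) (n : set K).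
Implicit Types (L M X : set U).
Local Notation O := (ringInt : set K).
Hypothesis i_n : is_intideal n.

Definition cyclic_in M L : Prop := @qiso K U K^o M L O n.

Let s_n : is_submodK n. Proof. by case: i_n. Qed.

Let sO := @submod_ringInt K.

Lemma cyclicP M L : submod M -> submod L ->
  cyclic_in M L <-> exists f, @qmap K U K^o f M L O n.
Proof. by move=> sM sL; apply: qisoP. Qed.

Lemma qmap_cyclic_scale (f : U -> K) M L r z : submod M -> submod L ->
  @qmap K U K^o f M L O n -> ringInt r -> M z -> n (f (r *: z) - r * f z) /\ n (f 0).
Proof.
move=> sM [L0 _ _] fq Or Mz; have [M0 _ _] := sM; have [_ fL _ _] := fq.
have f0 : n (f 0) by exact: (@qmap0 _ U K^o _ _ _ _ _ sM fq).
split=> //; have := fL r z 0 Or Mz M0; rewrite addr0 opprD addrA => h.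
by rewrite -[_ - _](subrK (f 0)); case: (s_n) => _ nD _; exact: nD.
Qed.

Lemma cyclic_ann M L : submod M -> submod L -> cyclic_in M L -> sprod n M `<=` L.
Proof.
move=> sM sL /cyclicP[]// f hf; apply: sprod_sub => // r z nr Mz.
have Or : ringInt r by case: i_n => _ _; apply.
have [n1 n0] := qmap_cyclic_scale sM sL hf Or Mz.
have [fD fL fK fS] := hf; have [M0 MD MM] := sM; have [_ nD nM] := s_n.
rewrite -[_ *: _]subr0; apply/fK => //; first exact: MM.
apply: (@submodB _ K^o) => //; rewrite -[f _](subrK (r * f z)); apply: nD => //.
by rewrite mulrC; apply: nM => //; exact: fD.
Qed.

Lemma cyclic_gen M L : submod M -> submod L -> cyclic_in M L ->
  exists2 b, M b & forall x, M x -> exists2 r, ringInt r & L (x - r *: b).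
Proof.
move=> sM sL /cyclicP[]// f hf.
have [fD fL fK fS] := hf; have [M0 MD MM] := sM; have [_ nD nM] := s_n.
have [b Mb n1] := fS 1 (@ringInt1 K); exists b => // x Mx; exists (f x); first exact: fD.
have [h1 h2] := qmap_cyclic_scale sM sL hf (fD _ Mx) Mb.
apply/fK => //; first by apply: MM => //; exact: fD.
have h3 : n (f x - f x * f b).
  by rewrite -{1}[f x]mulr1 -mulrBr; apply: nM => //; exact: fD.
exact: (@submod_tr _ K^o _ _ _ _ s_n h3 (@submod_sw _ K^o _ _ _ s_n h1)).
Qed.

Lemma setI_submod L M : submod L -> submod M -> submod (L `&` M).
Proof.
move=> [L0 LD LZ] [M0 MD MZ]; split=> // [x y [? ?] [? ?]|r x Or [? ?]]; split.
- exact: LD.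
- exact: MD.
- exact: LZ.
- exact: MZ.
Qed.

Lemma qiso_sumset L L' M : submod L' -> submod M ->
  @qiso K U U L' (L' `&` M) (sumset M L') M.
Proof.
move=> sL' sM; have sX := setI_submod sL' sM.
apply/qisoP => //; exists id; apply: qmap_linear => //.
- by case: sM.
- by move=> x; exact: sumsetr.
- by move=> x Lx; split=> [|[]].
- move=> _ [m [x [Mm Lx ->]]]; exists x => //; rewrite addrK //.
Qed.

(* (M + L')/M is L'/(L' \cap M), a quotient of L'/L; two cyclic quotients with
   the same annihilator n agree. *)
Lemma cyclic_level L L' M : submod L -> submod L' -> submod M -> L `<=` L' -> L `<=` M ->
  cyclic_in L' L -> cyclic_in (sumset M L') M <-> (forall x, M x -> L' x -> L x).
Proof.
move=> sL sL' sM LL' LM cL.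
have sO' : @submod K K^o O := sO.
have sS := sumset_submod sM sL'.
have q := qiso_sumset L sL' sM.
have sX := setI_submod sL' sM.
split=> [cM x Mx L'x|h]; last first.
  have E : L' `&` M = L.
    by apply/seteqP; split=> [x [L'x Mx]|x Lx]; [exact: h|split; [exact: LL'|exact: LM]].
  rewrite E in q; exact: (@qiso_trans K U U K^o _ _ _ _ _ _ sS sM sL' sL s_n (qiso_sym sL' sL sM
    sS q) cL).
have cX : cyclic_in L' (L' `&` M) by exact: (@qiso_trans K U U K^o _ _ _ _ _ _ sL' sX sS sM s_n
  q cM).
have [b L'b bP] := cyclic_gen sL' sL cL.
have [r Or Lr] := bP _ L'x.
have [f hf] := proj1 (cyclicP sL' sX) cX.
have [fD fL fK fS] := hf; have [M0 MD MM] := sL'; have [_ nD nM] := s_n.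
have LX : L `<=` L' `&` M by move=> z Lz; split; [exact: LL'|exact: LM].
have Xrb : (L' `&` M) (r *: b) by rewrite -(subKr x (r *: b)); apply: submodB => //; exact: LX.
have [h1 h0] := qmap_cyclic_scale sL' sX hf Or L'b.
have nrb : n (f (r *: b)).
  rewrite -[f _](subrK (f 0)); apply: nD => //; apply/fK; rewrite ?subr0 //.
  by case: Xrb.
have nrfb : n (r * f b) by rewrite -(subKr (f (r *: b)) (r * f b)); exact: (@submodB _ K^o).
(* Modulo n, f b is a unit with inverse t. So r f b in n gives r in n, and r b lies in n L', hence
   in L. *)
have [y L'y ny] := fS 1 (@ringInt1 K).
have [t Ot Lt] := bP _ L'y.
have [h2 _] := qmap_cyclic_scale sL' sX hf Ot L'b.
have h3 : n (f y - f (t *: b)) by apply/fK => //; [exact: MM|exact: LX].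
have h4 : n (1 - t * f b).
  exact: (@submod_tr _ K^o _ _ _ _ s_n (@submod_tr _ K^o _ _ _ _ s_n ny h3) h2).
have nr : n r.
  have -> : r = r * (1 - t * f b) + t * (r * f b) by ring.
  by apply: nD; exact: nM.
rewrite -(subrK (r *: b) x); case: (sL) => _ LD _; apply: LD => //.
by apply: (cyclic_ann sL' sL cL); exact: mem_sprod.
Qed.

End Level.

(** A copy of [Khat2], which is a module over \hat K, made to carry the K-module structure
    [scaleK]. *)
Definition Kh2 (R : realType) (K : fieldExtType rat) : Type := Khat2 R K.

Section Kh2Module.
Variables (R : realType) (K : fieldExtType rat).

HB.instance Definition _ := GRing.Zmodule.copy (Kh2 R K) (Khat2 R K).

Let scK (x : K) (v : Kh2 R K) : Kh2 R K := scaleK x v.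

Fact scaleKA x y v : scK x (scK y v) = scK (x * y) v.
Proof. by rewrite /scK /scaleK scalerA -Defs.iotaM. Qed.

Fact scaleK1 : left_id 1 scK.
Proof. by move=> v; rewrite /scK /scaleK -[Defs.iota R 1]/(1 : Khat R K) scale1r. Qed.

Fact scaleKDr : right_distributive scK +%R.
Proof. by move=> x u v; rewrite /scK /scaleK scalerDr. Qed.

Fact scaleKDl v : {morph scK^~ v : x y / x + y}.
Proof. by move=> x y; rewrite /scK /scaleK Defs.iotaD scalerDl. Qed.

HB.instance Definition _ := GRing.Zmodule_isLmodule.Build K (Kh2 R K)
  scaleKA scaleK1 scaleKDr scaleKDl.

End Kh2Module.

(** * Lattices in \hat K^2 as lattices in a K-plane *)

Section KhatLattices.
Variables (R : realType) (K : fieldExtType rat).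
Implicit Types (L M : set (Kh2 R K)) (u v : Kh2 R K).
Local Notation O := (ringInt : set K).

Lemma scaleKE (x : K) (v : Kh2 R K) : scaleK x v = x *: v.
Proof. by []. Qed.

Lemma denom_seq (s : seq K) : exists2 d : K, d != 0 & ringInt d /\ forall x, x \in s ->
  ringInt (d * x).
Proof.
elim: s => [|y s [d d0 [Od IH]]].
  by exists 1; [exact: oner_neq0|split=> //; exact: ringInt1].
have [e e0 Oe] := denom_exists y.
exists (e%:~R * d); first by rewrite mulf_neq0 ?intr_eq0K.
split; first by apply: ringIntM => //; exact: ringInt_int.
move=> x; rewrite inE => /orP[/eqP->|/IH Ox].
  by rewrite mulrAC; exact: ringIntM.
by rewrite -mulrA; apply: ringIntM => //; exact: ringInt_int.
Qed.

(** (u, v) is a K-basis of KL. The finitely many generators of L have a common denominator with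
    respect to it, and u and v, lying in KL, have nonzero multiples in L. *)
Lemma lattice_lat L : is_lattice L -> exists u v, indep u v /\ lat u v L.
Proof.
move=> [hs hd _].
have [s LE] : exists s : seq (Kh2 R K), L = sprod O [set v | v \in s] by exact: hs.
have [u [v [uv sE]]] : exists u v : Kh2 R K, indep u v /\
    (span_K L : set (Kh2 R K)) = [set w | exists x y : K, w = x *: u + y *: v].
  by case: hd => [u [v [uv sE]]]; exists u, v.
exists u, v; split=> //.
have sL : submod L by rewrite LE; apply: (@sprod_submod K (Kh2 R K)); exact: (@submod_ringInt K).
split=> //.
  have sb (t : seq (Kh2 R K)) : {subset t <= s} -> exists2 d : K, d != 0 & forall z, z \in t ->
      exists x y, [/\ ringInt x, ringInt y & d *: z = x *: u + y *: v].
    elim: t => [|z t IH] ts; first by exists 1; [exact: oner_neq0|].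
    have [|d d0 dP] := IH; first by move=> x xt; apply: ts; rewrite inE xt orbT.
    have [x [y zE]] : [set w : Kh2 R K | exists x y : K, w = x *: u + y *: v] z.
      rewrite -sE -[z]scale1r; apply: (@mem_sprod K (Kh2 R K)) => //.
      rewrite LE -[z]scale1r; apply: (@mem_sprod K (Kh2 R K)); first exact: ringInt1.
      by apply: ts; rewrite inE eqxx.
    have [e e0 [Oe eP]] := denom_seq [:: x; y; d].
    have [Ox Oy Od] : [/\ ringInt (e * x), ringInt (e * y) & ringInt (e * d)].
      by split; apply: eP; rewrite !inE eqxx ?orbT.
    exists ((e * e) * d); first by rewrite !mulf_neq0.
    move=> w; rewrite inE => /orP[/eqP->|/dP[p [q [Op Oq E]]]].
      exists (e * d * (e * x)), (e * d * (e * y)); split; try exact: ringIntM.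
      rewrite zE scalerDr !scalerA; congr (_ *: _ + _ *: _); ring.
    exists (e * e * p), (e * e * q); split; try by apply: ringIntM => //; exact: ringIntM.
    by rewrite -scalerA E scalerDr !scalerA.
  have [d d0 dP] := sb s (fun x h => h).
  exists d => //; rewrite LE; apply: (@sprod_sub K (Kh2 R K)); first exact: bounded_submod.
  by move=> r z Or zs; have [_ _ bZ] := bounded_submod u v d; apply: bZ => //; exact: dP.
have [L0 LD LZ] := sL.
have den (z : Kh2 R K) : span_K L z -> exists2 e : K, e != 0 & ringInt e /\ L (e *: z).
  move=> [k [x [y [_ Ly zE]]]]; rewrite {}zE.
  have [e e0 [Oe eP]] := denom_seq [seq x i | i : 'I_k].
  exists e => //; split=> //; rewrite scaler_sumr; apply: submod_sum => // i _.
  rewrite scaleKE scalerA; apply: LZ => //; apply: eP; apply: map_f; exact: mem_enum.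
have [e1 e10 [Oe1 Lu]] : exists2 e : K, e != 0 & ringInt e /\ L (e *: u).
  by apply: den; rewrite sE; exists 1, 0; rewrite scale1r scale0r addr0.
have [e2 e20 [Oe2 Lv]] : exists2 e : K, e != 0 & ringInt e /\ L (e *: v).
  by apply: den; rewrite sE; exists 0, 1; rewrite scale1r scale0r add0r.
exists (e1 * e2); first by rewrite mulf_neq0.
by split; [rewrite mulrC|]; rewrite -scalerA; exact: LZ.
Qed.

(** The generators are the a_i of a relation 1 = sum a_i b_i with b_i in I^-1. Generation is phrased
    as an induction principle along an additive map f, ready for maps such as x |-> x l. *)
Lemma fracideal_fingen I : is_fracideal I -> exists s : seq K,
  {in s, forall x, I x} /\ (forall (W : zmodType) (A : set W) (f : K -> W),
     A 0 -> (forall x y, A x -> A y -> A (x + y)) -> {morph f : x y / x + y} ->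
     (forall r x, ringInt r -> x \in s -> A (f (r * x))) -> forall y, I y -> A (f y)).
Proof.
move=> fI; have : idmul I (idinv I) 1 by rewrite idmul_idinv //; exact: ringInt1.
move=> [k [a [b [Ia Vb E]]]].
exists [seq a i | i : 'I_k]; split=> [x /mapP[i _ ->] //|W A f A0 AD fD fA y Iy].
rewrite -[y]mulr1 E mulr_sumr.
have f0 : f 0 = 0 by apply: (addrI (f 0)); rewrite -fD !addr0.
rewrite (big_morph f fD f0); apply: big_ind => // i _.
have -> : y * (a i * b i) = (b i * y) * a i by ring.
by apply: fA; [exact: Vb|apply: map_f; rewrite mem_enum].
Qed.

Lemma lat_lattice u v L M : indep u v -> is_lattice L -> lat u v L -> lat u v M -> is_lattice M.
Proof.
move=> uv [_ _ LT] lL lM; have [sM _ [e e0 [eu ev]]] := lM; split.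
- have [|c [d [J [I [D fJ fI _ ME]]]]] := @lat_steinitz _ _ u v M 1 0 uv lM;
  first by rewrite oner_neq0.
  set l := _ + _ in ME; set w := _ + _ in ME.
  have [[s1 [sJ1 gJ]] [s2 [sI2 gI]]] := (fracideal_fingen fJ, fracideal_fingen fI).
  have [[J0 _ _] [I0 _ _]] := (fracideal_submod fJ, fracideal_submod fI).
  exists ([seq x *: l | x <- s1] ++ [seq x *: w | x <- s2]); apply/seteqP; split.
    have [X0 XD XM] : submod (sprod O [set z : Kh2 R K | z \in [seq x *: l | x <- s1] ++ [seq x *: w | x <- s2]]).
      by apply: sprod_submod; exact: (@submod_ringInt K).
    move=> z; rewrite {1}ME => -[x [y [Jx Iy ->]]]; apply: (XD).
      apply: (gJ _ _ (fun x => x *: l) X0 XD) => //= [p q|r p Or ps]; first by rewrite scalerDl.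
      by rewrite -scalerA; apply: mem_sprod => //=; rewrite mem_cat (map_f (fun x => x *: l)).
    apply: (gI _ _ (fun x => x *: w) X0 XD) => //= [p q|r p Or ps]; first by rewrite scalerDl.
    by rewrite -scalerA; apply: mem_sprod => //=; rewrite mem_cat orbC (map_f (fun x => x *: w)).
  apply: (@sprod_sub K (Kh2 R K)) => // r z Or; rewrite /= mem_cat => zs.
  have [_ _ MM] := sM; apply: MM => //; rewrite ME.
  case/orP: zs => /mapP[x xs ->].
    by exists x, 0; rewrite scale0r addr0; split=> //; exact: sJ1.
  by exists 0, x; rewrite scale0r add0r; split=> //; exact: sI2.
- exists u, v; split=> //; apply/seteqP; split.
    move=> z [k [x [y [_ My zE]]]].
    suff [p [q E]] : exists p q : K, (z : Kh2 R K) = p *: u + q *: v by exists p, q.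
    have {zE} : (z : Kh2 R K) = \sum_i x i *: (y i : Kh2 R K) by exact: zE.
    move=> ->; apply: (big_ind (fun z : Kh2 R K => exists p q : K, z = p *: u + q *: v)).
    - by exists 0, 0; rewrite !scale0r addr0.
    - by move=> _ _ [p [q ->]] [p' [q' ->]]; exists (p + p'), (q + q'); rewrite !scalerDl addrACA.
    - move=> i _; have [p [q ->]] := lat_span lM (My i); exists (x i * p), (x i * q).
      by rewrite scalerDr !scalerA.
  move=> z [x [y zE]]; have {}zE : (z : Kh2 R K) = (x / e) *: (e *: u) + (y / e) *: (e *: v).
    by rewrite !scalerA !mulfVK.
  by rewrite zE; apply: prodsetD; apply: prodset1.
- have [t [Ot t0 tL]] := lat_absorb lM lL.
  apply/seteqP; split=> // z _; have : span_Khat L z by rewrite LT.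
  move=> [k [a [y [_ Ly ->]]]]; exists k, (fun i => a i * Defs.iota R t^-1),
    (fun i => scaleK t (y i)).
  split=> // [i|]; first exact: tL.
  apply: eq_bigr => i _; rewrite /scaleK scalerA -mulrA.
  have -> : Defs.iota R t^-1 * Defs.iota R t = 1 :> Khat R K.
    by rewrite -[LHS]/(Khat_mul _ _) Defs.iotaM mulVf.
  by rewrite mulr1.
Qed.

(** Every lattice over L is seen in the coordinates of L: M brings its own basis (u', v') of KM, the
    inclusion of L in M makes the transition matrix to (u, v) invertible, and Cramer's rule inverts
    it. *)
Lemma lat_super u v L M : indep u v -> lat u v L -> is_lattice M -> L `<=` M -> lat u v M.
Proof.
move=> uv lL /lattice_lat[u' [v' [uv' lM]]] LM.
have [sL _ [e e0 [eu ev]]] := lL; have [sM [d d0 dM] _] := lM.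
split=> //; last by exists e => //; split; exact: LM.
have sp z : L (e *: z) -> exists p q, z = p *: u' + q *: v'.
  move=> /LM /(lat_span lM)[p [q E]]; exists (e^-1 * p), (e^-1 * q).
  by rewrite -!scalerA -scalerDr -E scalerA mulVf // scale1r.
have [a [b uE]] := sp _ eu; have [a' [b' vE]] := sp _ ev.
have D : a * b' - b * a' != 0.
  apply/eqP => D0; have [h1 h2] : b' = 0 /\ b = 0.
    have [|-> /eqP] := uv b' (- b); last by rewrite oppr_eq0 => /eqP.
    rewrite uE vE comb_comb; have -> : b' * a + - b * a' = a * b' - b * a' by ring.
    by rewrite D0 (_ : b' * b + - b * b' = 0) ?scale0r ?addr0 //; ring.
  have [|a'0 a0] := uv a' (- a).
    by rewrite uE vE comb_comb h1 h2 !mulr0 addr0 (_ : a' * a + - a * a' = 0) ?scale0r ?addr0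
      //; ring.
  move/eqP: a0; rewrite oppr_eq0 => /eqP a0.
  have [|/eqP + _] := uv 1 0; last by rewrite oner_eq0.
  by rewrite uE a0 h2 !scale0r !addr0 scaler0.
pose D' := a * b' - b * a'.
have u'E : u' = (b' / D') *: u + (- b / D') *: v.
  rewrite uE vE comb_comb.
  have -> : b' / D' * a + - b / D' * a' = 1 by rewrite -(divff D) -/D'; rewrite /D'; ring.
  have -> : b' / D' * b + - b / D' * b' = 0 by ring.
  by rewrite scale1r scale0r addr0.
have v'E : v' = (- a' / D') *: u + (a / D') *: v.
  rewrite uE vE comb_comb.
  have -> : - a' / D' * b + a / D' * b' = 1 by rewrite -(divff D) -/D'; rewrite /D'; ring.
  have -> : - a' / D' * a + a / D' * a' = 0 by ring.
  by rewrite scale1r scale0r add0r.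
have [N N0 [ON NP]] := denom_seq [:: b' / D'; - b / D'; - a' / D'; a / D'].
exists (N * d); first by rewrite mulf_neq0.
move=> z /dM[x [y [Ox Oy E]]].
exists (x * (N * (b' / D')) + y * (N * (- a' / D'))), (x * (N * (- b / D')) + y * (N * (a / D'))).
split; try by apply: ringIntD; apply: ringIntM => //; apply: NP; rewrite !inE eqxx ?orbT.
rewrite -scalerA E u'E v'E comb_comb scalerDr !scalerA; congr (_ *: _ + _ *: _); ring.
Qed.

End KhatLattices.

(** * Ideals prime to the level *)

Section Coprime.
Variables (K : fieldExtType rat) (n : set K).
Implicit Types (I J a b c : set K).
Local Notation O := (ringInt : set K).
Hypothesis i_n : is_intideal n.

Let s_n : is_submodK n. Proof. by case: i_n. Qed.

Lemma idcoprimeP c : is_intideal c -> idcoprime c n <-> exists x y, [/\ c x, n y & x + y = 1].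
Proof.
move=> [sc _ cO]; split=> [E|[x [y [cx ny E]]]].
  have : sumset c n 1 by rewrite E; exact: ringInt1.
  by move=> [x [y [cx ny ->]]]; exists x, y.
have [_ _ nO] := i_n; apply/seteqP; split.
  by apply: (@sumset_sub _ K^o) => //; exact: submod_ringInt.
move=> z Oz; rewrite -(mulr1 z) -E mulrDr; exists (z * x), (z * y).
by split=> //; [case: sc => _ _; exact|case: (s_n) => _ _; exact].
Qed.

Lemma idcoprimeO : idcoprime O n.
Proof.
apply/idcoprimeP; first exact: intideal_ringInt.
by exists 1, 0; rewrite addr0; split=> //; [exact: ringInt1|case: (s_n)].
Qed.

Lemma idcoprimeM b c : is_intideal b -> is_intideal c -> idcoprime b n -> idcoprime c n ->
  idcoprime (idmul b c) n.
Proof.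
move=> ib ic /(idcoprimeP ib)[x [y [bx ny E]]] /(idcoprimeP ic)[x' [y' [cx ny' E']]].
apply/idcoprimeP; first exact: intidealM.
exists (x * x'), (x * y' + y); split; [exact: mem_idmul| |].
  have [_ nD nM] := s_n; apply: nD => //; apply: nM => //.
  by case: ib => _ _; apply.
by rewrite addrA -mulrDr E' mulr1.
Qed.

Lemma coprime_int c : is_intideal c -> idcoprime c n -> is_fracideal_coprime n c.
Proof.
move=> ic cc; split; first exact: intideal_frac.
exists c, O; split=> //; [exact: intideal_ringInt|exact: idcoprimeO|].
by rewrite idmulC idmulO //; exact: intideal_submod.
Qed.

Lemma coprime_mul a b : is_fracideal_coprime n a -> is_fracideal_coprime n b ->
  is_fracideal_coprime n (idmul a b).
Proof.
move=> [fa [b1 [c1 [ib1 ic1 cb1 cc1 E1]]]] [fb [b2 [c2 [ib2 ic2 cb2 cc2 E2]]]].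
split; first exact: fracidealM.
exists (idmul b1 b2), (idmul c1 c2).
split; [exact: intidealM|exact: intidealM|exact: idcoprimeM|exact: idcoprimeM|].
have [sa sb] := (fracideal_submod fa, fracideal_submod fb).
have [s1 s2] := (intideal_submod ic1, intideal_submod ic2).
rewrite -E1 -E2 !idmulA //; congr (idmul a _).
by rewrite -[idmul b (idmul c1 c2)]idmulA // [idmul b c1]idmulC idmulA.
Qed.

Lemma coprime_inv a : is_fracideal_coprime n a -> is_fracideal_coprime n (idinv a).
Proof.
move=> [fa [b [c [ib ic cb cc E]]]]; split; first exact: fracideal_inv.
by exists c, b; split=> //; rewrite -E idmulK //; exact: intideal_submod.
Qed.

(** Choose x in I^-1 generating I^-1 modulo n: then c = x I is integral, and the relation x y + mu =
    1 with y in I and mu in n makes it prime to n. *)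
Lemma coprime_class I : is_fracideal I -> exists c, [/\ is_intideal c, idcoprime c n
  & exists2 x, x != 0 & c = [set x * y | y in I]].
Proof.
move=> fI; have fV := fracideal_inv fI.
have [x [Vx x0 [y [mu [Iy nmu E]]]]] := fracideal_approx fV i_n.
rewrite idinvK // in Iy; have sI := fracideal_submod fI.
have cE := idmul_principal x sI.
have ic : is_intideal (idmul (principal x) I).
  apply: intideal_of_frac; first exact: fracidealM (principal_frac x0) fI.
  by rewrite cE => _ [z Iz <-]; exact: Vx.
exists (idmul (principal x) I); split=> //; last by exists x.
by apply/idcoprimeP => //; exists (x * y), mu; split=> //; rewrite cE; exists y.
Qed.

Lemma coprime_denom a : is_fracideal_coprime n a -> exists b c,
  [/\ is_intideal b, is_intideal c, c `<=` idinv a, idmul b (idinv a) = c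
    & (exists x y, [/\ b x, n y & x + y = 1]) /\ (exists x y, [/\ c x, n y & x + y = 1])].
Proof.
move=> [fa [b [c [ib ic /(idcoprimeP ib) cb /(idcoprimeP ic) cc E]]]].
have fV := fracideal_inv fa; have [_ _ bO] := ib.
have bVc : idmul b (idinv a) = c.
  by rewrite idmulC -E idmulK //; exact: intideal_submod.
exists b, c; split=> //; rewrite -bVc.
by apply: idmul_int_sub => //; exact: fracideal_submod.
Qed.

Variables (U : lmodType K).
Implicit Types L M N : set U.

(* Under these conditions a generator of L'/L can be chosen in L' and N, and it
   then gives a well-defined generator of N/M. *)
Definition compat L L' M N : Prop :=
  [/\ forall x, L' x -> exists y, [/\ L' y, N y & L (x - y)],
      forall x, N x -> exists y, [/\ L' y, N y & M (x - y)]
    & forall x, L x -> N x -> M x].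

Lemma compat_sum L L' M : submod L -> submod L' -> submod M -> L `<=` L' ->
  (forall x, M x -> L' x -> L x) -> L `<=` M -> compat L L' M (sumset M L').
Proof.
move=> [L0 _ _] sL' sM LL' ML LM; split.
- by move=> x L'x; exists x; rewrite subrr; split=> //; exact: sumsetr.
- move=> _ [y [x [My L'x ->]]]; exists x; rewrite addrK; split=> //; exact: sumsetr.
- by move=> x /LM.
Qed.

(** Write a c = b with b and c prime to n. An x in c that is 1 modulo n carries L' into a^-1 L'
    without changing classes modulo L; an x1 in b that is 1 modulo n carries a^-1 L' into L' without
    changing classes modulo a^-1 L. *)
Lemma compat_scale L L' a : submod L -> submod L' -> sprod n L' `<=` L ->
  is_fracideal_coprime n a -> compat L L' (sprod (idinv a) L) (sprod (idinv a) L').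
Proof.
move=> sL sL' nL ca; have [fa _] := ca.
have [b [c [ib ic cV bV [[x1 [y1 [bx1 ny1 E1]]] [x [y [cx ny E]]]]]]] := coprime_denom ca.
have fV := fracideal_inv fa; have sV := fracideal_submod fV.
have [[_ _ bO] [_ _ cO] [_ _ nO]] := And3 ib ic i_n.
have [_ L'D L'M] := sL'; have [_ LD LM] := sL.
have nVL z : sprod (idinv a) L' z -> forall t, n t -> sprod (idinv a) L (t *: z).
  move=> Vz t nt.
  apply: (@sprodS _ _ (idinv a) (idinv a) (sprod n L') L) => //.
  rewrite -sprodA // [idmul _ n]idmulC sprodA //; exact: mem_sprod.
split=> z.
- move=> L'z; exists (x *: z); split.
  + by apply: L'M => //; exact: cO.
  + by apply: mem_sprod => //; exact: cV.
  + rewrite -[z in z - _]scale1r -E scalerDl addrC addKr.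
    by apply: nL; exact: mem_sprod.
- move=> Vz; exists (x1 *: z); split.
  + have : sprod c L' (x1 *: z).
      by rewrite -bV sprodA //; [exact: mem_sprod|exact: intideal_submod].
    by apply: sprod_sub => // r w /cO; exact: L'M.
  + by have [_ _ VM] := sprod_submod L' sV; apply: VM => //; exact: bO.
  + by rewrite -[z in z - _]scale1r -E1 scalerDl addrC addKr; exact: nVL.
- move=> Lz Vz; rewrite -[z]scale1r -E scalerDl.
  have [_ VD _] := sprod_submod L sV; apply: VD; last exact: nVL.
  by apply: mem_sprod => //; exact: cV.
Qed.

(** Composing T_{a,a} and T_{b,b} calls for one representative that suits both stages. With x in c
    and x' in c', both 1 modulo n, the multiple by x x' does. *)
Lemma compat_scale2 L L' a b : submod L -> submod L' -> sprod n L' `<=` L ->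
  is_fracideal_coprime n a -> is_fracideal_coprime n b ->
  forall x, L' x -> exists y, [/\ L' y, sprod (idinv a) L' y, sprod (idinv (idmul a b)) L' y &
    L (x - y)].
Proof.
move=> sL sL' nL ca cb z L'z.
have [[fa _] [fb _]] := (ca, cb).
have [_ [c [_ ic cV _ [_ [x [y [cx ny E]]]]]]] := coprime_denom ca.
have [_ [c' [_ ic' cV' _ [_ [x' [y' [cx' ny' E']]]]]]] := coprime_denom cb.
have [[_ _ cO] [_ _ cO'] [_ _ nO]] := And3 ic ic' i_n.
have [_ L'D L'M] := sL'; have [_ LD LM] := sL.
have [fVa fVb] := (fracideal_inv fa, fracideal_inv fb).
exists ((x * x') *: z); split.
- by apply: L'M => //; apply: ringIntM; [exact: cO|exact: cO'].
- apply: mem_sprod => //; rewrite mulrC; case: (fracideal_submod fVa) => _ _ VM.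
  by apply: VM; [exact: cO'|exact: cV].
- by apply: mem_sprod => //; rewrite idinvM //; apply: mem_idmul; [exact: cV|exact: cV'].
- apply: nL; have -> : z - (x * x') *: z = (y + x * y') *: z.
    rewrite -[z in z - _]scale1r -scalerBl; congr (_ *: _).
    have -> : y' = 1 - x' by rewrite -E' addrC addKr.
    have -> : y = 1 - x by rewrite -E addrC addKr.
    by ring.
  apply: mem_sprod => //; have [_ nD nM] := s_n; apply: nD => //.
  by apply: nM => //; exact: cO.
Qed.

End Coprime.

Section LinearOperators.
Variable P : choiceType.
Implicit Types (S T : lend {malg rat[P]}).

Lemma lendZ (V : lmodType rat) (T : lend V) q (x : V) : T (q *: x) = q *: T x.
Proof.
have T0 : T 0 = 0.
  by have := lendP T (-1) 0 0; rewrite scaler0 addr0 scaleN1r addNr.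
by have := lendP T q x 0; rewrite !addr0 T0 addr0.
Qed.

Lemma lendD (V : lmodType rat) (T : lend V) (x y : V) : T (x + y) = T x + T y.
Proof. by have := lendP T 1 x y; rewrite !scale1r. Qed.

Lemma lend0 (V : lmodType rat) (T : lend V) : T 0 = 0.
Proof. by have := lendZ T 0 0; rewrite !scale0r. Qed.

Lemma lend_sum (V : lmodType rat) (T : lend V) I (r : seq I) (p : pred I) (F : I -> V) :
  T (\sum_(i <- r | p i) F i) = \sum_(i <- r | p i) T (F i).
Proof. exact: (big_morph _ (lendD T) (lend0 T)). Qed.

Lemma lend_fsum (V : lmodType rat) (T : lend V) (I : choiceType) (A : set I) (F : I -> V) :
  finite_set A -> T (\sum_(i \in A) F i) = \sum_(i \in A) T (F i).
Proof. by move=> fA; rewrite !fsbig_finite //= lend_sum. Qed.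

Lemma lextend_basis (f : P -> {malg rat[P]}) x : lextend f << x >> = f x.
Proof.
rewrite /= (linextw f (d := [fset x]%fset)); last exact: msuppU_le.
by rewrite big_seq_fset1 mcoeffUU scale1r.
Qed.

Lemma lend_ext S T : (forall x, S << x >> = T << x >>) -> S = T.
Proof.
move=> h; apply: val_inj; apply/funext => v /=.
rewrite (monalgE v) !lend_sum; apply: eq_bigr => x _.
have -> : << v@_x *g x >> = v@_x *: << x >> :> {malg rat[P]} by apply/malgP => k;
  rewrite mcoeffZ !mcoeffU mulrnAr mulr1.
by rewrite !lendZ h.
Qed.

End LinearOperators.

(** * Modular points and the Hecke operators on them *)

Section Points.
Variables (R : realType) (K : fieldExtType rat) (n : intideal K) (m : modpoints).
Local Notation Kh := (Kh2 R K).
Local Notation pt := (Defs.point m R n).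
Implicit Types (L M N : set Kh).

Definition pL : pt -> set Kh :=
  match m return Defs.point m R n -> set Kh with M0 => @pt0_L R K n | M1 => @pt1_L R K n end.

Definition pL' : pt -> set Kh :=
  match m return Defs.point m R n -> set Kh with M0 => @pt0_L' R K n | M1 => @pt1_L' R K n end.

(* The modular point obtained from (L, L') or (L, L', B) by replacing (L, L')
   by (M, N); the Hecke operators of both levels have this form. *)
Definition mv : pt -> set Kh -> set Kh -> {malg rat[pt]} :=
  match m return Defs.point m R n -> set Kh -> set Kh -> {malg rat[Defs.point m R n]} with
  | M0 => fun P M N => basis0 n M N
  | M1 => fun P M N => basis1 n M N (sumset (pt1_beta P `&` N) M)
  end.

Lemma pointP (P : pt) : @is_point0 R K n (pL P) (pL' P).
Proof. by move: P; rewrite /pL /pL'; case: m => [[L L' h]|[L L' B h]] //; exact: proj1 h. Qed.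

Lemma lattice_submod L : is_lattice L -> submod L.
Proof. by move=> /lattice_lat[u [v [_ []]]]. Qed.

Lemma point1_coset (L L' B : set Kh) : @is_point1 R K n L L' B -> exists b : Kh,
  [/\ L' b, forall x, B x <-> L (x - b)
    & forall z, L' z -> exists2 r, ringInt r & L (z - r *: b)].
Proof.
move=> [[laL _ _ _] [b [L'b BE L'E]]]; exists (b : Kh); split=> // [x|z].
  rewrite BE; split=> [[_ [l [-> Ll xE]]]|Lxb].
    by have {}xE : x = (b : Kh) + l by []; rewrite xE addrAC subrr add0r.
  by exists b, (x - b); split=> //; rewrite addrC subrK.
rewrite L'E => -[l [_ [Ll [r Or ->] zE]]]; exists r => //.
by have {}zE : z = (l : Kh) + r *: (b : Kh) by []; rewrite zE addrK.
Qed.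

(** The first half moves the generator along. The second half says that going to (M2, N2) by way of
    (M, N) is going there directly, as soon as every class of L'/L has a representative in both N
    and N2; composites of Hecke operators are evaluated in this way. *)
Lemma point1_move (L L' B M N : set Kh) : @is_point1 R K n L L' B -> @is_point0 R K n M N ->
  compat L L' M N -> @is_point1 R K n M N (sumset (B `&` N) M) /\
  forall M2 N2 : set Kh, (forall x, M x -> N2 x -> M2 x) -> (forall x, L x -> N2 x -> M2 x) ->
    submod M2 -> submod N2 ->
    (forall x, L' x -> exists y, [/\ L' y, N y, N2 y & L (x - y)]) ->
    sumset (sumset (B `&` N) M `&` N2) M2 = sumset (B `&` N2) M2.
Proof.
move=> hP pMN [c1 c2 c3]; have [b [L'b BE L'E]] := point1_coset hP.
have [[laL laL' LL' cyL] _] := hP; have [laM laN MN cyM] := pMN.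
have [sL sL' sM sN] := And4 (lattice_submod laL) (lattice_submod laL') (lattice_submod laM)
  (lattice_submod laN).
have [L0 LD LZ] := sL; have [L'0 L'D L'Z] := sL'; have [N_0 ND NZ] := sN; have [M_0 MD MZ] := sM.
have BP x y : B x -> B y -> L (x - y).
  by move=> /BE Bx /BE By; exact: (submod_tr sL Bx (submod_sw sL By)).
have Bb y : L (b - y) -> B y by move=> h; apply/BE; exact: submod_sw.
split.
  have [y [L'y Ny Lby]] := c1 _ L'b.
  have By := Bb _ Lby.
  split=> //; exists y; split=> //.
    apply/seteqP; split=> _ [x [z [+ Mz ->]]].
      move=> [Bx Nx]; exists y, ((x - y) + z); split=> //;
        last by rewrite addrA [y + _]addrC subrK.
      by apply: MD => //; apply: c3; [exact: BP|exact: submodB].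
    by move=> ->; exists y, z.
  apply/seteqP; split=> [x Nx|]; last first.
    apply: (@sumset_sub K Kh) => // _ [r Or ->]; exact: NZ.
  have [z [L'z Nz Mxz]] := c2 _ Nx.
  have [r Or Lz] := L'E _ L'z.
  exists (x - r *: y), (r *: y); split; [|by exists r|by rewrite subrK].
  rewrite -(subrKA z); apply: MD => //; apply: c3.
    have -> : z - r *: y = (z - r *: b) + r *: (b - y) by rewrite scalerBr addrA subrK.
    by apply: LD => //; exact: LZ.
  by apply: submodB => //; exact: NZ.
move=> M2 N2 t3 t4 sM2 sN2 tr.
have [y' [L'y' Ny' N2y' Lby']] := tr _ L'b.
have By' := Bb _ Lby'; have [_ M2D _] := sM2.
apply/seteqP; split=> _ [x [z [[Bx N2x] M2z ->]]].
  exists y', ((x - y') + z); split=> //; last by rewrite addrA [y' + _]addrC subrK.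
  apply: M2D => //; apply: t3; last exact: submodB.
  move: Bx => [b1 [m1 [[Bb1 Nb1] Mm1 ->]]]; rewrite addrAC; apply: MD => //.
  by apply: c3; [exact: BP|exact: submodB].
exists y', ((x - y') + z); split=> //; last by rewrite addrA [y' + _]addrC subrK.
  by split=> //; exists y', 0; rewrite addr0.
by apply: M2D => //; apply: t4; [exact: BP|exact: submodB].
Qed.

Lemma mv_point (P : pt) M N : @is_point0 R K n M N -> compat (pL P) (pL' P) M N ->
  exists Q : pt, [/\ mv P M N = << Q >>, pL Q = M, pL' Q = N &
    forall M2 N2, (forall x, M x -> N2 x -> M2 x) -> (forall x, pL P x -> N2 x -> M2 x) ->
      submod M2 -> submod N2 ->
     (forall x, pL' P x -> exists y, [/\ pL' P y, N y, N2 y & pL P (x - y)]) ->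
     mv Q M2 N2 = mv P M2 N2].
Proof.
move: P; rewrite /mv /pL /pL'; case: m => P pMN.
  move=> _; exists (Point0 pMN); split=> //; rewrite /basis0.
  by case: pselect => // h; congr << _ >>; congr Point0; exact: Prop_irrelevance.
case: P => L L' B hP /= c; have [h h2] := point1_move hP pMN c.
exists (Point1 h); split=> //.
  by rewrite /basis1; case: pselect => // h'; congr << _ >>; congr Point1;
    exact: Prop_irrelevance.
by move=> M2 N2 t3 t4 sM2 sN2 tr /=; congr basis1; exact: h2.
Qed.

Lemma point1_in (L L' B : set Kh) : @is_point1 R K n L L' B -> B `<=` L' /\ sumset B L = B.
Proof.
move=> hP; have [b [L'b BE _]] := point1_coset hP.
have [[laL laL' LL' cyL] _] := hP.
have [L0 LD LZ] := lattice_submod laL; have [_ L'D _] := lattice_submod laL'.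
split=> [x /BE Lx|]; first by rewrite -(subrK b x); apply: L'D => //; exact: LL'.
apply/seteqP; split=> [_ [x [z [/BE Bx Lz ->]]]|x Bx]; last by exists x, 0; rewrite addr0.
by apply/BE; rewrite addrAC; exact: LD.
Qed.

Lemma mv_id (P : pt) : mv P (pL P) (pL' P) = << P >>.
Proof.
have := pointP P; move: P; rewrite /mv /pL /pL'; case: m => P pLL.
  rewrite /basis0; case: pselect => // h; congr << _ >>; case: P {pLL} h => L L' h h'.
  by congr Point0; exact: Prop_irrelevance.
case: P pLL => L L' B h [laL laL' LL' _] /=.
have [BL' BL] := point1_in h.
have -> : sumset (B `&` L') L = B.
  by rewrite (_ : B `&` L' = B) //; apply/seteqP; split=> [x []|x Bx] //; split=> //; exact: BL'.
rewrite /basis1; case: pselect => // h'; congr << _ >>.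
by congr Point1; exact: Prop_irrelevance.
Qed.

Lemma heckeT_basis a (P : pt) : heckeT R n m a << P >> =
  (intnorm a)%:R^-1 *: \sum_(M \in hecke_lattices n a (pL P) (pL' P)) mv P M (sumset M (pL' P)).
Proof.
move: P; rewrite /heckeT /mv /pL /pL'; case: m => P; first by rewrite lextend_basis.
rewrite lextend_basis; congr (_ *: _); apply: eq_fsbigr => M.
rewrite inE => -[laM LM _ _]; congr basis1; congr sumset.
case: P LM => L L' B hP /= LM; have [BL' _] := point1_in hP.
(* T_a uses the whole coset B; it lies in L', so intersecting with M + L' leaves it unchanged and
   the operator has the common form [mv]. *)
apply/seteqP; split=> [x Bx|x []//]; split=> //.
by apply: (@sumsetr K Kh M L' (lattice_submod laM)); exact: BL'.
Qed.

Lemma heckeTT_basis (a : fracideal_coprime n) (P : pt) : heckeTT R m a << P >> =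
  fracnorm a ^- 2 *: mv P (idscale (idinv a) (pL P)) (idscale (idinv a) (pL' P)).
Proof. by move: P; rewrite /heckeTT /mv /pL /pL'; case: m => P; rewrite lextend_basis. Qed.

End Points.

(** * Hecke relations *)

Section Norms.
Variable K : fieldExtType rat.
Implicit Types (I a : set K).
Local Notation O := (ringInt : set K).

Lemma intnorm_neq0 I : is_intideal I -> (intnorm I)%:R != 0 :> rat.
Proof.
move=> [sI [x Ix x0] IO].
have [I0 ID IM] := sI.
have [s sO sP] := finquot_in (U := K^o) (@submod_ringInt K) IO (finquot_ideal sI Ix x0).
(* [fset_set] of an infinite set is empty, so the norm is nonzero only thanks to the finiteness of
   O/I. *)
have fin : finite_set [set sumset [set x] I | x in O].
  apply: (@sub_finite_set _ _ ((fun y => sumset [set y] I) @` [set` s])).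
    move=> _ [z Oz <-]; have [y ys Iy] := sP _ Oz; exists y => //.
    apply/seteqP; split=> _ [_ [w [-> Iw ->]]].
      exists z, (w - (z - y)); split=> //; last by ring.
      exact: (@submodB _ K^o).
    exists y, ((z - y) + w); split=> //; last by ring.
    exact: ID.
  exact/finite_image/finite_seq.
rewrite pnatr_eq0 /intnorm cardfs_eq0; apply/negP => /eqP E.
have : sumset [set 1] I \in fset_set [set sumset [set x] I | x in O].
  by rewrite in_fset_set // inE; exists 1 => //; exact: ringInt1.
by rewrite E inE.
Qed.

Lemma fracnorm_neq0 a : is_fracideal a -> fracnorm a != 0.
Proof.
move=> fa; have [sa [x ax x0] [d [Od d0 dP]]] := fa.
have ip : is_intideal (principal d).
  by apply: intideal_of_frac; [exact: principal_frac|move=> _ [y Oy <-]; exact: ringIntM].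
have ib : is_intideal (idmul a (principal d)).
  apply: intideal_of_frac; first exact: fracidealM fa (principal_frac d0).
  by rewrite idmulC idmul_principal // => _ [y ay <-]; exact: dP.
(* [fracnorm] is an [xget] with default value 0, so a presentation of a as b/c must be exhibited: c
   = dO for a denominator d of a. *)
have ex : exists q : rat, exists b c, [/\ is_intideal b, is_intideal c, idmul a c = b
                               & q = (intnorm b)%:R / (intnorm c)%:R].
  by eexists; exists (idmul a (principal d)), (principal d).
rewrite /fracnorm; case: xgetP => [q _ [b [c [ib' ic _ ->]]]|nex].
  by rewrite mulf_neq0 ?invr_eq0 ?intnorm_neq0.
by case: ex => q hq; case: (nex q).
Qed.

End Norms.

(** * The lattices in a Hecke sum *)

Section HeckeLattices.
Variables (R : realType) (K : fieldExtType rat) (n : intideal K).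
Local Notation Kh := (Kh2 R K).
Local Notation O := (ringInt : set K).
Implicit Types (L M N : set Kh) (u v : Kh).

Let i_n : is_intideal n := intidealP n.

Definition pbasis L L' u v := [/\ indep u v, lat u v L & lat u v L'].

Lemma pbasis_exists L L' : @is_point0 R K n L L' -> exists u v, pbasis L L' u v.
Proof.
move=> [laL laL' LL' _]; have [u [v [uv lL]]] := lattice_lat laL.
by exists u, v; split=> //; exact: lat_super uv lL laL' LL'.
Qed.

(** In the coordinates of a basis of KL the conditions become being a lattice of the plane, an
    equation of determinant ideals, and M meeting L' in L. In this form they can be followed along
    chains and under scaling. *)
Lemma hecke_latticesP (a : set K) L L' u v M : is_intideal a -> @is_point0 R K n L L' ->
  pbasis L L' u v -> hecke_lattices n a L L' M <->
  [/\ lat u v M, L `<=` M, vol u v L = idmul a (vol u v M) & forall x, M x -> L' x -> L x].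
Proof.
move=> ia [laL laL' LL' cyL] [uv lL lL'].
have sL := lat_submod lL; have sL' := lat_submod lL'.
split=> [[laM LM ind cyM]|[lM LM vE lev]].
  have lM := lat_super uv lL laM LM; have sM := lat_submod lM.
  split=> //; first exact/(index_vol uv lL lM LM ia).
  exact/(cyclic_level i_n sL sL' sM LL' LM cyL).
have sM := lat_submod lM.
split=> //; first exact: lat_lattice uv laL lL lM.
  exact/(index_vol uv lL lM LM ia).
exact/(cyclic_level i_n sL sL' sM LL' LM cyL).
Qed.

Lemma index_bound u v L M (a : set K) : indep u v -> lat u v L -> lat u v M -> L `<=` M ->
  index_in M L a -> sprod a M `<=` L.
Proof.
move=> uv lL lM LM; have [g [h [ig ih hg st]]] := stacked_exists uv lL lM LM.
move/(index_stacked _ uv ig ih hg st) => ->; move: st => [p [q [c [d [J [I [D fJ fI -> ->]]]]]]].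
have [sg sh sJ sI] := And4 (intideal_submod ig) (intideal_submod ih) (fracideal_submod fJ)
  (fracideal_submod fI).
rewrite sprod_dsum //; last exact: idmul_submod.
apply: dsumS; apply: idmulS => //; last exact: idmul_int_sub.
by rewrite idmulC; exact: idmul_int_sub.
Qed.

Lemma intermediates_finite u v L M : indep u v -> lat u v L -> lat u v M -> L `<=` M ->
  finite_set [set X | [/\ submod X, L `<=` X & X `<=` M]].
Proof.
move=> uv lL lM LM; apply: finquot_intermediate; last by case: lL.
exact: lat_finquot uv lL lM LM.
Qed.

(** If [M : L] = a, then aM lies in L, so M lies between L and a^-1 L. Finiteness gives the Hecke
    sums their meaning: over an infinite support they would default to 0. *)
Lemma hecke_lattices_finite (a : set K) L L' : is_intideal a -> @is_point0 R K n L L' ->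
  finite_set (hecke_lattices n a L L' : set (set Kh)).
Proof.
move=> ia pt; have [u [v pb]] := pbasis_exists pt; have [uv lL lL'] := pb.
have fa := intideal_frac ia; have fV := fracideal_inv fa.
have [sa sV] := (fracideal_submod fa, fracideal_submod fV).
have sL := lat_submod lL.
have Lsub : L `<=` sprod (idinv a) L by exact: sprod_idinv_sub.
apply: sub_finite_set (intermediates_finite uv lL (lat_scale uv lL fV) Lsub) => M hM.
have [lM LM vE lev] := proj1 (hecke_latticesP M ia pt pb) hM.
have sM := lat_submod lM; split=> //.
have ind : index_in M L a by exact/(index_vol uv lL lM LM ia).
have := index_bound uv lL lM LM ind => aML.
rewrite -[X in X `<=` _](sprodO sM) -(idmul_idinv fV) idinvK // sprodA //.
exact: sprodS.
Qed.

Lemma point0_scale L L' (a : set K) : @is_point0 R K n L L' -> is_fracideal a ->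
  @is_point0 R K n (sprod a L) (sprod a L').
Proof.
move=> pt fa; have [u [v [uv lL lL']]] := pbasis_exists pt; have [laL laL' LL' cyL] := pt.
have [sL sL' sa] := And3 (lat_submod lL) (lat_submod lL') (fracideal_submod fa).
have [saL saL'] := (sprod_submod L sa, sprod_submod L' sa).
split.
- exact: lat_lattice uv laL lL (lat_scale uv lL fa).
- exact: lat_lattice uv laL lL (lat_scale uv lL' fa).
- by apply: (@sprodS K Kh).
- have q := qiso_scale uv lL lL' LL' fa.
  exact: (@qiso_trans K Kh Kh K^o _ _ _ _ _ _ saL' saL sL' sL (intideal_submod i_n) (qiso_sym
    sL' sL saL saL' q) cyL).
Qed.

Lemma point0_sum (a : set K) L L' M : @is_point0 R K n L L' -> is_intideal a ->
  hecke_lattices n a L L' M -> @is_point0 R K n M (sumset M L').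
Proof.
move=> pt ia hM; have [u [v pb]] := pbasis_exists pt; have [uv lL lL'] := pb.
have [laL laL' LL' cyL] := pt.
have [lM LM vE lev] := proj1 (hecke_latticesP M ia pt pb) hM.
have [laM _ _ cyM] := hM.
split=> //; last by apply: (@sumsetl K Kh); exact: lat_submod lL'.
exact: lat_lattice uv laL lL (lat_sumset lM lL').
Qed.

Lemma point0_ann L L' : @is_point0 R K n L L' -> sprod n L' `<=` L.
Proof.
move=> [laL laL' _ cyL]; apply: (cyclic_ann i_n) => //; exact: lattice_submod.
Qed.

Definition mid (a b : set K) L M2 : set (set Kh) :=
  [set M | [/\ submod M, L `<=` M, M `<=` M2, index_in M L b & index_in M2 M a]].

Lemma vol_submod (u v : Kh) M : indep u v -> lat u v M -> is_submodK (vol u v M).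
Proof. by move=> uv lM; exact: fracideal_submod (vol_frac uv lM). Qed.

Lemma hecke_chain (a b : set K) L L' M M2 : is_intideal a -> is_intideal b ->
  @is_point0 R K n L L' ->
  (hecke_lattices n b L L' M /\ hecke_lattices n a M (sumset M L') M2) <->
  (hecke_lattices n (idmul a b) L L' M2 /\ mid a b L M2 M).
Proof.
move=> ia ib pt; have [u [v pb]] := pbasis_exists pt; have [uv lL lL'] := pb.
have [sL sL'] := (lat_submod lL, lat_submod lL').
have iab := intidealM ia ib; have [sa sb] := (intideal_submod ia, intideal_submod ib).
have [laL laL' LL' cyL] := pt.
split=> [[h1 h2]|[h1 [sM LM MM2 i1 i2]]].
  have ptM := point0_sum pt ib h1.
  have [lM LM vM levM] := proj1 (hecke_latticesP M ib pt pb) h1.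
  have sM := lat_submod lM.
  have pbM : pbasis M (sumset M L') u v by split=> //; exact: lat_sumset.
  have [lM2 MM2 vM2 levM2] := proj1 (hecke_latticesP M2 ia ptM pbM) h2.
  split; last first.
    by split=> //; [exact/(index_vol uv lL lM LM ib)|exact/(index_vol uv lM lM2 MM2 ia)].
  apply/(hecke_latticesP M2 iab pt pb); split=> //; first exact: subset_trans MM2.
    by rewrite vM vM2 -idmulA // [idmul b a]idmulC.
  by move=> x M2x L'x; apply: levM => //; apply: levM2 => //; exact: sumsetr.
have [lM2 LM2 vM2 levM2] := proj1 (hecke_latticesP M2 iab pt pb) h1.
have lM : lat u v M by exact: lat_between lL lM2 sM LM MM2.
have hM : hecke_lattices n b L L' M.
  apply/(hecke_latticesP M ib pt pb); split=> //; first exact/(index_vol uv lL lM LM ib).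
  by move=> x Mx L'x; apply: levM2 => //; exact: MM2.
split=> //; have ptM := point0_sum pt ib hM.
have pbM : pbasis M (sumset M L') u v by split=> //; exact: lat_sumset.
apply/(hecke_latticesP M2 ia ptM pbM); split=> //; first exact/(index_vol uv lM lM2 MM2 ia).
(* Modular law: M2 meets M + L' in M + (M2 ∩ L') = M + L = M. *)
move=> x M2x [y [z [My L'z E]]]; rewrite E in M2x *.
case: sM => _ MD _; apply: MD => //; apply: LM; apply: levM2 => //.
by rewrite -(addKr y z) addrC; apply: submodB => //; [exact: lat_submod lM2|exact: MM2].
Qed.

(** Passing from L to c^-1 L accounts for the index c^2. Because c is prime to n, meeting L' in L
    and meeting c^-1 L' in c^-1 L are equivalent for M2 containing c^-1 L. *)
Lemma hecke_scale (c d : set K) L L' M2 : is_intideal c -> idcoprime c n -> is_intideal d ->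
  @is_point0 R K n L L' ->
  hecke_lattices n d (sprod (idinv c) L) (sprod (idinv c) L') M2 <->
  (hecke_lattices n (idmul (idmul c c) d) L L' M2 /\ sprod (idinv c) L `<=` M2).
Proof.
move=> ic cc id_ pt; have [u [v pb]] := pbasis_exists pt; have [uv lL lL'] := pb.
have [sL sL'] := (lat_submod lL, lat_submod lL').
have fc := intideal_frac ic; have fV := fracideal_inv fc.
have [sc sV sd] := And3 (fracideal_submod fc) (fracideal_submod fV) (intideal_submod id_).
have icc := intidealM ic ic; have scc := intideal_submod icc.
have iccd := intidealM icc id_.
have ptV := point0_scale pt fV.
have pbV : pbasis (sprod (idinv c) L) (sprod (idinv c) L') u v by split=> //; exact: lat_scale.
have subV (X : set Kh) : submod X -> X `<=` sprod (idinv c) X by exact: sprod_idinv_sub.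
have [[x [y [cx ny E]]] cO] : (exists x y, [/\ c x, (n : set K) y & x + y = 1]) /\ c `<=` O.
  by split; [exact/(idcoprimeP i_n ic)|case: ic].
have cVX (X : set Kh) : submod X -> sprod c (sprod (idinv c) X) = X.
  by move=> sX; rewrite -sprodA // idmul_idinv // sprodO.
have volE (V : set K) (W : set K) : is_submodK V -> is_submodK W ->
    (idmul (idmul (idinv c) (idinv c)) V = idmul d W <-> V = idmul (idmul (idmul c c) d) W).
  move=> sVV sW; have fcc := fracidealM fc fc.
  rewrite -idinvM //; split=> [E1|->].
    by rewrite idmulA // -E1 -idmulA ?idmul_idinv ?idmulO //;
      exact/fracideal_submod/fracideal_inv.
  by rewrite [in LHS]idmulA // idmulK //; exact: idmul_submod.
split=> [h|[h VM]].
  have [lM LM vE lev] := proj1 (hecke_latticesP M2 id_ ptV pbV) h.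
  split=> //; apply/(hecke_latticesP M2 iccd pt pb); split=> //.
  - by apply: subset_trans LM; exact: subV.
  - by apply/volE; [exact: vol_submod|exact: vol_submod|rewrite -vE vol_scale].
  - move=> z Mz L'z; have Vz : sprod (idinv c) L z by apply: lev => //; exact: subV.
    have [_ LD _] := sL; rewrite -[z]scale1r -E scalerDl; apply: LD.
      by rewrite -(cVX L sL); exact: mem_sprod.
    by apply: (point0_ann pt); exact: mem_sprod.
have [lM LM vE lev] := proj1 (hecke_latticesP M2 iccd pt pb) h.
apply/(hecke_latticesP M2 id_ ptV pbV); split=> //.
  by rewrite vol_scale //; apply/volE => //; exact: vol_submod.
(* c z lies in M2 and in L', hence in L; so z lies in c^-1 L. *)
move=> z Mz Vz.
have h1 t : c t -> L (t *: z).
  move=> ct; apply: lev; first by have [_ _ MM] := lat_submod lM; apply: MM => //; exact: cO.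
  by rewrite -(cVX L' sL'); exact: mem_sprod.
have : idmul (idinv c) c 1 by rewrite idmulC idmul_idinv //; exact: ringInt1.
move=> [k [p [q [Vp cq E1]]]]; rewrite -[z]scale1r E1 scaler_suml.
apply: submod_sum => [|i _]; first exact: sprod_submod.
by rewrite -scalerA; apply: mem_sprod => //; exact: h1.
Qed.

End HeckeLattices.

(** * Composites of two Hecke operators *)

Section Compositions.
Variables (R : realType) (K : fieldExtType rat) (n : intideal K) (m : modpoints).
Local Notation Kh := (Kh2 R K).
Local Notation pt := (Defs.point m R n).
Local Notation O := (ringInt : set K).
Implicit Types (L M N : set Kh) (u v : Kh) (P Q : pt).

Let i_n : is_intideal n := intidealP n.

Definition mid_count (a b : set K) L M2 : rat := \sum_(M \in mid a b L M2) (1 : rat).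

Lemma sumsetA_absorb L' M M2 : submod L' -> submod M -> submod M2 -> M `<=` M2 ->
  sumset M2 (sumset M L') = sumset M2 L'.
Proof.
move=> sL' sM sM2 MM2; have sS := sumset_submod sM2 sL'; have sS' := sumset_submod sM sL'.
have M2S : M2 `<=` sumset M2 L' by exact: sumsetl.
apply/seteqP; split.
  apply: (sumset_sub sS) => //; apply: (sumset_sub sS); last exact: sumsetr.
  exact: subset_trans M2S.
apply: (sumset_sub (sumset_submod sM2 sS')); first exact: sumsetl.
apply: subset_trans (sumsetr sM2); exact: sumsetr.
Qed.

Lemma mv_hecke (a : set K) P M : is_intideal a -> hecke_lattices n a (pL P) (pL' P) M ->
  exists Q : pt, [/\ mv P M (sumset M (pL' P)) = << Q >>, pL Q = M, pL' Q = sumset M (pL' P) &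
    forall M2, submod M2 -> M `<=` M2 ->
      mv Q M2 (sumset M2 (pL' Q)) = mv P M2 (sumset M2 (pL' P))].
Proof.
move=> ia hM; have pP := pointP P; have [laL laL' LL' cyL] := pP.
have [u [v pb]] := pbasis_exists pP; have [uv lL lL'] := pb.
have [lM LM vM lev] := proj1 (hecke_latticesP M ia pP pb) hM.
have [sL sL' sM] := And3 (lat_submod lL) (lat_submod lL') (lat_submod lM).
have [Q [EQ QL QL' hQ]] := mv_point (point0_sum pP ia hM) (compat_sum sL sL' sM LL' lev LM).
exists Q; split=> // M2 sM2 MM2; rewrite QL' sumsetA_absorb //; apply: hQ => //.
- by move=> x Mx _; exact: MM2.
- by move=> x Lx _; apply: MM2; exact: LM.
- exact: sumset_submod.
- by move=> x L'x; exists x; rewrite subrr; split=> //; [exact: sumsetr|exact: sumsetr|case: sL].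
Qed.

Lemma fsumZ (V : lmodType rat) (I : choiceType) (A : set I) (q : rat) (F : I ->
  V) : finite_set A ->
  q *: (\sum_(i \in A) F i) = \sum_(i \in A) q *: F i.
Proof. by move=> fA; rewrite !fsbig_finite //= scaler_sumr. Qed.

Lemma fsum_scalel (V : lmodType rat) (I : choiceType) (A : set I) (q : I ->
  rat) (x : V) : finite_set A ->
  (\sum_(i \in A) q i) *: x = \sum_(i \in A) q i *: x.
Proof. by move=> fA; rewrite !fsbig_finite //= scaler_suml. Qed.

(** An index set that depends on an outer variable is replaced by an indicator on a fixed set, so
    that two sums can be exchanged and compared term by term. *)
Lemma fsum_sub (V : lmodType rat) (I : choiceType) (A B : set I) (F : I -> V) (p : I -> Prop) :
  finite_set B -> A = [set x | B x /\ p x] ->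
  \sum_(i \in A) F i = \sum_(i \in B) (`[< p i >])%:R *: F i.
Proof.
move=> fB AE; rewrite (eq_fsbigr (fun i => (`[< p i >])%:R *: F i)); last first.
  by move=> i; rewrite inE AE => -[_ pi]; rewrite asboolT // scale1r.
apply: fsbig_widen; first by move=> x; rewrite AE => -[].
move=> x /= [Bx nAx]; rewrite asboolF ?scale0r // => px; apply: nAx.
by rewrite AE.
Qed.

Lemma heckeT_comp (a b : intideal K) P :
  heckeT R n m a (heckeT R n m b << P >>) =
  ((intnorm a)%:R^-1 * (intnorm b)%:R^-1) *:
    \sum_(M2 \in hecke_lattices n (idmul a b) (pL P) (pL' P))
       mid_count a b (pL P) M2 *: mv P M2 (sumset M2 (pL' P)).
Proof.
have [ia ib] := (intidealP a, intidealP b); have iab := intidealM ia ib.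
have pP := pointP P; have [u [v pb]] := pbasis_exists pP.
have fA := hecke_lattices_finite iab pP; have fB := hecke_lattices_finite ib pP.
set G := fun M2 => mv P M2 (sumset M2 (pL' P)).
rewrite heckeT_basis lendZ lend_fsum //.
rewrite (eq_fsbigr (fun M => (intnorm a)%:R^-1 *:
    \sum_(M2 \in hecke_lattices n (idmul a b) (pL P) (pL' P)) (`[< mid a b (pL P) M2 M >])%:R *:
      G M2)); last first.
  move=> M; rewrite inE => hM; have [Q [-> QL QL' hQ]] := mv_hecke ib hM.
  rewrite heckeT_basis QL QL'; congr (_ *: _).
  rewrite -(@fsum_sub _ _ (hecke_lattices n a M (sumset M (pL' P)))) //; last first.
    by apply/seteqP; split=> M2; [move=> h;
      apply/(hecke_chain M M2 ia ib pP)|move/(hecke_chain M M2 ia ib pP) => -[]].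
  apply: eq_fsbigr => M2; rewrite inE => hM2; rewrite -QL' hQ //.
    by case: hM2 => /lattice_submod.
  by case: hM2.
rewrite -fsumZ // scalerA mulrC; congr (_ *: _).
rewrite exchange_fsbig //; apply: eq_fsbigr => M2; rewrite inE => hM2.
rewrite -fsum_scalel //; congr (_ *: _).
rewrite /mid_count (@fsum_sub rat^o _ _ (hecke_lattices n b (pL P) (pL' P)) (fun=> 1) (mid a b
  (pL P) M2)) //.
  by apply: eq_fsbigr => M _; rewrite /GRing.scale /= mulr1.
by apply/seteqP; split=> M h; [split=> //;
  apply: proj1 (proj2 (hecke_chain M M2 ia ib pP) (conj hM2 h))|case: h].
Qed.

Lemma heckeTT_move (a : fracideal_coprime n) P :
  let aL := sprod (idinv a) (pL P) in let aL' := sprod (idinv a) (pL' P) in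
  exists Q : pt, [/\ heckeTT R m a << P >> = fracnorm a ^- 2 *: << Q >>, pL Q = aL, pL' Q = aL' &
    forall M2 N2, (forall x, aL x -> N2 x -> M2 x) -> (forall x, pL P x -> N2 x -> M2 x) ->
      submod M2 -> submod N2 ->
     (forall x, pL' P x -> exists y, [/\ pL' P y, aL' y, N2 y & pL P (x - y)]) ->
     mv Q M2 N2 = mv P M2 N2].
Proof.
move=> aL aL'; have pP := pointP P; have [laL laL' LL' cyL] := pP.
have ca := fracideal_coprimeP a; have fV := fracideal_inv (proj1 ca).
have cc := compat_scale i_n (lattice_submod laL) (lattice_submod laL') (point0_ann pP) ca.
have [Q [EQ QL QL' hQ]] := mv_point (point0_scale pP fV) cc.
by exists Q; split=> //; rewrite heckeTT_basis -EQ.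
Qed.

(** Inverse ideals multiply, so both sides move a point to the same place; the factor q is the
    quotient of the norm factors of the three operators. *)
Lemma heckeTT_comp (a b ab : fracideal_coprime n) : ab = idmul b a :> set K ->
  exists2 q : rat, q != 0 & forall P,
    heckeTT R m a (heckeTT R m b << P >>) = q *: heckeTT R m ab << P >>.
Proof.
move=> abE; have [ca cb cab] := And3 (fracideal_coprimeP a) (fracideal_coprimeP b)
  (fracideal_coprimeP ab).
have [fa fb fab] := And3 (proj1 ca) (proj1 cb) (proj1 cab).
have [na nb nab] := And3 (fracnorm_neq0 fa) (fracnorm_neq0 fb) (fracnorm_neq0 fab).
exists (fracnorm b ^- 2 * fracnorm a ^- 2 * fracnorm ab ^+ 2).
  by rewrite !mulf_neq0 // ?invr_eq0 expf_neq0.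
move=> P; have pP := pointP P; have [laL laL' LL' cyL] := pP.
have [sL sL'] := (lattice_submod laL, lattice_submod laL').
have [Q [-> QL QL' hQ]] := heckeTT_move b P.
have [sVa sVb] := (fracideal_submod (fracideal_inv fa), fracideal_submod (fracideal_inv fb)).
rewrite lendZ !heckeTT_basis QL QL' !scalerA mulfK ?expf_neq0 //.
congr (_ *: _).
have E (X : set Kh) : idscale (idinv a) (sprod (idinv b) X) = sprod (idinv ab) X :> set Kh.
  by rewrite abE idinvM // [idmul (idinv b) _]idmulC sprodA.
rewrite !E; apply: hQ.
- have [laQ laQ' _ _] := pointP Q.
  have [_ _] := compat_scale i_n (lattice_submod laQ) (lattice_submod laQ') (point0_ann (pointP
    Q)) ca.
  by rewrite QL QL' -!E.
- by have [] := compat_scale i_n sL sL' (point0_ann pP) cab.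
- by apply: sprod_submod; exact/fracideal_submod/fracideal_inv.
- by apply: sprod_submod; exact/fracideal_submod/fracideal_inv.
- by rewrite abE; apply: (compat_scale2 i_n sL sL' (point0_ann pP) cb ca).
Qed.

Lemma heckeT_TT (c : fracideal_coprime n) (d : intideal K) : is_intideal c -> idcoprime c n ->
  exists2 q : rat, q != 0 & forall P, heckeT R n m d (heckeTT R m c << P >>) = q *:
    \sum_(M2 \in hecke_lattices n (idmul (idmul c c) d) (pL P) (pL' P))
       (`[< sprod (idinv c) (pL P) `<=` M2 >])%:R *: mv P M2 (sumset M2 (pL' P)).
Proof.
move=> ic cc; have [id_ icc] := (intidealP d, intidealM ic ic); have iccd := intidealM icc id_.
exists (fracnorm c ^- 2 * (intnorm d)%:R^-1).
  by rewrite mulf_neq0 // invr_eq0 ?expf_neq0 ?intnorm_neq0 // fracnorm_neq0 //;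
    exact: intideal_frac.
move=> P; have pP := pointP P; have [laL laL' LL' cyL] := pP.
have [sL sL'] := (lattice_submod laL, lattice_submod laL').
have [Q [-> QL QL' hQ]] := heckeTT_move c P.
have fV := fracideal_inv (intideal_frac ic); have sV := fracideal_submod fV.
have [svL svL'] := (sprod_submod (pL P) sV, sprod_submod (pL' P) sV).
rewrite lendZ heckeT_basis QL QL' scalerA; congr (_ *: _).
rewrite -(@fsum_sub _ _ (hecke_lattices n d (sprod (idinv c) (pL P)) (sprod (idinv c) (pL'
  P)))); last 2 first.
- exact: hecke_lattices_finite.
- by apply/seteqP; split=> M2 /(hecke_scale M2 ic cc id_ pP).
apply: eq_fsbigr => M2; rewrite inE => hM2.
have [laM VM _ _] := hM2; have sM := lattice_submod laM.
have subV (X : set Kh) : submod X -> X `<=` sprod (idinv c) X by exact: sprod_idinv_sub.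
(* With x + y = 1, x in c and y in n, an element z of c^-1 L' is y z + x z, where y z lies in c^-1
   L, hence in M2, and x z lies in L'. *)
have SE : sumset M2 (sprod (idinv c) (pL' P)) = sumset M2 (pL' P).
  have [sS sS'] := (sumset_submod sM sL', sumset_submod sM svL').
  apply/seteqP; split.
    apply: (sumset_sub sS); first exact: sumsetl.
    have [x [y [cx ny E]]] := proj1 (idcoprimeP i_n ic) cc.
    move=> z Vz; exists (y *: z), (x *: z); split.
    - apply: VM; have := point0_ann pP => nL.
      apply: (@sprodS _ _ (idinv c) (idinv c) (sprod n (pL' P)) (pL P)) => //.
      rewrite -sprodA //; last exact: intideal_submod.
      by rewrite [idmul _ n]idmulC sprodA //; [exact: mem_sprod|exact: intideal_submod].
    - rewrite -(sprodO sL') -(idmul_idinv (intideal_frac ic)) sprodA //;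
      last exact: intideal_submod.
      exact: mem_sprod.
    - by rewrite -scalerDl addrC E scale1r.
  apply: (sumset_sub sS'); first exact: sumsetl.
  exact: subset_trans (subV _ sL') (sumsetr sM).
rewrite SE; apply: hQ => //.
- by move=> x Vx _; exact: VM.
- by move=> x Lx _; apply: VM; exact: subV.
- exact: sumset_submod.
- by move=> x L'x; exists x; rewrite subrr; split=> //;
  [exact: subV|exact: (@sumsetr K Kh M2 (pL' P) sM _ L'x)|case: sL].
Qed.

End Compositions.

Lemma lend_sumE (V : lmodType rat) I (r : seq I) (p : pred I) (F : I -> lend V) (v : V) :
  (\sum_(i <- r | p i) F i : lend V) v = \sum_(i <- r | p i) F i v.
Proof. by elim/big_rec2: _ => // i x T _ <-. Qed.

Lemma subset_minimal (T : Type) (s : seq (set T)) : s != [::] ->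
  exists2 t0, t0 \in s & forall t, t \in s -> t `<=` t0 -> t = t0.
Proof.
elim: s => // x s IH _; have [->|/IH[t0 t0s t0min]] := eqVneq s [::].
  by exists x; rewrite ?inE // => t; rewrite inE => /eqP.
have [xt0|nxt0] := pselect (x `<=` t0).
  exists x; first by rewrite inE eqxx.
  move=> t; rewrite inE => /orP[/eqP //|ts tx].
  have tE := t0min _ ts (subset_trans tx xt0).
  by apply/seteqP; split=> //; rewrite tE.
exists t0; first by rewrite inE t0s orbT.
by move=> t; rewrite inE => /orP[/eqP->|]; [move/nxt0|exact: t0min].
Qed.

(** The inclusion matrix is unitriangular in any order refining inclusion. A minimal t0 contains no
    other member of s, so its column affects the row of t0 only, and the value at t0 can be
    corrected after the other members have been treated. *)
Lemma moebius_inversion (T : Type) (s : seq (set T)) (k : set T -> rat) : uniq s ->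
  exists q : set T -> rat, forall t, t \in s -> k t = \sum_(g <- s) (`[< t `<=` g >])%:R * q g.
Proof.
have [N] := ubnP (size s); elim: N s => // N IH s sN us.
have [->|s0] := eqVneq s [::]; first by exists (fun=> 0).
have [t0 t0s t0min] := subset_minimal s0.
have [||q' q'P] := IH (rem t0 s).
- by rewrite size_rem // prednK // lt0n size_eq0.
- exact: rem_uniq.
exists (fun g => if g == t0 then k t0 - \sum_(g <- rem t0 s) (`[< t0 `<=` g >])%:R * q' g else
  q' g).
move=> t ts; rewrite (perm_big _ (perm_to_rem t0s)) /= big_cons eqxx.
have nt0 : t0 \notin rem t0 s by rewrite mem_rem_uniqF.
rewrite [X in _ + X](eq_big_seq (fun g => (`[< t `<=` g >])%:R * q' g)); last first.
  by move=> g gs /=; case: ifP => // /eqP gE; rewrite gE in gs; rewrite gs in nt0.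
have [->|tt0] := eqVneq t t0; first by rewrite asboolT // mul1r subrK.
rewrite asboolF; last by move=> /(t0min _ ts) /eqP; rewrite (negbTE tt0).
by rewrite mul0r add0r q'P // mem_rem_uniq // inE tt0.
Qed.

(** * The Hecke relation for T_a T_b *)

Section HeckeRelation.
Variables (R : realType) (K : fieldExtType rat) (n : intideal K) (m : modpoints).
Local Notation Kh := (Kh2 R K).
Local Notation pt := (Defs.point m R n).
Local Notation O := (ringInt : set K).
Implicit Types (L M N : set Kh) (u v : Kh) (P Q : pt).

Let i_n : is_intideal n := intidealP n.

Lemma index_qiso (U V : lmodType K) (M L : set U) (M' L' : set V) a : submod M -> submod L ->
  submod M' -> submod L' -> qiso M L M' L' -> index_in M L a -> index_in M' L' a.
Proof.
move=> sM sL sM' sL' q [a1 [a2 [qa E]]]; exists a1, a2; split=> //.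
have sO := @submod_ringInt K.
have sa := setX_submod (intideal_submod (intidealP a1)) (intideal_submod (intidealP a2)).
exact: (qiso_trans sM' sL' sM sL sa (qiso_sym sM sL sL' sM' q) qa).
Qed.

(** Pulling back along f is a bijection between the modules counted on the two sides and preserves
    both indices, so the count is an invariant of the module M/L. *)
Lemma mid_count_qmap (a b : set K) (f : Kh -> Kh) L M L' M' : submod M -> submod L ->
  submod M' -> submod L' -> L `<=` M -> L' `<=` M' -> qmap f M L M' L' ->
  mid_count a b L M = mid_count a b L' M'.
Proof.
move=> sM sL sM' sL' LM LM' fq; rewrite /mid_count.
apply: (@reindex_fsbig _ _ _ _ _ (qpull f M)).
have pull N : submod N -> L' `<=` N -> N `<=` M' ->
    [/\ submod (qpull f M N), index_in N L' b <-> index_in (qpull f M N) L b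
      & index_in M' N a <-> index_in M (qpull f M N) a].
  move=> sN LN NM; have sq := qpull_submod sM fq sN LN.
  have q1 : qiso (qpull f M N) L N L'.
    by apply/qisoP => //; exists f; exact: (qmap_pull_bottom fq).
  have q2 : qiso M (qpull f M N) M' N.
    by apply/qisoP => //; exists f; exact: (qmap_pull_top sM sL' fq).
  split=> //; split; apply: index_qiso => //; exact: qiso_sym.
split.
- move=> N [sN LN NM i1 i2]; have [sq e1 e2] := pull N sN LN NM.
  by split; [exact: sq|exact: (qpull_sub sM sL' LM fq LN)|exact: qpull_le|exact/e1|exact/e2].
- move=> N1 N2; rewrite !inE => -[s1 L1 M1 _ _] [s2 L2 M2 _ _]; exact: (qpull_inj fq).
- move=> X [sX LX XM i1 i2]; have [N [sN LN NM E]] := qpull_surj sM sM' sL' LM' fq sX LX XM.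
  have [sq e1 e2] := pull N sN LN NM; exists N => //.
  by split=> //; [apply/e1; rewrite E|apply/e2; rewrite E].
Qed.

(* M/L is isomorphic to O/g + O/h, with h contained in g and gh = e. *)
Definition type_of (e : set K) L M (g : set K) : Prop := exists u v h,
  [/\ indep u v, is_intideal g, is_intideal h & h `<=` g] /\
  [/\ L `<=` M, idmul g h = e & stacked u v L M g h].

Lemma mid_count_type (a b : set K) e L M L' M' g :
  type_of e L M g -> type_of e L' M' g -> mid_count a b L M = mid_count a b L' M'.
Proof.
move=> [u [v [h [[uv ig ih _] [LM ghE st]]]]] [u' [v' [h' [[uv' _ ih' _] [LM' ghE' st']]]]].
have hE : h = h'.
  apply: (idmul_inj (intideal_frac ig)); rewrite ?ghE ?ghE' //; exact: intideal_submod.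
rewrite -hE in st'; have [f hf] := stacked_iso uv uv' ig ih st st'.
have [sL sM] := stacked_submod ig ih st; have [sL' sM'] := stacked_submod ig ih st'.
exact: (mid_count_qmap _ _ sM sL sM' sL' LM LM' hf).
Qed.

Lemma cyclic_faithful L L' : @is_point0 R K n L L' ->
  exists2 b, L' b & forall r, ringInt r -> L (r *: b) -> (n : set K) r.
Proof.
move=> [/lattice_submod sL /lattice_submod sL' LL' /(cyclicP i_n sL' sL)[f hf]].
have [fD fL fK fS] := hf; have [_ nD nM] := intideal_submod i_n; have [M0 MD MM] := sL'.
have [b L'b n1] := fS 1 (@ringInt1 K); exists b => // r Or Lrb.
have [h1 h0] := qmap_cyclic_scale i_n sL' sL hf Or L'b.
have h2 : (n : set K) (f (r *: b)).
  rewrite -[f _](subrK (f 0)); apply: nD => //; apply/fK; rewrite ?subr0 //.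
  exact: MM.
have -> : r = r * (1 - f b) + (f (r *: b) - (f (r *: b) - r * f b)) by ring.
apply: (nD); first exact: nM.
by apply: (@submodB _ K^o) => //; exact: intideal_submod.
Qed.

(* If g + n were a proper ideal s, then s^-1 L would contain elements of L'
   outside L, contradicting M \cap L' = L. *)
Lemma type_coprime e L L' M g : @is_point0 R K n L L' -> (forall x, M x -> L' x -> L x) ->
  type_of e L M g -> idcoprime g n.
Proof.
move=> ptL lev [u [v [h [[uv ig ih hg] [LM ghE st]]]]].
have [fg fn] := (intideal_frac ig, intideal_frac i_n).
have [sg sn] := (intideal_submod ig, intideal_submod i_n).
have [[_ _ gO] [_ _ nO]] := (ig, i_n).
pose s := sumset g n; have fs : is_fracideal s by exact: sumset_frac.
have sO : s `<=` O by apply: (@sumset_sub _ K^o) => //; exact: submod_ringInt.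
have is_ := intideal_of_frac fs sO; have fV := fracideal_inv fs; have sV := fracideal_submod fV.
have gs : g `<=` s by exact: (@sumsetl _ K^o).
have ns : (n : set K) `<=` s by exact: (@sumsetr _ K^o).
have sLM : sprod (idinv s) L `<=` M by apply/(stacked_scale_sub uv ig ih hg is_ st).
have nL := point0_ann ptL.
have [b L'b bP] := cyclic_faithful ptL; have sL' : submod L' by case: ptL => _ /lattice_submod.
have [_ _ L'Z] := sL'.
(* As n lies in s, s^-1 n L' lies in L'; as n L' lies in L, it lies in s^-1 L, hence in M. So it
   lies in L, and the multiples of b in L are those by elements of n. *)
have nVn : idmul (idinv s) n `<=` n.
  move=> r nr; have Or : ringInt r by apply: (proj2 (idmul_idinv_sub fs sn)) nr.
  apply: bP => //; apply: lev; last exact: L'Z.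
  apply: sLM; apply: (@sprodS _ _ (idinv s) (idinv s) (sprod n L') L) => //.
  by rewrite -sprodA //; exact: mem_sprod.
(* Cancel the invertible ideal n; s^-1 in O then gives s = O. *)
have VO : idinv s `<=` O.
  rewrite -(idmul_idinv fn) -[X in X `<=` _](idmulK fn sV) idmulC.
  by apply: idmulS => //; rewrite idmulC.
rewrite /idcoprime -/s; apply/seteqP; split=> // x Ox.
have : idmul s (idinv s) x by rewrite idmul_idinv.
move=> /(idmulS (@subset_refl _ s) VO); rewrite idmulC idmulO //; exact: fracideal_submod.
Qed.

(** The ideals g for which an operator T_d T_{g,g} with g^2 d = e is available. By [type_exists] the
    first elementary divisors arising in the sum for e are among them. *)
Definition square_divisors (e : set K) : set (set K) := [set g | [/\ is_intideal g, idcoprime g n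
  & exists2 d, is_intideal d & idmul (idmul g g) d = e]].

Lemma square_divisors_finite e : is_intideal e -> finite_set (square_divisors e).
Proof.
move=> ie; have [se [x ex x0] eO] := ie.
apply: sub_finite_set (@finquot_intermediate K K^o O e (finquot_ideal se ex x0) se).
move=> g [ig _ [d id_ E]]; have [sg _ gO] := ig; split=> //.
rewrite -E idmulA //; rewrite idmulC; apply: idmul_int_sub => //; exact: intidealM.
Qed.

Lemma type_exists (e : set K) P M2 : is_intideal e -> hecke_lattices n e (pL P) (pL' P) M2 ->
  exists2 g, type_of e (pL P) M2 g & square_divisors e g.
Proof.
move=> ie hM; have pP := pointP P; have [u [v pb]] := pbasis_exists pP; have [uv lL lL'] := pb.
have [lM LM vM lev] := proj1 (hecke_latticesP M2 ie pP pb) hM.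
have [g [h [ig ih hg st]]] := stacked_exists uv lL lM LM.
have ind : index_in M2 (pL P) e by exact/(index_vol uv lL lM LM ie).
have ghE := esym (proj1 (index_stacked e uv ig ih hg st) ind).
have tg : type_of e (pL P) M2 g by exists u, v, h.
exists g => //; split=> //; first exact: type_coprime pP lev tg.
exists (idmul (idinv g) h); first exact: idmul_inv_intideal.
have [fg sg] := (intideal_frac ig, intideal_submod ig).
rewrite idmulA // -{2}(idinvK fg) idmulK //; first exact: fracideal_inv.
exact: intideal_submod.
Qed.

Lemma heckeT_mul (a b : intideal K) : exists k (q : 'I_k -> rat)
    (c : 'I_k -> fracideal_coprime n) (d : 'I_k -> intideal K),
  (forall i, idmul (idmul (c i) (c i)) (d i) = idmul a b) /\
  heckeT R n m a * heckeT R n m b = \sum_i q i *: (heckeT R n m (d i) * heckeTT R m (c i)).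
Proof.
pose e := idmul a b; have ie : is_intideal e by apply: intidealM; exact: intidealP.
pose s : seq (set K) := fset_set (square_divisors e).
have sP g : g \in s <-> square_divisors e g.
  rewrite in_fset_set; last exact: square_divisors_finite.
  by rewrite inE.
(* The coefficient as a function of the type g alone, with value 0 at types that do not occur. *)
pose kap g := xget 0 [set q : rat | exists L M, type_of e L M g /\ q = mid_count a b L M].
have kapE L M g : type_of e L M g -> mid_count a b L M = kap g.
  move=> tg; rewrite /kap; case: xgetP => [q _ [L' [M' [tg' ->]]]|nex].
    exact: mid_count_type tg tg'.
  by case: (nex (mid_count a b L M)); exists L, M.
(* By inversion the coefficient at M2 is the sum of q c over the c in s with c^-1 L in M2; each of
   these indicators is, up to a nonzero factor r, the coefficient of M2 in one T_d T_{c,c}. *)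
have [q qP] := moebius_inversion kap (fset_uniq (fset_set (square_divisors e))).
rewrite -/s in qP.
have /choice[cd cdP] (i : 'I_(size s)) : exists cd : fracideal_coprime n * intideal K,
    cd.1 = (nth set0 s i) :> set K /\ idmul (idmul cd.1 cd.1) cd.2 = e.
  have [ig cg [d id_ E]] := proj1 (sP _) (mem_nth set0 (ltn_ord i)).
  by exists (FracIdealCoprime (coprime_int i_n ig cg), IntIdeal id_).
have /choice[r rP] (i : 'I_(size s)) : exists r : rat, r != 0 /\
   forall P, heckeT R n m (cd i).2 (heckeTT R m (cd i).1 << P >>) = r *:
    \sum_(M2 \in hecke_lattices n e (pL P) (pL' P))
       (`[< sprod (idinv (nth set0 s i)) (pL P) `<=` M2 >])%:R *: mv P M2 (sumset M2 (pL' P)).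
  have [cE E] := cdP i; have [ig cg _] := proj1 (sP _) (mem_nth set0 (ltn_ord i)).
  rewrite -cE in ig cg; have [r r0 rE] := @heckeT_TT R K n m _ (cd i).2 ig cg.
  by exists r; split=> // P; rewrite rE E cE.
pose C : rat := (intnorm a)%:R^-1 * (intnorm b)%:R^-1.
exists (size s), (fun i : 'I_(size s) => C * (q (nth set0 s i) * (r i)^-1)),
  (fun i => (cd i).1), (fun i => (cd i).2).
split=> [i|]; first by case: (cdP i).
apply: lend_ext => P.
rewrite lend_sumE.
transitivity (heckeT R n m a (heckeT R n m b << P >>)) => //.
rewrite heckeT_comp -/C -/e.
transitivity (\sum_(i < size s) (C * (q (nth set0 s i) / r i)) *: (heckeT R n m (cd i).2
  (heckeTT R m (cd i).1 << P >>))) => //.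
have fe := hecke_lattices_finite ie (pointP P).
rewrite (eq_bigr (fun i : 'I_(size s) => C *: \sum_(M2 \in hecke_lattices n e (pL P) (pL' P))
   (q (nth set0 s i) * (`[< sprod (idinv (nth set0 s i)) (pL P) `<=` M2 >])%:R) *: mv P M2
     (sumset M2 (pL' P)))); last first.
  move=> i _; have [r0 ->] := rP i; rewrite scalerA -mulrA divfK // -scalerA; congr (_ *: _).
  by rewrite fsumZ //; apply: eq_fsbigr => M2 _; rewrite scalerA.
rewrite -scaler_sumr; congr (_ *: _).
rewrite !fsbig_finite //= .
under [RHS]eq_bigr do rewrite fsbig_finite //=.
rewrite [RHS]exchange_big /=; rewrite !big_seq; apply: eq_bigr => M2.
rewrite in_fset_set // inE => hM; rewrite -scaler_suml; congr (_ *: _).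
have [g tg sg] := type_exists ie hM; rewrite (kapE _ _ _ tg) qP; last exact/sP.
rewrite (big_nth set0) big_mkord; apply: eq_bigr => i _; rewrite mulrC; congr (_ * _%:R).
have [ig _ _] := proj1 (sP _) (mem_nth set0 (ltn_ord i)).
move: tg => [u [v [h [[uv ig' ih hg] [LM ghE st]]]]].
by congr (nat_of_bool _); apply/asbool_equiv_eq; apply: iff_sym;
  exact: stacked_scale_sub uv ig' ih hg ig st.
Qed.

End HeckeRelation.

(** * Eigenvalue systems *)

Section CharacterExtension.
Variables (T : Type) (op : T -> T -> T) (inv : T -> T) (e : T) (F : numClosedFieldType).
Hypotheses (opA : associative op) (opC : commutative op) (op1 : left_id e op) (opV :
  left_inverse e inv op).

Let opACA : interchange op op. Proof. by move=> a b c d;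
  rewrite -!opA [op b _]opA [op b c]opC -opA. Qed.

Let op1r : right_id e op. Proof. by move=> x; rewrite opC op1. Qed.

(** The graph of a homomorphism from a subgroup to F^*; the trivial fibre over e makes it
    single-valued. As graphs, partial characters are ordered by inclusion, as Zorn's lemma
    requires. *)
Definition partial_char (G : set (T * F)) : Prop :=
  [/\ G (e, 1), forall c z d w, G (c, z) -> G (d, w) -> G (op c d, z * w),
      forall c z, G (c, z) -> z != 0 /\ G (inv c, z^-1)
    & forall z, G (e, z) -> z = 1].

Lemma partial_char_uniq G c z w : partial_char G -> G (c, z) -> G (c, w) -> z = w.
Proof.
move=> [_ GM GV G1] Gz Gw; have [z0 GVz] := GV _ _ Gz.
have := GM _ _ _ _ GVz Gw; rewrite opV => /G1 E.
by rewrite -(mulVKf z0 w) E mulr1.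
Qed.

(** Since c^2 is already in the domain H, the new domain is the union of H and Hc, and a square root
    s of the value w at c^2 can serve as the value at c. As Hc = Hc^-1, the new pairs (x, z) are
    those for which x c has the value z s. *)
Lemma partial_char_adjoin G c w : partial_char G -> G (op c c, w) -> (forall z, ~ G (c, z)) ->
  partial_char (G `|` [set p | G (op p.1 c, p.2 * sqrtC w)]).
Proof.
move=> [Ge GM GV G1] Gw nG; have [w0 _] := GV _ _ Gw.
set s := sqrtC w; have s0 : s != 0 by rewrite sqrtC_eq0.
have ss : s * s = w by rewrite -expr2 sqrtCK.
have opVr x : op x (inv x) = e by rewrite opC opV.
have inv_op x y : inv (op x y) = op (inv x) (inv y).
  rewrite -[LHS]op1r -(op1 e) -{1}(opVr x) -(opVr y) opACA opA.
  by rewrite opV op1.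
split.
- by left.
- move=> x z y t [Gx|/= Gx] [Gy|/= Gy].
  + by left; exact: GM.
  + by right; rewrite /= -opA -mulrA; exact: GM.
  + right; rewrite /= [op x y]opC [z * t]mulrC -opA -mulrA; exact: GM.
  + left; have := GM _ _ _ _ Gx Gy; rewrite opACA mulrACA ss => h.
    have [_ GVw] := GV _ _ Gw; have := GM _ _ _ _ h GVw.
    by rewrite -opA opVr op1r mulfK.
- move=> x z [Gx|/= Gx]; first by have [z0 GVx] := GV _ _ Gx; split=> //; left.
  have [zs0 GVx] := GV _ _ Gx.
  have z0 : z != 0 by apply: contraNneq zs0 => ->; rewrite mul0r.
  split=> //; right; rewrite /=.
  have := GM _ _ _ _ GVx Gw; rewrite inv_op -opA [op (inv c) _]opA opV op1.
  by have -> : (z * s)^-1 * w = z^-1 * s by rewrite -ss invfM mulrA mulfVK.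
- move=> z [/G1 //|/= Gc]; rewrite op1 in Gc.
  by case: (nG (z * s)).
Qed.

Lemma char_extension (G : set (T * F)) : partial_char G ->
  (forall c, exists z, G (op c c, z)) ->
  exists psi : T -> F, [/\ forall c d, psi (op c d) = psi c * psi d,
    forall c, psi c != 0 & forall c z, G (c, z) -> psi c = z].
Proof.
move=> pG sqG.
(* Zorn's lemma is applied to the part A added to G, so that the empty chain corresponds to G
   itself. *)
have [A [pA maxA]] : exists A, partial_char (G `|` A) /\ forall B, A `<` B ->
  ~ partial_char (G `|` B).
  apply: (@Zorn_bigcup _ (fun A => partial_char (G `|` A))) => C CP Ct.
  have CU X : C X -> G `|` X `<=` G `|` \bigcup_(X in C) X.
    by move=> CX; apply: setUS; exact: bigcup_sup.
  have [Ge GM GV G1] := pG.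
  have lift p : (G `|` \bigcup_(X in C) X) p -> G p \/ exists2 X, C X & (G `|` X) p.
    by move=> [Gp|[X CX Xp]]; [left|right; exists X => //; right].
  split.
  - by left.
  - move=> c z d w /lift h1 /lift h2; case: h1 h2 => [G1'|[X CX Xp]] [G2|[Y CY Yp]].
    + by left; exact: GM.
    + by apply: (CU _ CY); have [_ YM _ _] := CP _ CY; apply: YM => //; left.
    + by apply: (CU _ CX); have [_ XM _ _] := CP _ CX; apply: XM => //; left.
    + have [XY|YX] := Ct _ _ CX CY.
        apply: (CU _ CY); have [_ YM _ _] := CP _ CY; apply: YM => //.
        by case: Xp; [left|right; exact: XY].
      apply: (CU _ CX); have [_ XM _ _] := CP _ CX; apply: XM => //.
      by case: Yp; [left|right; exact: YX].
  - move=> c z /lift[/GV[z0 GVz]|[X CX Xp]]; first by split=> //; left.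
    have [_ _ XV _] := CP _ CX; have [z0 h] := XV _ _ Xp; split=> //; exact: (CU _ CX).
  - move=> z /lift[/G1 //|[X CX Xp]].
    by have [_ _ _ X1] := CP _ CX; exact: X1.
set H := G `|` A in pA.
have tot c : exists z, H (c, z).
  apply: contrapT => /forallNP nH; have [w Gw] := sqG c.
  have Hw : H (op c c, w) by left.
  have pB := partial_char_adjoin pA Hw nH.
  apply: (maxA (A `|` [set p | H (op p.1 c, p.2 * sqrtC w)])); last by rewrite setUA.
  split; first exact: subsetUl.
  move=> sub; have [_ _ HV _] := pA; have [w0 HVw] := HV _ _ Hw.
  apply: (nH (sqrtC w)); right; apply: sub; right => /=.
  by rewrite -expr2 sqrtCK.
have /choice[psi psiP] := tot.
have [He HM HV H1] := pA.
exists psi; split=> [c d|c|c z Gcz].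
- exact: partial_char_uniq pA (psiP _) (HM _ _ _ _ (psiP c) (psiP d)).
- by have [] := HV _ _ (psiP c).
- by apply: partial_char_uniq pA (psiP _) _; left.
Qed.

End CharacterExtension.

(** * Group laws of the class group *)

Section ClassGroupLaws.
Variable K : fieldExtType rat.
Implicit Types (I J : fracideal K) (c d : classgroup K).

Lemma fracideal_eq I J : (I : set K) = J -> I = J.
Proof.
by case: I J => I hI [J hJ] /= E; move: hI hJ; rewrite E => hI hJ; congr FracIdeal;
  exact: Prop_irrelevance.
Qed.

Lemma idclass_surj c : exists I, idclass I = c.
Proof. by exists (repr c); rewrite /idclass reprK. Qed.

Lemma classmulC : commutative (@classmul K).
Proof.
move=> c d; have [[I <-] [J <-]] := (idclass_surj c, idclass_surj d).
by rewrite !idclassM; congr idclass; apply: fracideal_eq; rewrite /= idmulC.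
Qed.

Lemma classmulA : associative (@classmul K).
Proof.
move=> c d b; have [[[I <-] [J <-]] [L <-]] := (idclass_surj c, idclass_surj d, idclass_surj b).
rewrite !idclassM; congr idclass; apply: fracideal_eq; rewrite /= idmulA //.
  exact: fracideal_submod (fracidealP I).
exact: fracideal_submod (fracidealP J).
Qed.

Lemma classmul1 : left_id (class1 K) (@classmul K).
Proof.
move=> c; have [I <-] := idclass_surj c; rewrite /class1 idclassM; congr idclass.
by apply: fracideal_eq; rewrite /= idmulO //; exact: fracideal_submod (fracidealP I).
Qed.

Definition classinv c : classgroup K := idclass (FracIdeal (fracideal_inv (fracidealP (repr c)))).

Lemma classmulV : left_inverse (class1 K) classinv (@classmul K).
Proof.
move=> c; transitivity (classmul (classinv c) (idclass (repr c))).
  by rewrite /idclass reprK.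
rewrite /classinv idclassM /class1; congr idclass.
by apply: fracideal_eq; rewrite /= idmulC idmul_idinv //; exact: fracidealP.
Qed.

Lemma classmulACA : interchange (@classmul K) (@classmul K).
Proof. by move=> a b c d;
  rewrite -!classmulA [classmul b _]classmulA [classmul b c]classmulC -classmulA. Qed.

Lemma coprime_representative (n : intideal K) c : exists a : fracideal_coprime n,
  idclass (frac_of_coprime a) = c.
Proof.
have [I <-] := idclass_surj c.
have [J [iJ cJ [x x0 JE]]] := coprime_class (intidealP n) (fracidealP I).
exists (FracIdealCoprime (coprime_int (intidealP n) iJ cJ)).
apply/eqmodP; apply/asboolP; exists x^-1; first by rewrite invr_eq0.
rewrite /= JE; apply/seteqP; split=> [y Iy|_ [_ [y Iy <-] <-]]; last by rewrite mulKf.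
by exists (x * y); [exists y|rewrite mulKf].
Qed.

End ClassGroupLaws.

(** * Relations inside the Hecke algebra *)

Section Eigensystems.
Variables (R : realType) (K : fieldExtType rat) (n : intideal K) (m : modpoints).
Local Notation H := (hecke R n m).
Local Notation C := R[i].
Local Notation hT := (hT R n m).
Local Notation hTT := (hTT R m).
Local Notation cls a := (idclass (frac_of_coprime a)).
Local Notation clb b := (idclass (frac_of_int b)).
Implicit Types (l : eigsystem R n m) (t s : H).

(** An eigenvalue system is given as a ring morphism only; its Q-linearity follows by clearing the
    denominator of q. *)
Lemma eigZ l (q : rat) t : l (q *: t) = ratr q * l t.
Proof.
have d0 : ((denq q)%:~R : C) != 0 by rewrite intr_eq0 denq_neq0.
have dq : (denq q)%:~R * ratr q = (numq q)%:~R :> C.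
  by rewrite -[RHS]ratr_int numqE rmorphM /= ratr_int mulrC.
apply: (mulfI d0); rewrite mulrA dq !mulrzl -!raddfMz /=; congr (l _).
by rewrite -!scaler_int scalerA numqE [q * _]mulrC.
Qed.

Lemma hT_mul (a b : intideal K) : exists k (q : 'I_k -> rat)
    (c : 'I_k -> fracideal_coprime n) (d : 'I_k -> intideal K),
  (forall i, idmul (idmul (c i) (c i)) (d i) = idmul a b) /\
  hT a * hT b = \sum_i q i *: (hT (d i) * hTT (c i)).
Proof.
have [k [q [c [d [cd E]]]]] := heckeT_mul R n m a b.
exists k, q, c, d; split=> //; apply: val_inj.
by rewrite raddf_sum /= -[LHS]/(heckeT R n m a * heckeT R n m b) E.
Qed.

Lemma hTT_mul (a b ab : fracideal_coprime n) : ab = idmul a b :> set K ->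
  exists2 q : rat, q != 0 & hTT a * hTT b = q *: hTT ab.
Proof.
rewrite idmulC => E; have [q q0 h] := heckeTT_comp R m E.
by exists q => //; apply: val_inj; apply: lend_ext => P; exact: h.
Qed.

Lemma hTT_unit (a : fracideal_coprime n) : a = ringInt :> set K ->
  exists2 q : rat, q != 0 & hTT a = q *: (1 : H).
Proof.
move=> aE; have fa := proj1 (fracideal_coprimeP a).
exists (fracnorm a ^- 2); first by rewrite invr_eq0 expf_neq0 // fracnorm_neq0.
apply: val_inj; apply: lend_ext => P.
transitivity (heckeTT R m a << P >>) => //; rewrite heckeTT_basis.
have [laL laL' _ _] := pointP P.
have E (X : set (Kh2 R K)) : submod X -> idscale (idinv a) X = X.
  by move=> sX; rewrite aE idinvO; exact: (@sprodO K (Kh2 R K)).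
by rewrite !E; [rewrite mv_id|exact: lattice_submod|exact: lattice_submod].
Qed.

Lemma hT_unit (a : intideal K) : a = ringInt :> set K ->
  exists2 q : rat, q != 0 & hT a = q *: (1 : H).
Proof.
move=> aE; have ia := intidealP a.
exists (intnorm a)%:R^-1; first by rewrite invr_eq0 intnorm_neq0.
apply: val_inj; apply: lend_ext => P.
transitivity (heckeT R n m a << P >>) => //; rewrite heckeT_basis.
have pP := pointP P; have [laL laL' LL' cyL] := pP.
have [sL sL'] := (lattice_submod laL, lattice_submod laL').
have [u [v pb]] := pbasis_exists pP; have [uv lL lL'] := pb.
have -> : hecke_lattices n a (pL P) (pL' P) = [set pL P].
  apply/seteqP; split=> [M hM|_ ->].
    have [lM LM vM lev] := proj1 (hecke_latticesP M ia pP pb) hM.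
    rewrite /= (index_trivial uv lL lM LM) // -aE.
    exact/(index_vol uv lL lM LM ia).
  apply/(hecke_latticesP _ ia pP pb); split=> //.
  by rewrite aE idmulO //; exact: vol_submod.
rewrite fsbig_set1; have -> : sumset (pL P) (pL' P) = pL' P.
  apply/seteqP; split; first by apply: sumset_sub.
  exact: sumsetr.
by rewrite mv_id.
Qed.

End Eigensystems.

(** * Products of homogeneous operators *)

Section Grading.
Variables (R : realType) (K : fieldExtType rat) (n : intideal K) (m : modpoints).
Local Notation H := (hecke R n m).
Local Notation C := R[i].
Local Notation hT := (hT R n m).
Local Notation hTT := (hTT R m).
Local Notation cls a := (idclass (frac_of_coprime a)).
Local Notation clb b := (idclass (frac_of_int b)).
Local Notation "c ** d" := (classmul c d) (at level 40, left associativity).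
Implicit Types (l : eigsystem R n m) (t s : H) (c d : classgroup K).

Definition one_coprime : fracideal_coprime n := FracIdealCoprime
  (coprime_int (intidealP n) (intideal_ringInt K) (idcoprimeO (intidealP n))).

Definition one_ideal : intideal K := IntIdeal (intideal_ringInt K).

Lemma hecke_class_gen a b : hecke_class (hclass a b) (hTT a * hT b : H).
Proof. by exists 1%N, (fun=> 1), (fun=> a), (fun=> b); rewrite big_ord1 scale1r. Qed.

Lemma hecke_class0 c : hecke_class c (0 : H).
Proof.
exists 0%N, (fun=> 0), (fun=> one_coprime), (fun=> one_ideal).
by rewrite big_ord0; split=> // -[].
Qed.

Lemma hecke_classD c t s : hecke_class c t -> hecke_class c s -> hecke_class c (t + s).
Proof.
move=> [k [q [a [b [ab ->]]]]] [k' [q' [a' [b' [ab' ->]]]]].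
exists (k + k')%N, (fun i => match fintype.split i with inl j => q j | inr j => q' j end),
  (fun i => match fintype.split i with inl j => a j | inr j => a' j end),
  (fun i => match fintype.split i with inl j => b j | inr j => b' j end).
split=> [i|]; first by case: (fintype.split i).
by rewrite big_split_ord /=; congr (_ + _); apply: eq_bigr => i _;
  rewrite ?(unsplitK (inl i)) ?(unsplitK (inr i)).
Qed.

Lemma hecke_classZ c r t : hecke_class c t -> hecke_class c (r *: t).
Proof.
move=> [k [q [a [b [ab ->]]]]]; exists k, (fun i => r * q i), a, b; split=> //.
by rewrite scaler_sumr; apply: eq_bigr => i _; rewrite scalerA.
Qed.

Lemma hecke_class_sum c (I : Type) (r : seq I) (F : I -> H) :
  (forall i, hecke_class c (F i)) -> hecke_class c (\sum_(i <- r) F i).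
Proof. by move=> h; apply: big_ind => //; [exact: hecke_class0|exact: hecke_classD]. Qed.

(* Since the eigensystems take values in a commutative ring, this needs the
   Hecke relations but not the commutativity of the Hecke algebra. *)
Lemma hecke_class_mul c d t s : hecke_class c t -> hecke_class d s ->
  exists2 r, hecke_class (c ** d) r & forall l, l r = l t * l s.
Proof.
pose good z := exists2 r, hecke_class (c ** d) r & forall l, l r = l z.
have good_sum (I : finType) (F : I -> H) : (forall i, good (F i)) -> good (\sum_i F i).
  move=> gF; have /choice[r rP] i : exists r, hecke_class (c ** d) r /\ forall l, l r = l (F i).
    by have [r r1 r2] := gF i; exists r.
  exists (\sum_i r i); first by apply: hecke_class_sum => i; case: (rP i).
  move=> l; rewrite !raddf_sum; apply: eq_bigr => i _; case: (rP i) => _; exact.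
have goodZ q z : good z -> good (q *: z).
  by move=> [r r1 r2]; exists (q *: r); [exact: hecke_classZ|move=> l; rewrite !eigZ r2].
have good_gen a b a' b' : hclass a b = c -> hclass a' b' = d ->
    good ((hTT a * hT b) * (hTT a' * hT b')).
  move=> abE abE'.
  have [ca ca'] := (fracideal_coprimeP a, fracideal_coprimeP a').
  pose aa := FracIdealCoprime (coprime_mul (intidealP n) ca ca').
  have [q _ qE] := @hTT_mul R K n m a a' aa erefl.
  have [k [qq [e [f [ef E]]]]] := hT_mul R n m b b'.
  have /choice[ae aeP] i : exists x : fracideal_coprime n, x = idmul aa (e i) :> set K.
    by exists (FracIdealCoprime (coprime_mul (intidealP n) (fracideal_coprimeP aa)
      (fracideal_coprimeP (e i)))).
  have /choice[p pP] i : exists p, hTT aa * hTT (e i) = p *: hTT (ae i).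
    by have [p _ pE] := hTT_mul R m (aeP i); exists p.
  have ggood : good (q *: \sum_i qq i *: (p i *: (hTT (ae i) * hT (f i)))).
    apply: (goodZ); apply: (good_sum) => i; do 2!apply: (goodZ).
    exists (hTT (ae i) * hT (f i)) => //.
    suff -> : c ** d = hclass (ae i) (f i) by exact: hecke_class_gen.
    have aeE : cls (ae i) = (cls a ** cls a') ** cls (e i).
      by rewrite !idclassM; congr idclass; apply: fracideal_eq; rewrite /= aeP.
    have efE : (cls (e i) ** cls (e i)) ** clb (f i) = clb b ** clb b'.
      by rewrite !idclassM; congr idclass; apply: fracideal_eq; rewrite /= ef.
    rewrite -abE -abE' /hclass aeE [LHS]classmulACA -efE.
    by rewrite [(cls a ** cls a) ** _]classmulACA [(cls a ** cls a' ** cls (e i)) **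
      _]classmulACA classmulA.
  have [r r1 r2] := ggood; exists r => // l; rewrite r2 eigZ raddf_sum /=.
  transitivity (l (hTT a * hTT a') * l (hT b * hT b')); last by rewrite !rmorphM /=; ring.
  rewrite qE E eigZ raddf_sum /= -[RHS]mulrA; apply: (congr1 (fun z => ratr q * z)).
  rewrite mulr_sumr; apply: eq_bigr => i _; rewrite !eigZ !rmorphM /=.
  have := congr1 l (pP i); rewrite rmorphM eigZ /= => pE.
  transitivity (ratr (qq i) * ((ratr (p i) * l (hTT (ae i))) * l (hT (f i)))); first by ring.
  by rewrite -pE; ring.
move=> [k [q [a [b [ab ->]]]]] [k' [q' [a' [b' [ab' ->]]]]].
suff [r r1 r2] : good (\sum_i \sum_j q i *: (q' j *: ((hTT (a i) * hT (b i)) * (hTT (a' j) * hT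
  (b' j))))).
  exists r => // l; rewrite r2 !raddf_sum mulr_suml; apply: eq_bigr => i _.
  rewrite raddf_sum mulr_sumr; apply: eq_bigr => j _.
  by rewrite /= !eigZ !rmorphM /=; ring.
by apply: (good_sum) => i; apply: (good_sum) => j; do 2!apply: (goodZ); exact: good_gen.
Qed.

(** T_b for b = O is a nonzero scalar, so T_{a,a} itself is homogeneous, of class [a]^2. *)
Lemma hTT_hT_one (a : fracideal_coprime n) : hclass a one_ideal = cls a ** cls a /\
  exists2 q : rat, q != 0 & hTT a * hT one_ideal = q *: hTT a.
Proof.
split.
  rewrite /hclass !idclassM; congr idclass; apply: fracideal_eq; rewrite /= idmulC idmulO //.
  exact/idmul_submod/fracideal_submod/(proj1 (fracideal_coprimeP a)).
have [q q0 ->] := @hT_unit R K n m one_ideal erefl; exists q => //.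
apply: val_inj; apply: lend_ext => P.
by rewrite -[LHS]/(heckeTT R m a (q *: << P >>)) lendZ.
Qed.

Lemma hT_class (b : intideal K) : exists2 q : rat, q != 0 & hecke_class (clb b) (q *: hT b : H).
Proof.
pose a := one_coprime; have [q q0 E] := @hTT_unit R K n m a erefl; exists q => //.
suff <- : hTT a * hT b = q *: hT b.
  suff <- : hclass a b = clb b by exact: hecke_class_gen.
  rewrite /hclass !idclassM; congr idclass; apply: fracideal_eq => /=.
  by rewrite idmulO ?idmulO //; [exact: intideal_submod (intidealP b)|exact: submod_ringInt].
rewrite E; apply: val_inj; apply: lend_ext => P; by [].
Qed.

Lemma eigchar_neq0 l (a : fracideal_coprime n) : l (hTT a) != 0.
Proof.
have ca := fracideal_coprimeP a; have fa := proj1 ca.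
pose a' := FracIdealCoprime (coprime_inv ca).
have [|q q0 E] := @hTT_mul R K n m a a' one_coprime; first by rewrite /= idmul_idinv.
have [q' q'0 E'] := @hTT_unit R K n m one_coprime erefl.
have := congr1 l E; rewrite E' rmorphM scalerA eigZ rmorph1 mulr1 /= => h.
apply/eqP => l0; move: h; rewrite l0 mul0r => /esym/eqP.
by rewrite fmorph_eq0 mulf_eq0 (negbTE q0) (negbTE q'0).
Qed.

End Grading.

(** * Eigenvalue systems that agree on the principal operators *)

Section SameRestriction.
Variables (R : realType) (K : fieldExtType rat) (n : intideal K) (m : modpoints).
Local Notation H := (hecke R n m).
Local Notation C := R[i].
Local Notation hT := (hT R n m).
Local Notation hTT := (hTT R m).
Local Notation cls a := (idclass (frac_of_coprime a)).
Local Notation clb b := (idclass (frac_of_int b)).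
Local Notation "c ** d" := (classmul c d) (at level 40, left associativity).
Variables l1 l2 : eigsystem R n m.
Hypothesis eq_principal : forall t : H, hecke_principal t -> l1 t = l2 t.
Implicit Types (t s : H) (c d : classgroup K).

Definition ratio_graph : set (classgroup K * C) :=
  [set p | exists t, [/\ hecke_class p.1 t, l1 t != 0 & l2 t = p.2 * l1 t]].

(* Multiplying by T_{a,a} with [a] = c^-1 moves the class c to c^-1. *)
Lemma hecke_class_inv c t : hecke_class c t -> exists s, exists a : fracideal_coprime n,
  [/\ hecke_class (classinv c) s, forall l : eigsystem R n m, l s = l (hTT a) * l t &
    l1 t * l1 s = l2 t * l2 s].
Proof.
move=> ct; have [a aE] := coprime_representative n (classinv c).
have [cE [q q0 E]] := hTT_hT_one R m a.
have cTT : hecke_class (cls a ** cls a) (hTT a : H).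
  have -> : hTT a = q^-1 *: (hTT a * hT (one_ideal K)) by rewrite E scalerA mulVf // scale1r.
  by rewrite -cE; apply: hecke_classZ; exact: hecke_class_gen.
have [s sc sE] := hecke_class_mul cTT ct.
have cV : (cls a ** cls a) ** c = classinv c.
  by rewrite aE -classmulA classmulV classmulC classmul1.
rewrite cV in sc; exists s, a; split=> //.
have [r rc rE] := hecke_class_mul ct sc.
rewrite -!rE; apply: eq_principal; rewrite /hecke_principal.
by rewrite -(classmulV c) classmulC.
Qed.

(** The element s of [hecke_class_inv] turns its identity into lambda_1(T_{a,a}) lambda_1(t)^2 =
    lambda_2(T_{a,a}) lambda_2(t)^2, and both characters are nonzero at a. *)
Lemma eig_neq0 c t : hecke_class c t -> (l1 t != 0) = (l2 t != 0).
Proof.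
move=> /hecke_class_inv[s [a [_ sE E]]].
have [x1 x2] := (eigchar_neq0 l1 a, eigchar_neq0 l2 a).
move: E; rewrite !sE => E; congr (~~ _); apply/eqP/eqP => l0.
  by move/esym/eqP: E; rewrite l0 !mul0r !mulf_eq0 (negbTE x2) /= orbb => /eqP.
by move/eqP: E; rewrite l0 !mul0r !mulf_eq0 (negbTE x1) /= orbb => /eqP.
Qed.

Lemma ratio_graph_partial_char : partial_char (@classmul K) (@classinv K) (class1 K) ratio_graph.
Proof.
split.
- have [q q0 cq] := @hT_class R K n m (one_ideal K).
  have [q' q'0 E] := @hT_unit R K n m (one_ideal K) erefl.
  exists (q *: hT (one_ideal K)); split=> /=.
  + suff <- : clb (one_ideal K) = class1 K by [].
    by congr idclass; exact: fracideal_eq.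
  + by rewrite E !eigZ rmorph1 mulr1 mulf_neq0 // fmorph_eq0.
  + by rewrite E !eigZ !rmorph1 mul1r.
- move=> c z d w [t [/= ct t0 tE]] [s [/= ds s0 sE]].
  have [r rc rE] := hecke_class_mul ct ds; exists r; split=> //=.
    by rewrite rE mulf_neq0.
  by rewrite !rE tE sE mulrACA.
- move=> c z [t [/= ct t0 tE]].
  have z0 : z != 0.
    have := t0; rewrite (eig_neq0 ct) tE mulf_eq0 negb_or => /andP[]//.
  split=> //; have [s [a [sc sE E]]] := hecke_class_inv ct.
  have s0 : l1 s != 0 by rewrite sE mulf_neq0 // eigchar_neq0.
  (* l1 t l1 s = l2 t l2 s = z l1 t l2 s, hence l2 s = z^-1 l1 s. *)
  exists s; split=> //=; apply: (mulfI t0); rewrite mulrCA E tE.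
  by rewrite -[z * _ * _]mulrA mulKf.
- move=> z [t [/= ct t0 tE]]; apply: (mulIf t0); rewrite mul1r -tE.
  by rewrite (eq_principal ct).
Qed.

Lemma ratio_graph_square (a : fracideal_coprime n) z : l2 (hTT a) = z * l1 (hTT a) ->
  ratio_graph (cls a ** cls a, z).
Proof.
move=> E; have [cE [q q0 qE]] := hTT_hT_one R m a.
exists (hTT a * hT (one_ideal K)); split=> /=.
- by rewrite -cE; exact: hecke_class_gen.
- by rewrite qE eigZ mulf_neq0 ?fmorph_eq0 // eigchar_neq0.
- by rewrite qE !eigZ E mulrCA.
Qed.

Lemma twist_exists : exists psi : unramified_char R K, is_twist l1 psi l2.
Proof.
have [|psi [psiM psi0 psiE]] := char_extension (@classmulA K) (@classmulC K) (@classmul1 K)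
  (@classmulV K) ratio_graph_partial_char.
  move=> c; have [a <-] := coprime_representative n c; exists (l2 (hTT a) / l1 (hTT a)).
  by apply: ratio_graph_square; rewrite divfK // eigchar_neq0.
exists (UnramifiedChar psiM psi0); split=> [b|a] /=; last first.
  (* psi([a])^2 = psi([a]^2), and [a]^2 lies in the domain of the quotient, with value chi_2(a) /
     chi_1(a). *)
  rewrite expr2 -psiM (psiE _ (l2 (hTT a) / l1 (hTT a))); first by rewrite divfK // eigchar_neq0.
  by apply: ratio_graph_square; rewrite divfK // eigchar_neq0.
have [q q0 cq] := @hT_class R K n m b.
have qC : ratr q != 0 :> C by rewrite fmorph_eq0.
have [l0|l0] := eqVneq (l1 (hT b)) 0.
  (* Outside the support of lambda_1 the operator T_b, homogeneous up to a nonzero factor, is killed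
     by lambda_2 as well, whatever the extension psi is there. *)
  have := eig_neq0 cq; rewrite !eigZ l0 !mulr0 eqxx mulf_eq0 fmorph_eq0 (negbTE q0) /=.
  by move/esym/negbFE/eqP => ->.
rewrite (psiE _ (l2 (hT b) / l1 (hT b))); first by rewrite divfK.
exists (q *: hT b); split=> //=; first by rewrite eigZ mulf_neq0.
by rewrite !eigZ mulrCA divfK.
Qed.

End SameRestriction.

(** On T_{a,a} T_b the twist multiplies by psi([a]^2 [b]), which is psi(1) = 1 in the principal
    class. *)
Lemma twist_principal (R : realType) (K : fieldExtType rat) (n : intideal K)
    (m : modpoints) (l1 l2 : eigsystem R n m) (psi : unramified_char R K) :
  is_twist l1 psi l2 -> forall t : hecke R n m, hecke_principal t -> l1 t = l2 t.
Proof.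
move=> [twT twTT] t [k [q [a [b [ab ->]]]]].
have psi1 : psi (class1 K) = 1.
  case: psi {twT twTT} => psi psiM psi0 /=; apply: (mulIf (psi0 (class1 K))).
  by rewrite -psiM classmul1 mul1r.
have psiM c d : psi (classmul c d) = psi c * psi d by case: psi {twT twTT psi1}.
rewrite !raddf_sum; apply: eq_bigr => i _; rewrite /= !eigZ !rmorphM /= twT twTT.
have := congr1 psi (ab i); rewrite /hclass !psiM psi1 => E.
congr (_ * _).
transitivity ((psi (idclass (frac_of_coprime (a i))) * psi (idclass (frac_of_coprime (a i))) *
  psi (idclass (frac_of_int (b i)))) * (l1 (hTT R m (a i)) * l1 (hT R n m (b i)))); last by ring.
by rewrite E mul1r.
Qed.

Theorem theorem5p1 (R : realType) (K : fieldExtType rat) (n : intideal K)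
    (m : modpoints) (l1 l2 : eigsystem R n m) :
  ((forall t : hecke R n m, hecke_principal t -> l1 t = l2 t) <->
   exists psi : unramified_char R K, is_twist l1 psi l2) /\
  (forall psi : unramified_char R K, is_twist l1 psi l2 ->
     (forall a : fracideal_coprime n,
        eigchar l2 a = eigchar l1 a * psi (idclass (frac_of_coprime a)) ^+ 2) /\
     ((forall a : fracideal_coprime n, eigchar l1 a = eigchar l2 a) <->
      (forall c : classgroup K, psi c ^+ 2 = 1))).
Proof.
split; first by split=> [/twist_exists //|[psi]]; exact: twist_principal.
move=> psi [twT twTT].
have chiE a : eigchar l2 a = eigchar l1 a * psi (idclass (frac_of_coprime a)) ^+ 2.
  by rewrite /eigchar twTT mulrC.
split=> //; split=> [eq_chi c|psi2 a]; last by rewrite chiE psi2 mulr1.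
(* Every class has a representative a prime to n, and chi_1(a) is nonzero and can be cancelled. *)
have [a <-] := coprime_representative n c.
by apply: (mulfI (eigchar_neq0 l1 a)); rewrite -[LHS]chiE -[LHS]eq_chi mulr1.
Qed.
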